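(* Let $d\ge1$, let $\Xi\subset\mathbb{R}^d$ be any open connected domain such that $$(1,\infty)^d\subset\Xi\subset(0,\infty)^d,$$ and let $f\in\mathcal{D}'(\mathbb{R}^d)$. Then the Toeplitz operator $\Theta_f\colon L^2(\Xi)\to L^2(\Xi)$ is bounded if and only if $f$ is a tempered distribution and $\|\hat f\|_{L^\infty(\mathbb{R}^d)}<\infty$, and in this case $$\|\Theta_f\|=\|\hat f\|_{L^\infty}.$$
   Context: For $\Xi$ as in the claim one has $\Xi-\Xi=\{x-y:x,y\in\Xi\}=\mathbb{R}^d$. For $f\in\mathcal{D}'(\mathbb{R}^d)$ the general domain Toeplitz operator is formally $\Theta_f(g)(x)=\int_\Xi f(x-y)g(y)\,dy$, $x\in\Xi$. Precisely, for $\varphi\in C_c^\infty(\Xi)$ and $x\in\Xi$, $\Theta_f(\varphi)(x)=(f,\varphi(x-\cdot))$, where $(f,\cdot)$ denotes the (bilinear) action of $f$ on test functions. Set $\|\Theta_f\|=\sup\{\|\Theta_f\varphi\|_{L^2(\Xi)}/\|\varphi\|_{L^2(\Xi)}:\varphi\in C_c^\infty(\Xi),\varphi\ne0\}$; $\Theta_f$ is called bounded (on $L^2(\Xi)$) if $\|\Theta_f\|<\infty$. The Fourier transform is $\hat g(\xi)=\int_{\mathbb{R}^d}g(x)e^{-2\pi i x\cdot\xi}\,dx$, extended to tempered distributions; $\|\hat f\|_{L^\infty}<\infty$ means that the tempered distribution $\hat f$ is given by an $L^\infty$ function. *)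

(* Defs.v *)
From HB Require Import structures.
From mathcomp Require Import all_boot all_order all_algebra.
From mathcomp Require Export complex.
From mathcomp Require Import all_classical all_reals all_analysis.
Set Implicit Arguments.
Unset Strict Implicit.
Unset Printing Implicit Defensive.
Import Order.TTheory GRing.Theory Num.Theory.
Import numFieldNormedType.Exports.
Local Open Scope classical_set_scope.
Local Open Scope ring_scope.

(* R^d is 'rV[R]_d, with the product sigma-algebra of the Borel sets of R
   (that is, the Borel sets of R^d). *)
Fact row_display : measure_display.
Proof. exact: default_measure_display. Qed.

Section measurable_row.
Variables (R : realType) (d : nat).

Let coord (i : 'I_d) (x : 'rV[R]_d) : measurableTypeR R := x ord0 i.

Let row_set0 : g_sigma_preimage coord set0.
Proof. exact: sigma_algebra0. Qed.

Let row_setC A : g_sigma_preimage coord A -> g_sigma_preimage coord (~` A).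
Proof. exact: sigma_algebraC. Qed.

Let row_bigcup (F : (set 'rV[R]_d)^nat) :
  (forall i, g_sigma_preimage coord (F i)) ->
  g_sigma_preimage coord (\bigcup_i (F i)).
Proof. exact: sigma_algebra_bigcup. Qed.

HB.instance Definition _ :=
  @isMeasurable.Build row_display
    'rV[R]_d (g_sigma_preimage coord) row_set0 row_setC row_bigcup.
End measurable_row.

Section lebesgue_row.
Variable R : realType.
Local Notation RT := (measurableTypeR R).

Definition row_cons n (p : 'rV[R]_n * RT) : 'rV[R]_n.+1 :=
  row_mx (const_mx p.2 : 'rV[R]_1) p.1.

Lemma row_consEl n p (j : 'I_1) : @row_cons n p ord0 (lshift n j) = p.2.
Proof. by rewrite -[LHS]/(row_mx _ _ _ _) row_mxEl mxE. Qed.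

Lemma row_consEr n p (j : 'I_n) : @row_cons n p ord0 (rshift 1 j) = p.1 ord0 j.
Proof. by rewrite -[LHS]/(row_mx _ _ _ _) row_mxEr. Qed.

Lemma measurable_row_coord n (i : 'I_n) :
  measurable_fun [set: 'rV[R]_n] (fun x : 'rV[R]_n => x ord0 i : RT).
Proof.
move=> _ Y mY; rewrite setTI; apply: sub_sigma_algebra => /=.
rewrite -bigcup_seq/=; exists i => /=; first by rewrite mem_index_enum.
by exists Y => //; rewrite setTI.
Qed.

Lemma measurable_row_cons n : measurable_fun setT (@row_cons n).
Proof.
apply: (@measurability _ _ _ _ _ _ (\big[setU/set0]_(i < n.+1)
  preimage_set_system setT (fun x : 'rV[R]_n.+1 => x ord0 i : RT) measurable)) => //.
move=> _ [B + <-]; rewrite -bigcup_seq /= => -[i _ [C mC <-]].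
rewrite !setTI -[X in measurable X]setTI.
have [j ij|j ij] := @split_ordP 1 n i.
  rewrite (_ : _ @^-1` _ = snd @^-1` C); first exact: measurable_snd.
  apply/seteqP; split=> -[x y] /=; by rewrite ij row_consEl.
rewrite (_ : _ @^-1` _ = fst @^-1` ((fun x : 'rV[R]_n => x ord0 j : RT) @^-1` C)).
  apply: measurable_fst => //; rewrite -[X in measurable X]setTI.
  exact: measurable_row_coord.
by apply/seteqP; split=> -[x y] /=; rewrite ij row_consEr.
Qed.

Section lebesgue_row_cons.
Variables (n : nat) (m : {measure set 'rV[R]_n -> \bar R}).

Definition lebesgue_row_cons : set 'rV[R]_n.+1 -> \bar R :=
  pushforward (m \x lebesgue_measure)%E (@row_cons n).

Let lebesgue_row_cons0 : lebesgue_row_cons set0 = 0%E.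
Proof. exact: (measure0 (m \x lebesgue_measure)%E). Qed.

Let lebesgue_row_cons_ge0 A : (0 <= lebesgue_row_cons A)%E.
Proof. exact: (measure_ge0 (m \x lebesgue_measure)%E). Qed.

Let lebesgue_row_cons_sigma_additive : semi_sigma_additive lebesgue_row_cons.
Proof.
apply: (@measure_semi_sigma_additive _ _ _ (pushforward _ _)).
exact: measurable_row_cons.
Qed.

HB.instance Definition _ := isMeasure.Build _ _ _ lebesgue_row_cons
  lebesgue_row_cons0 lebesgue_row_cons_ge0 lebesgue_row_cons_sigma_additive.
End lebesgue_row_cons.

Fixpoint lebesgue_row n : {measure set 'rV[R]_n -> \bar R} :=
  if n is m.+1 then lebesgue_row_cons (lebesgue_row m)
  else \d_(0 : 'rV[R]_0).
End lebesgue_row.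

Section distributions.
Variables (R : realType) (d : nat).
Local Notation V := 'rV[R]_d.
Local Notation mu := (@lebesgue_row R d).
Implicit Types (phi psi h : V -> R[i]) (f u T : (V -> R[i]) -> R[i]).

Local Notation cabs := (@ComplexField.Normc.normc R).

(* The derivative D_j1 (... (D_jk g)) for s = [:: j1; ...; jk]. *)
Definition partial (s : seq 'I_d) (g : V -> R) : V -> R :=
  foldr (fun j g' => 'D_(delta_mx ord0 j) g') g s.

Definition real_smooth (g : V -> R) := forall s : seq 'I_d,
  continuous (partial s g) /\
  forall x j, derivable (partial s g) x (delta_mx ord0 j).

(* Topology, differentiation and integration of complex-valued functions are
   taken componentwise, as R[i] has no normed R-module structure. *)
Definition smooth phi :=
  real_smooth (@complex.Re R \o phi) /\ real_smooth (@complex.Im R \o phi).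

Definition cpartial (s : seq 'I_d) phi (x : V) : R[i] :=
  (partial s (@complex.Re R \o phi) x +i* partial s (@complex.Im R \o phi) x)%C.

Definition cmeasurable phi :=
  measurable_fun setT (@complex.Re R \o phi) /\
  measurable_fun setT (@complex.Im R \o phi).

Definition cintegral phi : R[i] :=
  (\int[mu]_(x in setT) complex.Re (phi x) +i*
   \int[mu]_(x in setT) complex.Im (phi x))%C.

Definition csupport phi : set V := closure [set x | phi x != 0].

(* C_c^oo(Omega); its elements are functions on R^d, extended by 0. *)
Definition test_function (Omega : set V) phi :=
  [/\ smooth phi, compact (csupport phi) & csupport phi `<=` Omega].

(* sup of (1 + |x|)^k |D^s phi(x)| over x and over derivatives of order at
   most N; here |x| is the maximum norm. *)
Definition seminorm (k N : nat) phi : \bar R :=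
  ereal_sup [set y | exists (x : V) (s : seq 'I_d), (size s <= N)%N /\
    y = ((1 + `|x|) ^+ k * cabs (cpartial s phi x))%:E].

Definition schwartz phi :=
  smooth phi /\ forall k N : nat, (seminorm k N phi < +oo)%E.

Definition linear_on (D : set (V -> R[i])) u :=
  forall (a : R[i]) phi psi, D phi -> D psi ->
    u (fun x => a * phi x + psi x) = a * u phi + u psi.

(* Distributions and tempered distributions are total maps u of which only the
   values on C_c^oo(R^d), respectively on the Schwartz space, are meaningful. *)
Definition is_distribution u :=
  linear_on (test_function setT) u /\
  forall K : set V, compact K -> exists (C : R) (N : nat), forall phi,
    test_function setT phi -> csupport phi `<=` K ->
    ((cabs (u phi))%:E <= C%:E * seminorm 0 N phi)%E.

Definition is_tempered u :=
  linear_on schwartz u /\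
  exists (C : R) (k N : nat), forall phi, schwartz phi ->
    ((cabs (u phi))%:E <= C%:E * seminorm k N phi)%E.

(* "f is a tempered distribution": T is its continuous extension to the
   Schwartz space (unique there, by density). *)
Definition tempered_extension f T :=
  is_tempered T /\ forall phi, test_function setT phi -> T phi = f phi.

Definition dotr (x y : V) : R := \sum_(i < d) x ord0 i * y ord0 i.

Definition fourier phi (xi : V) : R[i] :=
  cintegral (fun x => phi x *
    (cos (2 * pi * dotr x xi) -i* sin (2 * pi * dotr x xi))%C).

Definition fourier_tempered u : (V -> R[i]) -> R[i] := u \o fourier.

Definition given_by u h :=
  forall phi, schwartz phi -> u phi = cintegral (fun x => h x * phi x).

Definition Linfty_norm h : \bar R := Lnorm mu +oo (fun x => (cabs (h x))%:E).

Definition Linfty h := cmeasurable h /\ (Linfty_norm h < +oo)%E.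

Definition L2_norm (Xi : set V) phi : \bar R :=
  Lnorm mu 2%:E ((fun x => (cabs (phi x))%:E) \_ Xi).

Definition toeplitz f phi (x : V) : R[i] := f (fun y => phi (x - y)).

Definition toeplitz_norm (Xi : set V) f : \bar R :=
  ereal_sup [set (L2_norm Xi (toeplitz f phi) / L2_norm Xi phi)%E |
    phi in [set phi | test_function Xi phi /\ phi <> cst 0]].

Definition toeplitz_bounded (Xi : set V) f := (toeplitz_norm Xi f < +oo)%E.

End distributions.

(* Main.v *)
Require Import Defs.
From HB Require Import structures.
From mathcomp Require Import all_boot all_order all_algebra.
From mathcomp Require Import complex ring lra.
From mathcomp Require Import all_classical all_reals all_analysis.
From mathcomp Require Import measurable_realfun ess_sup_inf.
Set Implicit Arguments.
Unset Strict Implicit.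
Unset Printing Implicit Defensive.
Import Order.TTheory GRing.Theory Num.Theory.
Import numFieldNormedType.Exports.
Local Open Scope classical_set_scope.
Local Open Scope ring_scope.

(** Write $h=\hat f$. For a test function [phi], [toeplitz f phi] is the convolution $f*\varphi$
    restricted to $\Xi$. If $h$ is bounded, [toeplitz_fourier] writes its value at $x$ as the
    Fourier transform of $h\hat\varphi$ at $-x$. Two uses of the Plancherel inequality
    ([plancherel_le]) then bound the operator norm by the essential supremum of $|h|$
    ([toeplitz_norm_le]).

    Conversely, let the norm on $\Xi$ be at most $M$. Convolution with $f$ commutes with
    translations, and $\Xi$ contains a translate of every cube. Moving both the test function and
    the window of integration far into the orthant gives the same bound $M$ on all of $\mathbb{R}^d$
    ([sqnorm_toeplitz]). Let $p\ge0$ be a test function of integral at most 1, and let $u=f*p$, a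
    continuous function. For a real test function $\chi$, the Fourier transform at $\xi$ of $u$
    times the autocorrelation of $\chi$ is the pairing of $f*p*\varphi$ with $\psi$, where
    $\varphi,\psi$ are $\chi$ modulated by $\pm\xi$. It is therefore at most $M\int\chi^2$
    ([toeplitz_fourier_bound]). Dilating $\chi$ flattens the normalised autocorrelation to 1, so $u$
    is a pointwise limit of functions whose transforms are bounded by $M$. A weak-star limit
    ([weak_star]) gives a density bounded by $M$ for $u$ ([spectral_density_mollified]). Letting $p$
    shrink to the Dirac mass, a second weak-star limit gives $h$ with $|h|\le M$ and
    $f(\varphi)=\int h(z)\hat\varphi(-z)\,dz$ ([spectral_density]).

    Such an $h$ is unique almost everywhere ([spectral_zero]). Hence every bounded function
    representing $\hat f$ has essential supremum at most $M$ ([symbol_le]), which is the remaining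
    inequality of norms. The integral formula for $f$ makes sense on Schwartz functions and defines
    the tempered extension ([symbol_extension]).

    Two tools carry the analysis. Fourier inversion and Plancherel come from Abel summation with the
    factor $\prod_i e^{-\varepsilon|x_i|}$, whose transform is a product of Poisson kernels. The
    exchange of $f$ with an integral ([toeplitz_interchange]) comes from cutting the integrand into
    pieces of small diameter. *)

(** * Measurability, boxes and sigma-finiteness for Lebesgue measure on row vectors *)

Section row_measurability.
Context {R : realType}.
Local Notation RT := (measurableTypeR R).

Lemma measurable_rowP n d' (T : measurableType d') (g : T -> 'rV[R]_n) :
  (forall i, measurable_fun setT (fun t => g t ord0 i)) -> measurable_fun setT g.
Proof.
move=> mg; apply: (@measurability _ _ _ _ _ _ (\big[setU/set0]_(i < n)
  preimage_set_system setT (fun x : 'rV[R]_n => x ord0 i : RT) measurable)) => //.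
move=> _ [B + <-]; rewrite -bigcup_seq /= => -[i _ [C mC <-]].
by rewrite !setTI -[X in measurable X]setTI; exact: mg.
Qed.

Lemma measurable_coord n (i : 'I_n) :
  measurable_fun setT (fun x : 'rV[R]_n => x ord0 i).
Proof. exact: measurable_row_coord. Qed.

Lemma measurable_rect n (A : 'I_n -> set R) : (forall i, measurable (A i)) ->
  measurable [set x : 'rV[R]_n | forall i, A i (x ord0 i)].
Proof.
move=> mA; rewrite (_ : mkset _ =
    \bigcap_(i in [set` index_enum 'I_n]) ((fun x : 'rV[R]_n => x ord0 i) @^-1` A i)).
  apply: fin_bigcap_measurable => // i _.
  by rewrite -[X in measurable X]setTI; exact: measurable_coord.
apply/seteqP; split=> x /= h i; first by move=> _; exact: h.
by apply: h; rewrite /= mem_index_enum.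
Qed.

Lemma lebesgue_row_rect n (A : 'I_n.+1 -> set R) : (forall i, measurable (A i)) ->
  lebesgue_row R n.+1 [set x | forall i, A i (x ord0 i)] =
  (lebesgue_row R n [set x | forall i, A (@rshift 1 n i) (x ord0 i)] *
   lebesgue_measure (A (@lshift 1 n ord0)))%E.
Proof.
move=> mA; have mB : measurable
    [set x : 'rV[R]_n | forall i, A (@rshift 1 n i) (x ord0 i)].
  exact: (@measurable_rect n (fun i => A (@rshift 1 n i))).
rewrite -(product_measure1E (lebesgue_row R n) lebesgue_measure mB (mA _)).
rewrite [LHS]/(lebesgue_row_cons _ _) /lebesgue_row_cons/pushforward/=.
congr (_ _); apply/seteqP; split => -[x t] /=.
  move=> h; split=> [i|]; first by have := h (@rshift 1 n i); rewrite row_consEr.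
  by have := h (@lshift 1 n ord0); rewrite row_consEl.
move=> [h1 h2] i; have [j ij|j ij] := @split_ordP 1 n i; rewrite ij.
  by rewrite row_consEl /= (ord1 j).
by rewrite row_consEr.
Qed.

Definition cube n (k : R) : set 'rV[R]_n := [set x | forall i, `|x ord0 i| <= k].
Arguments cube : clear implicits.

Lemma cubeE n (k : R) : cube n k = [set x | forall i, `[- k, k]%classic (x ord0 i)].
Proof.
by apply/seteqP; split=> x /= h i; have := h i; rewrite /= in_itv/= ler_norml.
Qed.

Lemma measurable_cube n k : measurable (cube n k).
Proof.
rewrite cubeE; apply: (@measurable_rect n (fun=> `[- k, k]%classic)) => i.
exact: measurable_itv.
Qed.

Lemma lebesgue_row_rect_lty n (A : 'I_n -> set R) : (forall i, measurable (A i)) ->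
  (forall i, (lebesgue_measure (A i) < +oo)%E) ->
  (lebesgue_row R n [set x | forall i, A i (x ord0 i)] < +oo)%E.
Proof.
elim: n A => [A mA _|n IH A mA hA].
  by rewrite /= diracE ltry.
rewrite lebesgue_row_rect// lte_mul_pinfty//.
  by rewrite ge0_fin_numE//; exact: (IH (fun i => A (@rshift 1 n i))).
Qed.

Lemma cube_lty n k : (lebesgue_row R n (cube n k) < +oo)%E.
Proof.
rewrite cubeE; apply: (@lebesgue_row_rect_lty n (fun=> `[- k, k]%classic)) => i.
  exact: measurable_itv.
by rewrite lebesgue_measure_itv/=; case: ifP => _; rewrite ?ltry.
Qed.

Lemma cube_cover n : \bigcup_k cube n k%:R = setT.
Proof.
apply/seteqP; split => // x _; have [k hk] : exists k : nat, \sum_i `|x ord0 i| <= k%:R.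
  exists (Num.truncn (\sum_i `|x ord0 i|)).+1; apply/ltW; exact: truncnS_gt.
exists k => // i; apply: le_trans hk.
by rewrite (bigD1 i)//= lerDl; apply: sumr_ge0.
Qed.

Lemma sigma_finite_lebesgue_row n : sigma_finite setT (lebesgue_row R n).
Proof.
exists (fun k => cube n k%:R); first by rewrite cube_cover.
by move=> k; split; [exact: measurable_cube|exact: cube_lty].
Qed.

End row_measurability.
Arguments cube {R} n k.

(** * Tonelli and Fubini for sigma-finite measures *)

Section sigma_finite_tonelli.
Context d1 d2 (T1 : measurableType d1) (T2 : measurableType d2) {R : realType}.

(** [lebesgue_row] is defined by recursion as a plain measure, while the product theorems ask for a
    sigma-finite structure. Repacking yields an equal measure that carries it and can be substituted
    in a goal. *)
Lemma sigma_finite_packed d (T : measurableType d) (m : {measure set T -> \bar R}) :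
  sigma_finite setT m ->
  exists m' : {sigma_finite_measure set T -> \bar R}, m = m'.
Proof.
case: m => f c sf.
pose m : {measure set T -> \bar R} := Measure.Pack c.
pose H1 := isSFinite.Build _ _ _ f (@sfinite_measure_sigma_finite _ _ _ m sf).
pose H2 := isSigmaFinite.Build _ _ _ f sf.
pose m' := HB.pack_for (SigmaFiniteMeasure.type T R) f c H1 H2.
by exists m'.
Qed.

Variables (m1 : {measure set T1 -> \bar R}) (m2 : {measure set T2 -> \bar R}).
Hypotheses (s1 : sigma_finite setT m1) (s2 : sigma_finite setT m2).
Variable f : T1 * T2 -> \bar R.
Hypothesis mf : measurable_fun setT f.

Lemma sf_fubini_tonelli : (forall z, 0 <= f z)%E ->
  (\int[m1]_x \int[m2]_y f (x, y) = \int[m2]_y \int[m1]_x f (x, y))%E.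
Proof.
move=> f0; have [m1' ->] := sigma_finite_packed s1.
by have [m2' ->] := sigma_finite_packed s2; exact: fubini_tonelli.
Qed.

Lemma sf_measurable_tonelli : (forall z, 0 <= f z)%E ->
  measurable_fun setT (fun x => \int[m2]_y f (x, y))%E.
Proof.
move=> f0.
by have [m2' ->] := sigma_finite_packed s2; exact: measurable_fun_fubini_tonelli_F.
Qed.

Hypothesis ltyf : (\int[m1]_x \int[m2]_y `|f (x, y)| < +oo)%E.

Lemma sf_fubini : 
  (\int[m1]_x \int[m2]_y f (x, y) = \int[m2]_y \int[m1]_x f (x, y))%E.
Proof.
move: ltyf; have [m1' ->] := sigma_finite_packed s1.
have [m2' ->] := sigma_finite_packed s2 => h; apply: Fubini.
exact/integrable12ltyP.
Qed.

Lemma sf_fubini_integrable : (forall x, m2.-integrable setT (fun y => f (x, y))) ->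
  m1.-integrable setT (fun x => \int[m2]_y f (x, y))%E.
Proof.
move: ltyf; have [m1' ->] := sigma_finite_packed s1.
have [m2' ->] := sigma_finite_packed s2 => h _; apply: integrable_fubini_F.
exact/integrable12ltyP.
Qed.

End sigma_finite_tonelli.

(** * Affine change of variables for nonnegative integrands *)

Section affine_change.
Context {R : realType}.
Local Notation RT := (measurableTypeR R).
Local Notation leb := (@lebesgue_measure R).
Local Open Scope ereal_scope.

(** Uniqueness of Lebesgue measure: $|a|$ times its image under $x\mapsto ax+b$ gives each interval
    $]p,q]$ its length. For $a<0$ the preimage is closed at the other end, which does not change its
    measure. *)
Lemma ge0_integral_affineR (a b : R) (f : RT -> \bar R) : a != 0%R ->
  measurable_fun setT f -> (forall x, 0 <= f x) ->
  \int[leb]_x f x = `|a|%:E * \int[leb]_x f (a * x + b)%R.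
Proof.
move=> a0 mf f0; pose phi : RT -> RT := fun x => (a * x + b)%R.
have mphi : measurable_fun setT phi.
  by apply: measurable_funD => //; exact: measurable_funM.
pose c : {nonneg R}%R := NngNum (normr_ge0 a).
pose m0 : {measure set RT -> \bar R} := mscale c (pushforward leb phi).
pose m := m0 mphi.
have lebm A : measurable A -> leb A = m A.
  apply: lebesgue_measure_unique => _ [[p q]] _ <-.
  transitivity ((`|a|)%:E * leb (phi @^-1` `]p, q]%classic)); last by [].
  have [an|ap|/eqP] := ltgtP a 0%R; last by rewrite (negbTE a0).
  - rewrite (_ : phi @^-1` _ = `[((q - b) / a)%R, ((p - b) / a)%R[%classic); last first.
      apply/seteqP; split=> x /=; rewrite !in_itv/= /phi;
      rewrite ler_ndivrMr// ltr_ndivlMr// => /andP[h1 h2]; apply/andP; split; lra.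
    rewrite !lebesgue_measure_itv/= !lte_fin ltr_nM2r ?invr_lt0// ltrD2r.
    case: ifPn => // _; last by rewrite mule0.
    rewrite -!EFinB -EFinM ltr0_norm//; congr EFin.
    by field.
  - rewrite (_ : phi @^-1` _ = `]((p - b) / a)%R, ((q - b) / a)%R]%classic); last first.
      apply/seteqP; split=> x /=; rewrite !in_itv/= /phi;
      rewrite ler_pdivlMr// ltr_pdivrMr// => /andP[h1 h2]; apply/andP; split; lra.
    rewrite !lebesgue_measure_itv/= !lte_fin ltr_pM2r ?invr_gt0// ltrD2r.
    case: ifPn => // _; last by rewrite mule0.
    rewrite -!EFinB -EFinM gtr0_norm//; congr EFin.
    by field.
rewrite (@eq_measure_integral _ _ _ _ m); last by move=> A mA _; exact: lebm.
rewrite ge0_integral_mscale//=; congr (_ * _).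
by rewrite ge0_integral_pushforward.
Qed.

Lemma ge0_integral_row_cons n (f : 'rV[R]_n.+1 -> \bar R) :
  measurable_fun setT f -> (forall x, 0 <= f x) ->
  \int[lebesgue_row R n.+1]_x f x =
  \int[lebesgue_row R n]_x \int[leb]_t f (row_cons (x, t)).
Proof.
move=> mf f0.
rewrite [LHS]/(integral (pushforward (lebesgue_row R n \x leb) (@row_cons R n)) setT f).
transitivity (\int[(lebesgue_row R n \x leb)]_z f (row_cons z)).
  have := @ge0_integral_pushforward _ _ _ _ _ _ (@measurable_row_cons R n)
    (lebesgue_row R n \x leb) setT f measurableT mf (fun y _ => f0 y).
  by rewrite preimage_setT.
have [m' ->] := sigma_finite_packed (@sigma_finite_lebesgue_row R n).
rewrite fubini_tonelli1//.
by apply: measurableT_comp => //; exact: measurable_row_cons.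
Qed.

Lemma measurable_affine_row n (a : R) (b : 'rV[R]_n) :
  measurable_fun setT (fun x : 'rV[R]_n => a *: x + b)%R.
Proof.
apply: measurable_rowP => i; under eq_fun do rewrite !mxE.
by apply: measurable_funD => //; apply: measurable_funM => //; exact: measurable_coord.
Qed.

(** Induction on the dimension: the inner integral over the first coordinate is a function of the
    others, to which the induction hypothesis applies, and the one-dimensional formula handles the
    inside. Each coordinate contributes a factor $|a|$. *)
Lemma ge0_integral_affine n (a : R) (b : 'rV[R]_n) (f : 'rV[R]_n -> \bar R) :
  a != 0%R -> measurable_fun setT f -> (forall x, 0 <= f x) ->
  \int[lebesgue_row R n]_x f x =
  (`|a| ^+ n)%:E * \int[lebesgue_row R n]_x f (a *: x + b)%R.
Proof.
elim: n b f => [|n IH] b f a0 mf f0.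
  rewrite expr0 mul1e; apply: eq_integral => x _; congr (f _).
  by apply/rowP => -[].
have mfc : measurable_fun setT (f \o @row_cons R n).
  exact: (measurableT_comp mf (@measurable_row_cons R n)).
rewrite !ge0_integral_row_cons//; last first.
  exact: (measurableT_comp mf (measurable_affine_row a b)).
pose g x := \int[leb]_t f (row_cons (x, t)).
have mg : measurable_fun setT g.
  apply: (@sf_measurable_tonelli _ _ _ _ _ leb (sigma_finiteT leb) _ mfc).
  by move=> z; exact: f0.
have g0 x : 0 <= g x by apply: integral_ge0.
pose b' : 'rV[R]_n := (\row_i b ord0 (@rshift 1 n i))%R.
rewrite -/g (IH b' g a0 mg g0).
rewrite exprSr EFinM -muleA; congr (_ * _).
have E x : g (a *: x + b')%R =
    `|a|%:E * \int[leb]_t f (a *: (row_cons (x, t)) + b)%R.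
  rewrite /g (@ge0_integral_affineR a (b ord0 (@lshift 1 n ord0)))//; last first.
    exact: (measurable_fun_pair2 _ mfc).
  congr (_ * _); apply: eq_integral => t _; congr (f _); apply/rowP => i.
  have [j ij|j ij] := @split_ordP 1 n i; rewrite ij.
    by rewrite [RHS]mxE [X in _ = (X + _)%R]mxE !row_consEl (ord1 j).
  by rewrite [RHS]mxE [X in _ = (X + _)%R]mxE !row_consEr !mxE.
under eq_integral do rewrite E.
rewrite ge0_integralZl//; last by move=> x _; exact: integral_ge0.
have mfa : measurable_fun setT
    ((fun x => f (a *: x + b)%R) \o @row_cons R n).
  apply: measurableT_comp; last exact: measurable_row_cons.
  exact: (measurableT_comp mf (measurable_affine_row a b)).
apply: (@sf_measurable_tonelli _ _ _ _ _ leb (sigma_finiteT leb) _ mfa).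
by move=> z; exact: f0.
Qed.

End affine_change.

(** * Complex-valued functions: modulus, measurability, integral, convergence *)

Notation cabs := (@ComplexField.Normc.normc _).
Notation Re := (@complex.Re _).
Notation Im := (@complex.Im _).

Section complex_modulus.
Context {R : realType}.
Implicit Types (z w : R[i]) (r : R).

Lemma ReD z w : Re (z + w) = Re z + Re w. Proof. by case: z; case: w. Qed.
Lemma ImD z w : Im (z + w) = Im z + Im w. Proof. by case: z; case: w. Qed.
Lemma ReN z : Re (- z) = - Re z. Proof. by case: z. Qed.
Lemma ImN z : Im (- z) = - Im z. Proof. by case: z. Qed.
Lemma ReM z w : Re (z * w) = Re z * Re w - Im z * Im w.
Proof. by case: z; case: w. Qed.
Lemma ImM z w : Im (z * w) = Re z * Im w + Im z * Re w.
Proof. by case: z; case: w. Qed.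

Lemma complex_ext z w : Re z = Re w -> Im z = Im w -> z = w.
Proof. by case: z; case: w => a b c d /= -> ->. Qed.

Lemma cabsE z : cabs z = Num.sqrt (Re z ^+ 2 + Im z ^+ 2).
Proof. by case: z. Qed.
Lemma cabs_ge0 z : 0 <= cabs z. Proof. by rewrite cabsE sqrtr_ge0. Qed.
Lemma cabs_sqr z : cabs z ^+ 2 = Re z ^+ 2 + Im z ^+ 2.
Proof. by rewrite cabsE sqr_sqrtr// addr_ge0// sqr_ge0. Qed.
Lemma cabsM z w : cabs (z * w) = cabs z * cabs w.
Proof. exact: ComplexField.Normc.normcM. Qed.
Lemma cabsD z w : cabs (z + w) <= cabs z + cabs w.
Proof. exact: le_normcD. Qed.
Lemma cabsN z : cabs (- z) = cabs z. Proof. exact: normcN. Qed.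
Lemma cabs0 : cabs (0 : R[i]) = 0.
Proof. exact: ComplexField.Normc.normc0. Qed.
Lemma cabs_eq0 z : cabs z = 0 -> z = 0.
Proof. exact: ComplexField.Normc.eq0_normc. Qed.
Lemma cabs_conj z : cabs (z^*)%C = cabs z.
Proof. by case: z => a b; rewrite !cabsE/= sqrrN. Qed.
Lemma cabs_real r : cabs (r%:C)%C = `|r|.
Proof. by rewrite cabsE/= expr0n addr0 sqrtr_sqr. Qed.
Lemma Re_le_cabs z : `|Re z| <= cabs z.
Proof. by rewrite cabsE -sqrtr_sqr ler_sqrt ?addr_ge0 ?sqr_ge0// lerDl sqr_ge0. Qed.
Lemma Im_le_cabs z : `|Im z| <= cabs z.
Proof. by rewrite cabsE -sqrtr_sqr ler_sqrt ?addr_ge0 ?sqr_ge0// lerDr sqr_ge0. Qed.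
Lemma cabs_le_ReIm z : cabs z <= `|Re z| + `|Im z|.
Proof.
rewrite -(@ler_pXn2r _ 2)// ?nnegrE ?addr_ge0 ?cabs_ge0//.
rewrite cabs_sqr sqrrD !real_normK ?num_real// lerD2r lerDl.
by rewrite mulrn_wge0// mulr_ge0.
Qed.
Lemma cabsB z w : cabs (z - w) <= cabs z + cabs w.
Proof. by rewrite (le_trans (cabsD _ _))// cabsN. Qed.
Lemma cabs_distrC z w : cabs (z - w) = cabs (w - z).
Proof. by rewrite -cabsN opprB. Qed.
End complex_modulus.

Section complex_measurable.
Context d (T : measurableType d) {R : realType}.
Implicit Types f g : T -> R[i].

Definition cmeas f := measurable_fun setT (Re \o f) /\ measurable_fun setT (Im \o f).

Lemma cmeas_cst (c : R[i]) : cmeas (fun=> c).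
Proof. by split; exact: measurable_cst. Qed.

Lemma cmeas_real (g : T -> R) : measurable_fun setT g -> cmeas (fun x => (g x)%:C%C).
Proof. by move=> mg; split => //; exact: measurable_cst. Qed.

Lemma cmeasD f g : cmeas f -> cmeas g -> cmeas (fun x => f x + g x).
Proof.
move=> [f1 f2] [g1 g2]; split.
  by rewrite (_ : _ \o _ = (Re \o f) \+ (Re \o g));
    [exact: measurable_funD|apply/funext => x; exact: ReD].
by rewrite (_ : _ \o _ = (Im \o f) \+ (Im \o g));
  [exact: measurable_funD|apply/funext => x; exact: ImD].
Qed.

Lemma cmeasM f g : cmeas f -> cmeas g -> cmeas (fun x => f x * g x).
Proof.
move=> [f1 f2] [g1 g2]; split.
  rewrite (_ : _ \o _ = (fun x => (Re \o f) x * (Re \o g) x - (Im \o f) x * (Im \o g) x)).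
    by apply: measurable_funB; exact: measurable_funM.
  by apply/funext => x; exact: ReM.
rewrite (_ : _ \o _ = (fun x => (Re \o f) x * (Im \o g) x + (Im \o f) x * (Re \o g) x)).
  by apply: measurable_funD; exact: measurable_funM.
by apply/funext => x; exact: ImM.
Qed.

Lemma cmeasN f : cmeas f -> cmeas (fun x => - f x).
Proof.
move=> [f1 f2]; split.
  by rewrite (_ : _ \o _ = (fun x => - (Re \o f) x)); [exact: measurableT_comp|
    apply/funext => x; exact: ReN].
by rewrite (_ : _ \o _ = (fun x => - (Im \o f) x)); [exact: measurableT_comp|
    apply/funext => x; exact: ImN].
Qed.

Lemma cmeasB f g : cmeas f -> cmeas g -> cmeas (fun x => f x - g x).
Proof. by move=> mf mg; apply: cmeasD => //; exact: cmeasN. Qed.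

Lemma cmeas_conj f : cmeas f -> cmeas (fun x => (f x)^*%C).
Proof.
move=> [f1 f2]; split.
  by rewrite (_ : _ \o _ = Re \o f)//; apply/funext => x /=; case: (f x).
rewrite (_ : _ \o _ = (fun x => - (Im \o f) x)); first exact: measurableT_comp.
by apply/funext => x /=; case: (f x).
Qed.

Lemma cmeas_cabs f : cmeas f -> measurable_fun setT (fun x => cabs (f x)).
Proof.
move=> [f1 f2]; rewrite (_ : (fun _ => _) =
    (@Num.sqrt R) \o (fun x => (Re \o f) x ^+ 2 + (Im \o f) x ^+ 2)).
  apply: measurableT_comp; last first.
    by apply: measurable_funD; exact: measurable_funX.
  by apply: continuous_measurable_fun; exact: sqrt_continuous.
by apply/funext => x /=; rewrite cabsE.
Qed.

Lemma cmeas_comp d' (T' : measurableType d') (h : T' -> T) f :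
  measurable_fun setT h -> cmeas f ->
  measurable_fun setT (Re \o (f \o h)) /\ measurable_fun setT (Im \o (f \o h)).
Proof.
move=> mh [f1 f2]; split.
  exact: (measurableT_comp f1 mh).
exact: (measurableT_comp f2 mh).
Qed.
End complex_measurable.

Section complex_integral.
Context d (T : measurableType d) {R : realType} (mu : {measure set T -> \bar R}).
Implicit Types (f g : T -> R[i]) (h k : T -> R).

Definition rint (h : T -> R) := mu.-integrable setT (EFin \o h).
Definition cint f := rint (Re \o f) /\ rint (Im \o f).
Definition Cint f : R[i] :=
  (\int[mu]_x (Re \o f) x +i* \int[mu]_x (Im \o f) x)%C.

Lemma rint_meas h : rint h -> measurable_fun setT h.
Proof. by move=> /integrableP[/measurable_EFinP]. Qed.

Lemma cint_meas f : cint f -> cmeas f.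
Proof. by move=> [/rint_meas ? /rint_meas ?]. Qed.

Lemma rint_le h k : measurable_fun setT h -> rint k -> (forall x, `|h x| <= k x) ->
  rint h.
Proof.
move=> mh ik hk; apply: le_integrable ik => //; first exact/measurable_EFinP.
by move=> x _ /=; rewrite lee_fin (le_trans (hk x))// ler_norm.
Qed.

Lemma rintD h k : rint h -> rint k -> rint (fun x => h x + k x).
Proof. by move=> ih ik; have := integrableD measurableT ih ik. Qed.

Lemma rintZ c h : rint h -> rint (fun x => c * h x).
Proof. by move=> ih; have := integrableZl measurableT c ih. Qed.

Lemma rintN h : rint h -> rint (fun x => - h x).
Proof. by move=> /(rintZ (-1)); congr (integrable _ _ _); apply/funext => x /=; rewrite mulN1r. Qed.

Lemma cint_le f (k : T -> R) : cmeas f -> rint k -> (forall x, cabs (f x) <= k x) ->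
  cint f.
Proof.
move=> [m1 m2] ik fk; split; apply: (rint_le _ ik) => // x /=.
  exact: le_trans (Re_le_cabs _) _.
exact: le_trans (Im_le_cabs _) _.
Qed.

Lemma cint_cabs f : cint f -> rint (fun x => cabs (f x)).
Proof.
move=> [i1 i2]; have mf : cmeas f by split; exact: rint_meas.
apply: (@rint_le _ (fun x => `|Re (f x)| + `|Im (f x)|)); first exact: cmeas_cabs.
  by apply: rintD; [exact: (integrable_norm i1)|exact: (integrable_norm i2)].
by move=> x; rewrite ger0_norm ?cabs_ge0 ?cabs_le_ReIm.
Qed.

Lemma cintD f g : cint f -> cint g -> cint (fun x => f x + g x).
Proof.
move=> fi gi; apply: (@cint_le _ (fun x => cabs (f x) + cabs (g x))).
- by apply: cmeasD; exact: cint_meas.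
- by apply: rintD; exact: cint_cabs.
- by move=> x; exact: cabsD.
Qed.

Lemma cintM f g (B : R) : cint f -> cmeas g -> (forall x, cabs (g x) <= B) ->
  cint (fun x => f x * g x).
Proof.
move=> fi mg gB; apply: (@cint_le _ (fun x => B * cabs (f x))).
- by apply: cmeasM => //; exact: cint_meas.
- by apply: rintZ; exact: cint_cabs.
- by move=> x; rewrite cabsM mulrC ler_wpM2r ?cabs_ge0.
Qed.

Lemma cintZ f (c : R[i]) : cint f -> cint (fun x => c * f x).
Proof.
move=> fi; rewrite (_ : (fun x => _) = fun x => f x * c).
  by apply: (cintM fi); [exact: cmeas_cst|move=> x; exact: lexx].
by apply/funext => x; rewrite mulrC.
Qed.

Lemma cintN f : cint f -> cint (fun x => - f x).
Proof.
by move=> /(cintZ (-1)); congr cint; apply/funext => x; rewrite mulN1r.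
Qed.

Lemma cintB f g : cint f -> cint g -> cint (fun x => f x - g x).
Proof. by move=> fi /cintN gi; exact: cintD. Qed.

Lemma cint_real h : rint h -> cint (fun x => (h x)%:C%C).
Proof.
move=> hi; split => //; rewrite /rint (_ : _ \o _ = cst 0%E); last by apply/funext.
exact: integrable0.
Qed.

Lemma CintD f g : cint f -> cint g -> Cint (fun x => f x + g x) = Cint f + Cint g.
Proof.
move=> [f1 f2] [g1 g2]; apply: complex_ext; rewrite ?ReD ?ImD /Cint/=.
  by rewrite -RintegralD//; apply: eq_Rintegral => x _; rewrite /= ReD.
by rewrite -RintegralD//; apply: eq_Rintegral => x _; rewrite /= ImD.
Qed.

Lemma CintZ f c : cint f -> Cint (fun x => c * f x) = c * Cint f.
Proof.
move=> [f1 f2]; apply: complex_ext; rewrite ?ReM ?ImM /Cint/=.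
  rewrite -!RintegralZl// -RintegralB//; [|exact: rintZ|exact: rintZ].
  by apply: eq_Rintegral => x _; rewrite /= ReM.
rewrite -!RintegralZl// -RintegralD//; [|exact: rintZ|exact: rintZ].
by apply: eq_Rintegral => x _; rewrite /= ImM.
Qed.

Lemma CintN f : cint f -> Cint (fun x => - f x) = - Cint f.
Proof.
move=> fi; rewrite -[RHS]mulN1r -CintZ//; congr Cint.
by apply/funext => x; rewrite mulN1r.
Qed.

Lemma CintB f g : cint f -> cint g -> Cint (fun x => f x - g x) = Cint f - Cint g.
Proof. by move=> fi gi; rewrite CintD ?CintN//; exact: cintN. Qed.

Lemma Cint_real h : Cint (fun x => (h x)%:C%C) = (\int[mu]_x h x)%:C%C.
Proof.
apply: complex_ext => //=; rewrite -[RHS](_ : \int[mu]_x (cst 0 x) = 0)//.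
by rewrite Rintegral_cst// mul0r.
Qed.

Lemma Cint_conj f : cint f -> Cint (fun x => (f x)^*%C) = (Cint f)^*%C.
Proof.
move=> [f1 f2]; apply: complex_ext => /=.
  by apply: eq_Rintegral => x _ /=; case: (f x).
rewrite -mulN1r -RintegralZl//; apply: eq_Rintegral => x _ /=.
by case: (f x) => a b /=; rewrite mulN1r.
Qed.

(* Integrate Re (conj z * f) <= |z| |f| for z the integral of f. *)
Lemma cabs_Cint_le f : cint f -> cabs (Cint f) <= \int[mu]_x cabs (f x).
Proof.
move=> fi; have [f1 f2] := fi; set z := Cint f.
have [z0|z0] := eqVneq (cabs z) 0.
  by rewrite z0 Rintegral_ge0// => x _; exact: cabs_ge0.
have zp : 0 < cabs z by rewrite lt_def z0 cabs_ge0.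
rewrite -(ler_pM2l zp).
have -> : cabs z * cabs z =
    Re z * (\int[mu]_x (Re \o f) x) + Im z * (\int[mu]_x (Im \o f) x).
  by rewrite -expr2 cabs_sqr !expr2.
rewrite -!RintegralZl//; last exact: cint_cabs.
rewrite -RintegralD//; [|exact: rintZ|exact: rintZ].
apply: le_Rintegral => //.
- by apply: rintD; exact: rintZ.
- by apply: rintZ; exact: cint_cabs.
move=> x _; rewrite -cabs_conj -cabsM.
apply: le_trans (Re_le_cabs _); apply: le_trans (ler_norm _).
by rewrite ReM; case: (z) => a b /=; rewrite mulNr opprK.
Qed.

Lemma cabs_Cint_le_ub f (k : T -> R) : cmeas f -> rint k ->
  (forall x, cabs (f x) <= k x) -> cabs (Cint f) <= \int[mu]_x k x.
Proof.
move=> mf ik fk; have fi := cint_le mf ik fk.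
apply: le_trans (cabs_Cint_le fi) _; apply: le_Rintegral => //.
exact: cint_cabs.
Qed.

End complex_integral.

(** The filter is arbitrary because both ordinary sequential limits and limits along an ultrafilter
    on the integers occur. *)
Definition ccvg {R : realType} I (F : set_system I) (u : I -> R[i]) (l : R[i]) :=
  (Re \o u @ F --> Re l) /\ (Im \o u @ F --> Im l).

Section ccvg.
Context {R : realType} I (F : set_system I) {FF : ProperFilter F}.
Implicit Types (u v : I -> R[i]) (a b : R[i]).

Lemma ccvg_unique u a b : ccvg F u a -> ccvg F u b -> a = b.
Proof.
by move=> [a1 a2] [b1 b2]; apply: complex_ext;
  [apply: cvg_unique a1 b1|apply: cvg_unique a2 b2].
Qed.

Lemma ccvg_cst a : ccvg F (fun=> a) a.
Proof. by split; exact: cvg_cst. Qed.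

Lemma ccvgD u v a b : ccvg F u a -> ccvg F v b -> ccvg F (fun i => u i + v i) (a + b).
Proof.
move=> [a1 a2] [b1 b2]; split.
  rewrite ReD (_ : Re \o _ = fun i => (Re \o u) i + (Re \o v) i); first exact: cvgD.
  by apply/funext => i; exact: ReD.
rewrite ImD (_ : Im \o _ = fun i => (Im \o u) i + (Im \o v) i); first exact: cvgD.
by apply/funext => i; exact: ImD.
Qed.

Lemma ccvgM u v a b : ccvg F u a -> ccvg F v b -> ccvg F (fun i => u i * v i) (a * b).
Proof.
move=> [a1 a2] [b1 b2]; split.
  rewrite ReM (_ : Re \o _ =
    fun i => (Re \o u) i * (Re \o v) i - (Im \o u) i * (Im \o v) i).
    by apply: cvgB; apply: cvgM.
  by apply/funext => i; exact: ReM.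
rewrite ImM (_ : Im \o _ =
    fun i => (Re \o u) i * (Im \o v) i + (Im \o u) i * (Re \o v) i).
  by apply: cvgD; apply: cvgM.
by apply/funext => i; exact: ImM.
Qed.

Lemma ccvg_cabs u a : ccvg F u a -> cabs (u i) @[i --> F] --> cabs a.
Proof.
move=> [a1 a2]; rewrite cabsE (_ : (fun i => _) =
    fun i => Num.sqrt ((Re \o u) i * (Re \o u) i + (Im \o u) i * (Im \o u) i)).
  apply: (continuous_cvg _ (@sqrt_continuous R _)).
  by rewrite !expr2; apply: cvgD; apply: cvgM.
by apply/funext => i; rewrite cabsE !expr2.
Qed.

Lemma ccvg_cabs_le u a (B : R) : ccvg F u a -> (forall i, cabs (u i) <= B) -> cabs a <= B.
Proof.
move=> /ccvg_cabs ua uB.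
apply: (closed_cvg (fun x => x <= B) _ _ _ ua); first exact: closed_le.
exact: nearW.
Qed.

Lemma ccvg_near u a (v : I -> R[i]) : (forall i, u i = v i) -> ccvg F u a -> ccvg F v a.
Proof. by move=> /funext ->. Qed.

Lemma cvg_dist_le (v : I -> R) (l : R) (e : I -> R) :
  (forall i, `|v i - l| <= e i) -> e @ F --> (0 : R) -> v @ F --> l.
Proof.
move=> ve /cvgr0Pnorm_le e0; apply/cvgrPdist_le => eps /e0.
by apply: filterS => i h; rewrite distrC (le_trans (ve i))// (le_trans _ h)// ler_norm.
Qed.

Lemma ccvg_squeeze u a (e : I -> R) : (forall i, cabs (u i - a) <= e i) ->
  e @ F --> (0 : R) -> ccvg F u a.
Proof.
move=> ue e0; split; apply: cvg_dist_le e0 => i /=; apply: le_trans (ue i).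
  by rewrite -ReN -ReD; exact: Re_le_cabs.
by rewrite -ImN -ImD; exact: Im_le_cabs.
Qed.
End ccvg.

(** * Dominated convergence and Fubini for complex-valued functions *)

Section dominated.
Context d (T : measurableType d) {R : realType} (mu : {measure set T -> \bar R}).

Lemma rdominated (f_ : nat -> T -> R) (f g : T -> R) :
  (forall n, measurable_fun setT (f_ n)) -> measurable_fun setT f ->
  (forall x, f_ n x @[n --> \oo] --> f x) -> rint mu g ->
  (forall n x, `|f_ n x| <= g x) ->
  \int[mu]_x f_ n x @[n --> \oo] --> \int[mu]_x f x.
Proof.
move=> mf_ mf cvf ig fg.
have cvE x : setT x -> (f_ n x)%:E @[n --> \oo] --> (f x)%:E.
  by move=> _; apply: cvg_EFin; [exact: nearW|exact: cvf].
have [i1 _ h] := @dominated_convergence _ _ _ mu setT measurableT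
  (fun n x => (f_ n x)%:E) (EFin \o f) (EFin \o g)
  (fun n => (measurable_EFinP _ _).2 (mf_ n)) ((measurable_EFinP _ _).2 mf)
  (aeW _ cvE)
  ig (aeW _ (fun x n _ => fg n x)).
rewrite /Rintegral; apply: fine_cvg; rewrite fineK//.
exact: integrable_fin_num.
Qed.

Lemma cdominated (f_ : nat -> T -> R[i]) (f : T -> R[i]) (g : T -> R) :
  (forall n, cmeas (f_ n)) -> cmeas f -> (forall x, ccvg \oo (f_ ^~ x) (f x)) ->
  rint mu g -> (forall n x, cabs (f_ n x) <= g x) ->
  ccvg \oo (fun n => Cint mu (f_ n)) (Cint mu f).
Proof.
move=> mf_ mf cvf ig fg; split.
- apply: (@rdominated (fun n => Re \o f_ n) _ g) => //.
  + by move=> n; case: (mf_ n).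
  + by case: mf.
  + by move=> x; case: (cvf x).
  + by move=> n x; rewrite (le_trans (Re_le_cabs _)).
- apply: (@rdominated (fun n => Im \o f_ n) _ g) => //.
  + by move=> n; case: (mf_ n).
  + by case: mf.
  + by move=> x; case: (cvf x).
  + by move=> n x; rewrite (le_trans (Im_le_cabs _)).
Qed.
End dominated.

Section complex_fubini.
Context d1 d2 (T1 : measurableType d1) (T2 : measurableType d2) {R : realType}.
Variables (m1 : {measure set T1 -> \bar R}) (m2 : {measure set T2 -> \bar R}).
Hypotheses (s1 : sigma_finite setT m1) (s2 : sigma_finite setT m2).

Section real.
Variable f : T1 * T2 -> R.
Hypothesis mf : measurable_fun setT f.
Hypothesis f1 : forall x, rint m2 (fun y => f (x, y)).
Hypothesis f2 : forall y, rint m1 (fun x => f (x, y)).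
Hypothesis ltyf : (\int[m1]_x \int[m2]_y (`|f (x, y)|)%:E < +oo)%E.

Lemma rfubini : \int[m1]_x \int[m2]_y f (x, y) = \int[m2]_y \int[m1]_x f (x, y).
Proof.
rewrite {1 3}/Rintegral; congr fine.
have := @sf_fubini _ _ _ _ _ m1 m2 s1 s2 (EFin \o f)
  ((measurable_EFinP _ _).2 mf) ltyf.
move=> h; transitivity (\int[m1]_x \int[m2]_y (EFin \o f) (x, y))%E.
  apply: eq_integral => x _; rewrite /Rintegral fineK//.
  exact: (integrable_fin_num measurableT (f1 x)).
rewrite h; apply: eq_integral => y _; rewrite /Rintegral fineK//.
exact: (integrable_fin_num measurableT (f2 y)).
Qed.

Lemma rfubini_rint : rint m1 (fun x => \int[m2]_y f (x, y)).
Proof.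
have := @sf_fubini_integrable _ _ _ _ _ m1 m2 s1 s2 (EFin \o f)
  ((measurable_EFinP _ _).2 mf) ltyf f1.
congr (integrable _ _ _); apply/funext => x /=; rewrite /Rintegral fineK//.
exact: (integrable_fin_num measurableT (f1 x)).
Qed.
End real.

Section complex.
Variable f : T1 * T2 -> R[i].
Hypothesis mf : cmeas f.
Hypothesis f1 : forall x, cint m2 (fun y => f (x, y)).
Hypothesis f2 : forall y, cint m1 (fun x => f (x, y)).
Hypothesis ltyf : (\int[m1]_x \int[m2]_y (cabs (f (x, y)))%:E < +oo)%E.

Let lty (g : T1 * T2 -> R) : measurable_fun setT g ->
  (forall z, `|g z| <= cabs (f z)) -> (\int[m1]_x \int[m2]_y (`|g (x, y)|)%:E < +oo)%E.
Proof.
move=> mg gf; apply: le_lt_trans ltyf.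
have ms (h : T1 * T2 -> R) : measurable_fun setT h -> (forall z, 0 <= h z) ->
    measurable_fun setT (fun x => \int[m2]_y (h (x, y))%:E)%E.
  move=> mh h0.
  apply: (@sf_measurable_tonelli _ _ _ _ _ m2 s2 (EFin \o h)).
    exact/measurable_EFinP.
  by move=> z; rewrite lee_fin.
apply: ge0_le_integral => //.
- by move=> x _; apply: integral_ge0 => y _; rewrite lee_fin.
- by apply: (ms (fun z => `|g z|)) => //; exact: measurableT_comp.
- exact: (ms (fun z => cabs (f z)) (cmeas_cabs mf) (fun z => cabs_ge0 _)).
move=> x _; apply: ge0_le_integral => //.
- apply/measurable_EFinP; apply: measurableT_comp => //.
  exact: (measurable_fun_pair2 x mg).
- by apply/measurable_EFinP; exact: (measurable_fun_pair2 x (cmeas_cabs mf)).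
- by move=> y _; rewrite lee_fin.
Qed.

Lemma Cfubini : Cint m1 (fun x => Cint m2 (fun y => f (x, y))) =
  Cint m2 (fun y => Cint m1 (fun x => f (x, y))).
Proof.
apply: complex_ext => /=.
- apply: (@rfubini (Re \o f)).
  + by case: mf.
  + by move=> x; case: (f1 x).
  + by move=> y; case: (f2 y).
  + by apply: lty => [|z]; [case: mf|exact: Re_le_cabs].
- apply: (@rfubini (Im \o f)).
  + by case: mf.
  + by move=> x; case: (f1 x).
  + by move=> y; case: (f2 y).
  + by apply: lty => [|z]; [case: mf|exact: Im_le_cabs].
Qed.

Lemma Cfubini_cint : cint m1 (fun x => Cint m2 (fun y => f (x, y))).
Proof.
split.
- apply: (@rfubini_rint (Re \o f)).
  + by case: mf.
  + by move=> x; case: (f1 x).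
  + by apply: lty => [|z]; [case: mf|exact: Re_le_cabs].
- apply: (@rfubini_rint (Im \o f)).
  + by case: mf.
  + by move=> x; case: (f1 x).
  + by apply: lty => [|z]; [case: mf|exact: Im_le_cabs].
Qed.
End complex.

Lemma cmeas_pair2 (f : T1 * T2 -> R[i]) x : cmeas f -> cmeas (fun y => f (x, y)).
Proof.
by move=> [a b]; split; [exact: (measurable_fun_pair2 x a)|
  exact: (measurable_fun_pair2 x b)].
Qed.

Lemma cmeas_pair1 (f : T1 * T2 -> R[i]) y : cmeas f -> cmeas (fun x => f (x, y)).
Proof.
by move=> [a b]; split; [exact: (measurable_fun_pair1 y a)|
  exact: (measurable_fun_pair1 y b)].
Qed.

Section product_bound.
Variable f : T1 * T2 -> R[i].
Variables (A : T1 -> R) (B : T2 -> R).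
Hypotheses (mf : cmeas f) (iA : rint m1 A) (iB : rint m2 B).
Hypotheses (A0 : forall x, 0 <= A x) (B0 : forall y, 0 <= B y).
Hypothesis fAB : forall x y, cabs (f (x, y)) <= A x * B y.

Let f1 x : cint m2 (fun y => f (x, y)).
Proof.
apply: (@cint_le _ _ _ _ _ (fun y => A x * B y)) => //; last exact: rintZ.
exact: cmeas_pair2.
Qed.

Let f2 y : cint m1 (fun x => f (x, y)).
Proof.
apply: (@cint_le _ _ _ _ _ (fun x => B y * A x)); last by move=> x; rewrite mulrC.
  exact: cmeas_pair1.
exact: rintZ.
Qed.

Let ltyf : (\int[m1]_x \int[m2]_y (cabs (f (x, y)))%:E < +oo)%E.
Proof.
have iAp : (\int[m1]_x (A x)%:E < +oo)%E.
  by have := integrable_lty measurableT iA.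
have iBp : (\int[m2]_x (B x)%:E < +oo)%E.
  by have := integrable_lty measurableT iB.
have iB0 : (0 <= \int[m2]_x (B x)%:E)%E by apply: integral_ge0 => y _; rewrite lee_fin.
have iA0 : (0 <= \int[m1]_x (A x)%:E)%E by apply: integral_ge0 => y _; rewrite lee_fin.
have mA : measurable_fun setT (fun x => (A x)%:E).
  by apply/measurable_EFinP; exact: rint_meas iA.
have mB : measurable_fun setT (fun x => (B x)%:E).
  by apply/measurable_EFinP; exact: rint_meas iB.
have mfc := cmeas_cabs mf.
apply: (@le_lt_trans _ _ (\int[m1]_x ((A x)%:E * \int[m2]_y (B y)%:E))%E).
  apply: ge0_le_integral => //.
  - by move=> x _; apply: integral_ge0 => y _; rewrite lee_fin cabs_ge0.
  - apply: (@sf_measurable_tonelli _ _ _ _ _ m2 s2 (fun z => (cabs (f z))%:E)).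
      exact/measurable_EFinP.
    by move=> z; rewrite lee_fin cabs_ge0.
  - by apply: emeasurable_funM => //; exact: measurable_cst.
  move=> x _; rewrite -ge0_integralZl//; last 2 first.
  - by move=> y _; rewrite lee_fin.
  - by rewrite lee_fin.
  apply: ge0_le_integral => //.
  - by move=> y _; rewrite lee_fin cabs_ge0.
  - apply/measurable_EFinP; exact: (measurable_fun_pair2 x mfc).
  - by apply: emeasurable_funM => //; exact: measurable_cst.
  - by move=> y _; rewrite -EFinM lee_fin.
under eq_integral do rewrite muleC.
rewrite ge0_integralZl//; last by move=> x _; rewrite lee_fin.
by rewrite lte_mul_pinfty// ge0_fin_numE.
Qed.

(** A majorant of product form [A x * B y], with both factors integrable, makes every section
    integrable and the iterated integral of the modulus finite. This is the form in which Fubini is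
    applied to Fourier kernels. *)
Lemma Cfubini_prod : Cint m1 (fun x => Cint m2 (fun y => f (x, y))) =
  Cint m2 (fun y => Cint m1 (fun x => f (x, y))).
Proof. exact: Cfubini. Qed.

Lemma Cfubini_prod_cint : cint m1 (fun x => Cint m2 (fun y => f (x, y))).
Proof. exact: Cfubini_cint. Qed.
End product_bound.
End complex_fubini.

(** * Topology of row vectors and its link with the product sigma-algebra *)

Section row_topology.
Context {R : realType} (n : nat).
Local Notation V := 'rV[R]_n.

Lemma ball_rowE (x : V) (e : R) : 0 < e ->
  ball x e = [set y | forall i, `]x ord0 i - e, x ord0 i + e[%classic (y ord0 i)].
Proof.
move=> e0; apply/seteqP; split=> y /=.
  move=> [_ h] i; have := h ord0 i; rewrite /ball/= in_itv/= ltr_distlC.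
  by rewrite /ball_.
move=> h; split => // i j; rewrite (ord1 i); have := h j.
by rewrite /ball/= in_itv/= -ltr_distlC.
Qed.

Lemma measurable_ball_row (x : V) (e : R) : 0 < e -> measurable (ball x e).
Proof.
move=> e0; rewrite ball_rowE//.
by apply: (@measurable_rect R n (fun i => `]x ord0 i - e, x ord0 i + e[%classic)).
Qed.

Definition rat_ball (q : 'rV[rat]_n * nat) : set V :=
  ball (map_mx ratr q.1 : V) (q.2.+1%:R^-1).

Lemma open_rat_ball (U : set V) (x : V) : open U -> U x ->
  exists q, rat_ball q x /\ rat_ball q `<=` U.
Proof.
move=> oU Ux; have /nbhs_ballP [e /= e0 eU] := open_nbhs_nbhs (conj oU Ux).
have [m me] : exists m : nat, m.+1%:R^-1 < e / 2.
  have e2 : 0 < e / 2 by rewrite divr_gt0.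
  exists (Num.truncn (e / 2)^-1); rewrite -[ltRHS]invrK ltf_pV2 ?posrE ?invr_gt0//.
  exact: truncnS_gt.
have h (i : 'I_n) : exists q : rat, `|ratr q - x ord0 i| < m.+1%:R^-1 :> R.
  have : x ord0 i - m.+1%:R^-1 < x ord0 i + m.+1%:R^-1.
    by rewrite ltrD2l (@lt_trans _ _ 0)// ?oppr_lt0 ?invr_gt0.
  move=> /rat_in_itvoo [q]; rewrite in_itv/= => hq; exists q.
  by rewrite ltr_distlC -ltr_distlC distrC ltr_distlC.
have [q hq] := choice h.
exists (\row_i q i, m); split.
  by rewrite /rat_ball ball_rowE ?invr_gt0// => i /=; rewrite !mxE in_itv/= -ltr_distlC.
move=> y; rewrite /rat_ball => hy; apply: eU.
apply: (@ball_splitr _ _ (map_mx ratr (\row_i q i) : V)).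
  apply: le_ball (ltW me) _ _.
  by rewrite ball_rowE ?invr_gt0// => i /=; rewrite !mxE in_itv/= -ltr_distlC.
by apply: le_ball (ltW me) _ _.
Qed.

(** The balls with rational centre and radius $1/(m+1)$ form a countable base, so an open set is a
    countable union of measurable balls. *)
Lemma open_measurable_row (U : set V) : open U -> measurable U.
Proof.
move=> oU; pose F (k : nat) : set V := if @unpickle ('rV[rat]_n * nat)%type k is Some q
  then if `[< rat_ball q `<=` U >] then rat_ball q else set0 else set0.
rewrite (_ : U = \bigcup_k F k).
  apply: bigcup_measurable => k _; rewrite /F; case: unpickle => // q.
  by case: ifP => // _; apply: measurable_ball_row; rewrite invr_gt0.
apply/seteqP; split => x.
  move=> /(open_rat_ball oU)[q [qx qU]]; exists (pickle q) => //.
  by rewrite /F pickleK; case: asboolP.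
move=> [k _]; rewrite /F; case: unpickle => // q.
by case: asboolP => // qU /qU.
Qed.

Lemma continuous_measurable_row (g : V -> R) : continuous g -> measurable_fun setT g.
Proof.
move=> /continuousP cg; apply: (measurability _ (RGenOpens.measurableE R)).
move=> _ [_ [a [b ->] <-]]; rewrite setTI; apply: open_measurable_row.
by apply: cg; exact: interval_open.
Qed.

Lemma measurable_subrow : measurable_fun setT (fun z : V * V => z.1 - z.2).
Proof.
apply: measurable_rowP => i; under eq_fun do rewrite !mxE.
apply: measurable_funB.
  exact: (measurableT_comp (measurable_coord i) measurable_fst).
exact: (measurableT_comp (measurable_coord i) measurable_snd).
Qed.

Lemma measurable_dotr : measurable_fun setT (fun z : V * V => dotr z.1 z.2).
Proof.
apply: measurable_sum => i; apply: measurable_funM.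
  exact: (measurableT_comp (measurable_coord i) measurable_fst).
exact: (measurableT_comp (measurable_coord i) measurable_snd).
Qed.

Lemma cube_norm (x : V) (k : R) : 0 <= k -> cube n k x <-> `|x| <= k.
Proof.
move=> k0; rewrite -[X in _ <-> (X <= _)]/(mx_norm x) mx_normrE; split => h.
  by apply/bigmax_leP; split => // -[i j] _ /=; rewrite (ord1 i); exact: h.
move=> i; move/bigmax_leP : h => [_ h].
exact: (h (ord0, i)).
Qed.

Lemma coord_le_norm (x : V) i : `|x ord0 i| <= `|x|.
Proof. by have /(cube_norm x (normr_ge0 x)) := lexx `|x|; exact. Qed.

End row_topology.

(** * Integrals on row vectors under affine maps *)

Section row_integral.
Context {R : realType} (n : nat).
Local Notation V := 'rV[R]_n.
Local Notation mu := (@lebesgue_row R n).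

Lemma rint_indic (A : set V) : measurable A -> (mu A < +oo)%E -> rint mu (\1_A : V -> R).
Proof.
move=> mA Afin; apply/integrableP; split.
  by apply/measurable_EFinP; exact: measurable_indic.
under eq_integral do rewrite /= ger0_norm//.
by rewrite integral_indic// setIT.
Qed.

Lemma rint_bounded_supp (f : V -> R) (B k : R) : measurable_fun setT f ->
  (forall x, `|f x| <= B) -> (forall x, ~ cube n k x -> f x = 0) -> rint mu f.
Proof.
move=> mf fB f0; apply: (@rint_le _ _ _ _ _ (fun x => B * \1_(cube n k) x)) => //.
  by apply: rintZ; apply: rint_indic; [exact: measurable_cube|exact: cube_lty].
move=> x; rewrite indicE; case: (boolP (_ \in _)) => [_|]; first by rewrite mulr1.
by rewrite notin_setE => /f0 ->; rewrite normr0 mulr0.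
Qed.

Lemma cint_bounded_supp (f : V -> R[i]) (B k : R) : cmeas f ->
  (forall x, cabs (f x) <= B) -> (forall x, ~ cube n k x -> f x = 0) -> cint mu f.
Proof.
move=> mf fB f0; split; apply: (@rint_bounded_supp _ B k); try by case: mf.
- by move=> x /=; exact: le_trans (Re_le_cabs _) _.
- by move=> x /f0 /= ->.
- by move=> x /=; exact: le_trans (Im_le_cabs _) _.
- by move=> x /f0 /= ->.
Qed.

Section affine.
Variables (a : R) (b : V).
Hypothesis a0 : a != 0.

Let an0 : (0 < (`|a| ^+ n)%:E)%E.
Proof. by rewrite lte_fin exprn_gt0// normr_gt0. Qed.

Lemma measurable_affine d' (U : measurableType d') (f : V -> U) :
  measurable_fun setT f -> measurable_fun setT (fun x : V => f (a *: x + b)).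
Proof. by move=> mf; exact: (measurableT_comp mf (measurable_affine_row a b)). Qed.

Lemma ge0_Rintegral_affine (f : V -> R) : measurable_fun setT f ->
  (forall x, 0 <= f x) ->
  \int[mu]_x f x = `|a| ^+ n * \int[mu]_x f (a *: x + b).
Proof.
move=> mf f0; rewrite /Rintegral (@ge0_integral_affine R n a b (EFin \o f))//; last first.
  exact/measurable_EFinP.
(* When the integral is infinite, [fine] sends both sides to 0. *)
rewrite /=; case: (integral _ _ _) => [r||] //=.
  by rewrite gt0_muley//= mulr0.
by rewrite gt0_muleNy//= mulr0.
Qed.

Lemma rint_affine (f : V -> R) : rint mu f -> rint mu (fun x => f (a *: x + b)).
Proof.
move=> fi; have mf := rint_meas fi; apply/integrableP; split.
  by apply/measurable_EFinP; exact: measurable_affine.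
have /integrableP[_] := fi.
rewrite (@ge0_integral_affine R n a b (fun x => `|(EFin \o f) x|%E))//; last first.
  by apply: measurableT_comp => //; exact/measurable_EFinP.
by rewrite /=; case: (integral _ _ _) => [r||] //=; rewrite ?ltry// gt0_muley.
Qed.

(** Reduction to the nonnegative case by $f=(f+|f|)-|f|$, a difference of two nonnegative integrable
    functions. *)
Lemma Rintegral_affine (f : V -> R) : rint mu f ->
  \int[mu]_x f x = `|a| ^+ n * \int[mu]_x f (a *: x + b).
Proof.
move=> fi; have mf := rint_meas fi.
have nfi : rint mu (fun x => `|f x|) by exact: (integrable_norm fi).
have pfi : rint mu (fun x => f x + `|f x|) by apply: rintD.
have fE x : f x = (f x + `|f x|) - `|f x| by rewrite addrK.
transitivity (\int[mu]_x ((f x + `|f x|) - `|f x|)).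
  by apply: eq_Rintegral => x _; exact: fE.
rewrite RintegralB// [in RHS](_ : (fun x => f (a *: x + b)) =
  fun x => (f (a *: x + b) + `|f (a *: x + b)|) - `|f (a *: x + b)|); last first.
  by apply/funext => x; exact: fE.
rewrite RintegralB//; last 2 first.
- exact: (rint_affine pfi).
- exact: (rint_affine nfi).
rewrite mulrBr -(@ge0_Rintegral_affine (fun x => f x + `|f x|)); last 2 first.
- exact: rint_meas pfi.
- by move=> x; rewrite -[X in X + _]opprK addrC subr_ge0 -normrN ler_norm.
rewrite -(@ge0_Rintegral_affine (fun x => `|f x|))//.
exact: rint_meas nfi.
Qed.

Lemma cint_affine (f : V -> R[i]) : cint mu f -> cint mu (fun x => f (a *: x + b)).
Proof.
by move=> [i1 i2]; split; [exact: (rint_affine i1)|exact: (rint_affine i2)].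
Qed.

Lemma Cint_affine (f : V -> R[i]) : cint mu f ->
  Cint mu f = (`|a| ^+ n)%:C%C * Cint mu (fun x => f (a *: x + b)).
Proof.
move=> [i1 i2]; apply: complex_ext; rewrite ?ReM ?ImM /=.
  by rewrite mul0r subr0 (Rintegral_affine i1).
by rewrite mul0r addr0 (Rintegral_affine i2).
Qed.

End affine.

Lemma Cint_shift (b : V) (f : V -> R[i]) : cint mu f ->
  Cint mu (fun x => f (x + b)) = Cint mu f.
Proof.
move=> fi; rewrite [RHS](@Cint_affine 1 b)//.
by rewrite normr1 expr1n mul1r; under [in RHS]eq_fun do rewrite scale1r.
Qed.

Lemma Cint_reflect (b : V) (f : V -> R[i]) : cint mu f ->
  Cint mu (fun x => f (b - x)) = Cint mu f.
Proof.
move=> fi; rewrite [RHS](@Cint_affine (-1) b)//.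
by rewrite normrN1 expr1n mul1r; under [in RHS]eq_fun do rewrite scaleN1r addrC.
Qed.

Lemma cint_shift (b : V) (f : V -> R[i]) : cint mu f -> cint mu (fun x => f (x + b)).
Proof.
move=> /(@cint_affine 1 b (oner_neq0 _)).
by under [X in cint _ X -> _]eq_fun do rewrite scale1r.
Qed.

Lemma cint_reflect (b : V) (f : V -> R[i]) : cint mu f -> cint mu (fun x => f (b - x)).
Proof.
have h : -1 != 0 :> R by rewrite oppr_eq0 oner_neq0.
move=> /(@cint_affine (-1) b h).
by under [X in cint _ X -> _]eq_fun do rewrite scaleN1r addrC.
Qed.

End row_integral.

(** * Integrals of products of one-variable functions *)

Section row_product.
Context {R : realType}.
Local Notation leb := (@lebesgue_measure R).
Local Notation mu := (lebesgue_row R).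

Section cons.
Variables (n : nat) (f : 'rV[R]_n.+1 -> R[i]) (A : 'rV[R]_n -> R) (B : R -> R).
Hypotheses (mf : cmeas f) (iA : rint (mu n) A) (iB : rint leb B).
Hypothesis fAB : forall x t, cabs (f (row_cons (x, t))) <= A x * B t.

Let mcons (g : 'rV[R]_n.+1 -> R) : measurable_fun setT g ->
  measurable_fun setT (fun z => g (@row_cons R n z)).
Proof. by move=> mg; exact: (measurableT_comp mg (@measurable_row_cons R n)). Qed.

Let lty (h : 'rV[R]_n.+1 -> R) (c : R) : measurable_fun setT h -> (forall x, 0 <= h x) ->
  0 <= c -> (forall x t, h (row_cons (x, t)) <= c * (A x * B t)) ->
  [/\ rint (mu n.+1) h, forall x, rint leb (fun t => h (row_cons (x, t))),
   rint (mu n) (fun x => \int[leb]_t h (row_cons (x, t))) &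
   \int[mu n.+1]_x h x = \int[mu n]_x \int[leb]_t h (row_cons (x, t))].
Proof.
move=> mh h0 c0 hc; have mhc := mcons mh.
have i1 x : rint leb (fun t => h (row_cons (x, t))).
  apply: (@rint_le _ (measurableTypeR R) R leb _ (fun t => (c * A x) * B t)).
  - exact: (measurable_fun_pair2 x mhc).
  - exact: rintZ.
  - by move=> t; rewrite ger0_norm// -mulrA.
have E : (\int[mu n.+1]_x (h x)%:E =
    \int[mu n]_x (\int[leb]_t h (row_cons (x, t)))%:E)%E.
  rewrite (@ge0_integral_row_cons R n (EFin \o h))//; last exact/measurable_EFinP.
  apply: eq_integral => x _; rewrite /Rintegral fineK//.
  exact: (integrable_fin_num measurableT (i1 x)).
have i2 : rint (mu n) (fun x => \int[leb]_t h (row_cons (x, t))).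
  apply: (@rint_le _ _ _ _ _ (fun x => (c * \int[leb]_t B t) * A x)).
  - apply/measurable_EFinP.
    have := @sf_measurable_tonelli _ _ _ _ _ leb (sigma_finiteT leb)
      (fun z => (h (@row_cons R n z))%:E) ((measurable_EFinP _ _).2 mhc)
      (fun z => h0 _).
    congr measurable_fun; apply/funext => x /=; rewrite /Rintegral fineK//.
    exact: (integrable_fin_num measurableT (i1 x)).
  - exact: rintZ.
  - move=> x; rewrite ger0_norm; last by apply: Rintegral_ge0 => t _.
    rewrite mulrAC -RintegralZl//; apply: le_Rintegral => [//|||t _].
    + exact: i1.
    + exact: (rintZ (c * A x) iB).
    + by rewrite -mulrA.
split => //; last by rewrite /Rintegral E.
apply/integrableP; split; first exact/measurable_EFinP.
under eq_integral do rewrite /= ger0_norm//.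
by rewrite E; have := integrable_lty measurableT i2.
Qed.

Let rcons (g : 'rV[R]_n.+1 -> R) : measurable_fun setT g ->
  (forall x t, `|g (row_cons (x, t))| <= A x * B t) ->
  rint (mu n.+1) g /\
  \int[mu n.+1]_x g x = \int[mu n]_x \int[leb]_t g (row_cons (x, t)).
Proof.
move=> mg gAB; have mng : measurable_fun setT (fun x => `|g x|) by exact: measurableT_comp.
have hn x t : `|g (row_cons (x, t))| <= 1 * (A x * B t) by rewrite mul1r.
have [j1 j2 j3 j4] := @lty (fun x => `|g x|) 1 mng (fun x => normr_ge0 _) ler01 hn.
have mp : measurable_fun setT (fun x => g x + `|g x|) by exact: measurable_funD.
have p0 x : 0 <= g x + `|g x|.
  by rewrite -[X in X + _]opprK addrC subr_ge0 -normrN ler_norm.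
have hp x t : g (row_cons (x, t)) + `|g (row_cons (x, t))| <= 2 * (A x * B t).
  rewrite mulr_natl mulr2n lerD//.
  by apply: le_trans (gAB x t); exact: ler_norm.
have [k1 k2 k3 k4] := @lty (fun x => g x + `|g x|) 2 mp p0 (ler0n _ _) hp.
split.
  apply: (@rint_le _ _ _ _ _ (fun x => `|g x|)) => //.
transitivity (\int[mu n.+1]_x ((g x + `|g x|) - `|g x|)).
  by apply: eq_Rintegral => x _; rewrite addrK.
rewrite RintegralB// k4 j4 -RintegralB//; apply: eq_Rintegral => x _.
rewrite -RintegralB//; last 2 first.
- exact: k2.
- exact: j2.
by apply: eq_Rintegral => t _; rewrite addrK.
Qed.

Lemma row_cons_Cint : cint (mu n.+1) f /\
  Cint (mu n.+1) f = Cint (mu n) (fun x => Cint leb (fun t => f (row_cons (x, t)))).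
Proof.
have [mf1 mf2] := mf.
have [r1 r2] := rcons mf1 (fun x t => le_trans (Re_le_cabs _) (fAB x t)).
have [i1 i2] := rcons mf2 (fun x t => le_trans (Im_le_cabs _) (fAB x t)).
by split; [split|apply: complex_ext].
Qed.
End cons.

Lemma cmeas_prod d (T : measurableType d) n (g : 'I_n -> T -> R[i]) :
  (forall i, cmeas (g i)) -> cmeas (fun x => \prod_(i < n) g i x).
Proof.
elim: n g => [|n IH] g mg.
  by under eq_fun do rewrite big_ord0; exact: cmeas_cst.
under eq_fun do rewrite big_ord_recl; apply: cmeasM => //.
exact: IH.
Qed.

Lemma row_prod n (g : 'I_n -> R -> R[i]) : (forall i, cint leb (g i)) ->
  cint (mu n) (fun x => \prod_(i < n) g i (x ord0 i)) /\
  Cint (mu n) (fun x => \prod_(i < n) g i (x ord0 i)) = \prod_(i < n) Cint leb (g i).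
Proof.
elim: n g => [g _|n IH g ig].
  have E : (fun x : 'rV[R]_0 => \prod_(i < 0) g i (x ord0 i)) = fun=> 1.
    by apply/funext => x; rewrite big_ord0.
  have m0T : (mu 0 setT = 1)%E by rewrite /= diracE in_setT.
  have r1 : rint (mu 0) (fun=> 1).
    apply/integrableP; split; first exact: measurable_cst.
    by under eq_integral do rewrite /= normr1; rewrite integral_cst// mul1e m0T ltry.
  rewrite E big_ord0; split; first exact: (cint_real r1).
  rewrite (Cint_real (mu 0) (fun=> 1)); congr (_%:C)%C.
  by rewrite Rintegral_cst// mul1r m0T.
have [I1 I2] := IH (fun i => g (@rshift 1 n i)) (fun i => ig _).
have E x t : \prod_(i < n.+1) g i (@row_cons R n (x, t) ord0 i) =
    g (@lshift 1 n ord0) t * \prod_(i < n) g (@rshift 1 n i) (x ord0 i).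
  rewrite (@big_split_ord _ _ _ 1 n) /= big_ord_recl big_ord0 mulr1 row_consEl.
  by congr (_ * _); apply: eq_bigr => i _; rewrite row_consEr.
have mprod : cmeas (fun x : 'rV[R]_n.+1 => \prod_(i < n.+1) g i (x ord0 i)).
  apply: cmeas_prod => i; have [/rint_meas m1 /rint_meas m2] := ig i.
  by split; [exact: (measurableT_comp m1 (measurable_coord i))|
    exact: (measurableT_comp m2 (measurable_coord i))].
have bnd x t : cabs (\prod_(i < n.+1) g i (@row_cons R n (x, t) ord0 i)) <=
    cabs (\prod_(i < n) g (@rshift 1 n i) (x ord0 i)) * cabs (g (@lshift 1 n ord0) t).
  by rewrite E cabsM mulrC.
have [j1 j2] := row_cons_Cint mprod (cint_cabs I1) (cint_cabs (ig _))
  bnd.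
split => //; rewrite j2 (@big_split_ord _ _ _ 1 n) /= big_ord_recl big_ord0 mulr1 -I2.
rewrite -CintZ//; congr Cint; apply/funext => x.
by under [in LHS]eq_fun do rewrite E mulrC; rewrite CintZ// mulrC.
Qed.

Lemma row_rprod n (g : 'I_n -> R -> R) : (forall i, rint leb (g i)) ->
  rint (mu n) (fun x => \prod_(i < n) g i (x ord0 i)) /\
  \int[mu n]_x (\prod_(i < n) g i (x ord0 i)) = \prod_(i < n) \int[leb]_t g i t.
Proof.
move=> ig; have [] := @row_prod n (fun i t => (g i t)%:C%C) (fun i => cint_real (ig i)).
under eq_fun do rewrite -rmorph_prod.
move=> [i1 _]; rewrite (Cint_real (mu n) (fun x => \prod_(i < n) g i (x ord0 i))).
under eq_bigr do rewrite (Cint_real leb).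
by rewrite -rmorph_prod => -[].
Qed.
End row_product.

(** * The one-dimensional Abel factor and its Poisson kernel *)

Section poisson1.
Context {R : realType}.
Local Notation leb := (@lebesgue_measure R).

Lemma integral_oneDsqr : (\int[leb]_x ((oneDsqr x)^-1)%:E = (pi : R)%:E)%E.
Proof.
rewrite (@ge0_symfun_integralT _ (fun x => (oneDsqr x)^-1)).
- rewrite (_ : [set x | 0 <= x] = `[0, +oo[%classic); last first.
    by apply/seteqP; split=> x /=; rewrite in_itv/= andbT.
  by rewrite integral0y_oneDsqr -EFinM mulrC divfK.
- by move=> x; rewrite invr_ge0 (le_trans ler01)// oneDsqr_ge1.
- exact: continuous_oneDsqrV.
- by move=> x /=; rewrite /oneDsqr sqrrN.
Qed.

Lemma rint_oneDsqr : rint leb (fun x => (oneDsqr x)^-1).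
Proof.
apply/integrableP; split.
  by apply/measurable_EFinP; apply: continuous_measurable_fun; exact: continuous_oneDsqrV.
under eq_integral do rewrite /= ger0_norm ?invr_ge0 ?(le_trans ler01) ?oneDsqr_ge1//.
by rewrite integral_oneDsqr ltry.
Qed.

Variables (e b : R).
Hypothesis e0 : 0 < e.

Let den : e ^+ 2 + b ^+ 2 != 0.
Proof. by rewrite gt_eqF// ltr_pwDl ?sqr_ge0// exprn_gt0. Qed.

(** An antiderivative of $e^{-ex}(1+\cos bx)$ that tends to 0 at infinity. Adding 1 to the cosine
    keeps the integrand nonnegative, so the fundamental theorem of calculus on a half-line applies
    without a prior proof of integrability. *)
Let F (x : R) := expR (- e * x) * ((b * sin (b * x) - e * cos (b * x)) / (e ^+ 2 + b ^+ 2) - e^-1).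

Let dF (x : R) : is_derive x 1 F (expR (- e * x) * (1 + cos (b * x))).
Proof.
apply: trigger_derive; rewrite /GRing.scale/=.
move: (cos (b * x)) (sin (b * x)) (expR (- e * x)) => c s E.
have e0' : e != 0 by rewrite gt_eqF.
by field; rewrite den e0'.
Qed.

Let Fy : F x @[x --> +oo] --> (0 : R).
Proof.
pose C := (`|b| + `|e|) / (e ^+ 2 + b ^+ 2) + e^-1.
apply: (@cvg_dist_le R R _ _ _ _ (fun x => C * expR (- (e * x)))).
  move=> x; rewrite subr0 normrM ger0_norm ?expR_ge0// mulrC mulNr.
  rewrite ler_wpM2r ?expR_ge0// (le_trans (ler_normB _ _))// lerD//.
    rewrite normrM [`|_^-1|]ger0_norm ?invr_ge0 ?addr_ge0 ?sqr_ge0//.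
    rewrite ler_wpM2r ?invr_ge0 ?addr_ge0 ?sqr_ge0// (le_trans (ler_normB _ _))// lerD//.
      by rewrite normrM ler_piMr// sin_max.
    by rewrite normrM ler_piMr// cos_max.
  by rewrite ger0_norm// invr_ge0 ltW.
rewrite -[X in _ --> X](mulr0 C); apply: cvgM; first exact: cvg_cst.
apply: (@cvg_comp _ _ _ (fun x => e * x) (fun y => expR (- y)) _ (+oo%R : set_system R)).
  apply/cvgryPge => A; exists (A / e); split; first exact: num_real.
  by move=> x /= /ltW h; rewrite mulrC -ler_pdivrMr.
exact: cvgr_expR.
Qed.

Lemma integral0y_exp_1cos :
  (\int[leb]_(x in `[0%R, +oo[) (expR (- e * x) * (1 + cos (b * x)))%:E =
   (e^-1 + e / (e ^+ 2 + b ^+ 2))%:E)%E.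
Proof.
rewrite (@ge0_continuous_FTC2y _ _ F 0 0).
- rewrite -EFinB /F !mulr0 expR0 mul1r sin0 cos0; congr EFin.
  by rewrite mulr0 mulr1; field; rewrite den gt_eqF.
- by move=> x _; rewrite mulr_ge0 ?expR_ge0// -lerBlDl sub0r cos_geN1.
- apply: continuous_subspaceT => x; apply: cvgM.
    apply: (@continuous_comp _ _ _ (fun x => - e * x) expR).
      by apply: cvgM; [exact: cvg_cst|exact: cvg_id].
    exact: continuous_expR.
  apply: cvgD; first exact: cvg_cst.
  apply: (@continuous_comp _ _ _ (fun x => b * x) cos).
    by apply: cvgM; [exact: cvg_cst|exact: cvg_id].
  exact: continuous_cos.
- exact: Fy.
- by move=> x _; case: (dF x).
- apply: cvg_at_right_filter; apply: differentiable_continuous.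
  by apply/derivable1_diffP; case: (dF 0).
- by move=> x _; rewrite derive1E; case: (dF x).
Qed.

Lemma continuous_expabs (a : R) : continuous (fun t : R => expR (- (a * `|t|))).
Proof.
move=> t; apply: (continuous_cvg _ (@continuous_expR R _)).
by apply: cvgN; apply: cvgM; [exact: cvg_cst|exact: norm_continuous].
Qed.

Lemma integral_expabs_1cos :
  (\int[leb]_t (expR (- (e * `|t|)) * (1 + cos (b * t)))%:E =
   (2 * (e^-1 + e / (e ^+ 2 + b ^+ 2)))%:E)%E.
Proof.
rewrite (@ge0_symfun_integralT _ (fun t => expR (- (e * `|t|)) * (1 + cos (b * t)))).
- rewrite EFinM -integral0y_exp_1cos; congr (_ * _)%E.
  rewrite (_ : [set x | 0 <= x] = `[0, +oo[%classic); last first.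
    by apply/seteqP; split=> x /=; rewrite in_itv/= andbT.
  apply: eq_integral => x; rewrite inE/= in_itv/= andbT => x0.
  by rewrite ger0_norm// mulNr.
- by move=> x; rewrite mulr_ge0 ?expR_ge0// -lerBlDl sub0r cos_geN1.
- move=> x; apply: cvgM; first exact: continuous_expabs.
  apply: cvgD; first exact: cvg_cst.
  apply: (@continuous_comp _ _ _ (fun x => b * x) cos).
    by apply: cvgM; [exact: cvg_cst|exact: cvg_id].
  exact: continuous_cos.
- by move=> x /=; rewrite normrN mulrN cosN.
Qed.

End poisson1.

Section poisson1_complex.
Context {R : realType}.
Local Notation leb := (@lebesgue_measure R).

Definition cis (t : R) : R[i] := (cos t +i* sin t)%C.

Lemma cisD s t : cis (s + t) = cis s * cis t.
Proof.
by apply: complex_ext; rewrite ?ReM ?ImM /= ?cosD ?sinD// addrC.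
Qed.
Lemma cis0 : cis 0 = 1. Proof. by apply: complex_ext; rewrite /= ?cos0 ?sin0. Qed.
Lemma cisN t : cis (- t) = (cos t -i* sin t)%C.
Proof. by rewrite /cis cosN sinN. Qed.
Lemma cis_conj t : (cis t)^*%C = cis (- t). Proof. by rewrite cisN. Qed.
Lemma cabs_cis t : cabs (cis t) = 1.
Proof. by rewrite cabsE /= cos2Dsin2 sqrtr1. Qed.
Lemma cis_sum n (t : 'I_n -> R) : cis (\sum_i t i) = \prod_i cis (t i).
Proof. by apply: (big_morph cis cisD cis0). Qed.

Variable e : R.
Hypothesis e0 : 0 < e.

Lemma rint_expabs : rint leb (fun t => expR (- (e * `|t|))).
Proof.
have mexp : measurable_fun setT (fun t : R => expR (- (e * `|t|))).
  by apply: continuous_measurable_fun; exact: continuous_expabs.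
apply/integrableP; split; first exact/measurable_EFinP.
have := integral_expabs_1cos 0 e0; rewrite expr0n addr0.
under [X in X = _ -> _]eq_integral do rewrite mul0r cos0 mulrC EFinM.
rewrite (@ge0_integralZl _ _ _ leb setT measurableT
  (fun t => (expR (- (e * `|t|)))%:E) ((measurable_EFinP _ _).2 mexp)); last 2 first.
- by move=> x _; rewrite lee_fin expR_ge0.
- by rewrite lee_fin addr_ge0.
under [X in _ -> (X < _)%E]eq_integral do rewrite /= ger0_norm ?expR_ge0//.
case: (integral _ _ _) => [r||] //; first by rewrite ltry.
by rewrite gt0_muley// lte_fin.
Qed.

Lemma rint_expabsM (g : R -> R) : measurable_fun setT g -> (forall t, `|g t| <= 1) ->
  rint leb (fun t => expR (- (e * `|t|)) * g t).
Proof.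
move=> mg g1; apply: (@rint_le _ (measurableTypeR R) R leb _ (fun t => expR (- (e * `|t|)))).
- by apply: measurable_funM => //; exact: rint_meas rint_expabs.
- exact: rint_expabs.
- by move=> t; rewrite normrM ger0_norm ?expR_ge0// ler_piMr ?expR_ge0.
Qed.

Let mcos (b : R) : measurable_fun setT (fun t : R => cos (b * t)).
Proof.
apply: continuous_measurable_fun => x.
apply: (@continuous_comp _ _ _ (fun x => b * x) cos).
  by apply: cvgM; [exact: cvg_cst|exact: cvg_id].
exact: continuous_cos.
Qed.

Let msin (b : R) : measurable_fun setT (fun t : R => sin (b * t)).
Proof.
apply: continuous_measurable_fun => x.
apply: (@continuous_comp _ _ _ (fun x => b * x) sin).
  by apply: cvgM; [exact: cvg_cst|exact: cvg_id].
exact: continuous_sin.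
Qed.

Let Rint_1cos b : \int[leb]_t (expR (- (e * `|t|)) * (1 + cos (b * t))) =
  2 * (e^-1 + e / (e ^+ 2 + b ^+ 2)).
Proof. by rewrite /Rintegral integral_expabs_1cos. Qed.

Lemma Rint_expabs : \int[leb]_t expR (- (e * `|t|)) = 2 * e^-1.
Proof.
have := Rint_1cos 0; under eq_Rintegral do rewrite mul0r cos0 mulrC.
rewrite RintegralZl//; last exact: rint_expabs.
rewrite expr0n addr0 => h.
have {}h : 2 * \int[leb]_t expR (- (e * `|t|)) = 2 * (2 * e^-1).
  by rewrite h expr2; field; rewrite gt_eqF.
by apply: (mulfI _ h); rewrite pnatr_eq0.
Qed.

Lemma Rint_expabs_cos b : \int[leb]_t (expR (- (e * `|t|)) * cos (b * t)) =
  2 * e / (e ^+ 2 + b ^+ 2).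
Proof.
have := Rint_1cos b; under eq_Rintegral do rewrite mulrDr mulr1.
rewrite RintegralD//; last 2 first.
- exact: rint_expabs.
- by apply: rint_expabsM => //; move=> t; exact: cos_max.
by rewrite Rint_expabs mulrDr => /addrI ->; rewrite mulrA.
Qed.

Lemma Rint_expabs_sin b : \int[leb]_t (expR (- (e * `|t|)) * sin (b * t)) = 0.
Proof.
have h1 : rint leb (fun t => expR (- (e * `|t|)) * sin (b * t)).
  by apply: rint_expabsM => //; move=> t; exact: sin_max.
(* Adding 1 makes the integrand nonnegative, so the reflection formula for nonnegative functions
   applies. Comparing [f t] with [f (- t)] shows that the odd part integrates to 0. *)
pose f (t : R) := expR (- (e * `|t|)) * (1 + sin (b * t)).
have fE t : f t = expR (- (e * `|t|)) + expR (- (e * `|t|)) * sin (b * t).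
  by rewrite /f mulrDr mulr1.
have f0 t : 0 <= f t.
  by rewrite /f mulr_ge0 ?expR_ge0// -lerBlDl sub0r; have := sin_max (b * t);
    rewrite ler_norml => /andP[].
have mf : measurable_fun setT f.
  apply: measurable_funM; first exact: rint_meas rint_expabs.
  by apply: measurable_funD => //; exact: msin.
have E : \int[leb]_t f t = \int[leb]_t f (- t).
  rewrite /Rintegral; congr fine.
  have n1 : (-1 : R) != 0 by rewrite oppr_eq0 oner_eq0.
  have := @ge0_integral_affineR R (-1) 0 (EFin \o f) n1
    ((measurable_EFinP _ _).2 mf) (fun x => f0 x).
  rewrite normrN normr1 mul1e /= => ->; apply: eq_integral => t _.
  by rewrite mulN1r addr0.
have fNE t : f (- t) = expR (- (e * `|t|)) - expR (- (e * `|t|)) * sin (b * t).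
  by rewrite fE normrN mulrN sinN mulrN.
move: E; under eq_Rintegral do rewrite fE; under [in RHS]eq_Rintegral do rewrite fNE.
rewrite RintegralD// ?RintegralB//; try exact: rint_expabs.
by move=> /addrI /eqP; rewrite -subr_eq0 opprK -mulr2n mulrn_eq0 => /eqP.
Qed.

Lemma cint_expabs_cis b : cint leb (fun t => (expR (- (e * `|t|)))%:C%C * cis (b * t)).
Proof.
apply: (@cintM _ _ _ _ _ _ 1).
- exact: cint_real rint_expabs.
- by split; [exact: mcos|exact: msin].
- by move=> t; rewrite cabs_cis.
Qed.

Lemma Cint_expabs_cis b : Cint leb (fun t => (expR (- (e * `|t|)))%:C%C * cis (b * t)) =
  (2 * e / (e ^+ 2 + b ^+ 2))%:C%C.
Proof.
apply: complex_ext => /=.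
  rewrite -Rint_expabs_cos; apply: eq_Rintegral => t _.
  by rewrite /= mul0r subr0.
rewrite -[RHS](Rint_expabs_sin b); apply: eq_Rintegral => t _.
by rewrite /= mul0r addr0.
Qed.

Lemma poisson1_gt0 (t : R) : 0 < e ^+ 2 + (2 * pi * t) ^+ 2.
Proof. by rewrite ltr_pwDl ?sqr_ge0// exprn_gt0. Qed.

Lemma poisson1E t : 2 * e / (e ^+ 2 + (2 * pi * t) ^+ 2) =
  2 * e^-1 * (oneDsqr (2 * pi / e * t + 0))^-1.
Proof.
have := poisson1_gt0 t; rewrite /oneDsqr addr0 [2 * pi / e * t]mulrAC.
move: (2 * pi * t) => u h; field.
by rewrite (gt_eqF e0) (gt_eqF h).
Qed.

Let ab : 2 * pi / e != 0 :> R.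
Proof. by rewrite gt_eqF// divr_gt0// mulr_gt0// pi_gt0. Qed.

(** The substitution of $(2\pi/e)t$ for $t$ reduces the kernel to $1/(1+t^2)$, whose integral is
    $\pi$. *)
Lemma integral_poisson1 :
  (\int[leb]_t (2 * e / (e ^+ 2 + (2 * pi * t) ^+ 2))%:E = 1)%E.
Proof.
have mo : measurable_fun setT (fun t : R => (oneDsqr t)^-1).
  by apply: continuous_measurable_fun; exact: continuous_oneDsqrV.
have o0 (t : R) : 0 <= (oneDsqr t)^-1.
  by rewrite invr_ge0 (le_trans ler01)// oneDsqr_ge1.
have := @ge0_integral_affineR R (2 * pi / e) 0 (fun t => ((oneDsqr t)^-1)%:E) ab
    ((measurable_EFinP _ _).2 mo) (fun x => o0 x).
rewrite integral_oneDsqr => h.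
under eq_integral do rewrite poisson1E EFinM.
rewrite ge0_integralZl//.
- move: h; case: (integral _ _ _) => [r||] //=.
  + rewrite -EFinM => -[h]; rewrite -EFinM; congr EFin.
    have p0 := pi_gt0 R.
    have pn0 : (pi : R) != 0 by rewrite gt_eqF.
    apply: (mulfI pn0); rewrite mulr1 [RHS]h ger0_norm.
      by rewrite !mulrA (mulrC pi).
    by rewrite divr_ge0 ?mulr_ge0 ?ltW.
  + by rewrite gt0_muley// lte_fin normr_gt0.
  + by rewrite gt0_muleNy// lte_fin normr_gt0.
- apply/measurable_EFinP; apply: (measurableT_comp mo).
  by apply: measurable_funD => //; exact: measurable_funM.
- by rewrite lee_fin mulr_ge0// invr_ge0 ltW.
Qed.

Lemma rint_poisson1 : rint leb (fun t => 2 * e / (e ^+ 2 + (2 * pi * t) ^+ 2)).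
Proof.
apply/integrableP; split.
  apply/measurable_EFinP; rewrite (_ : (fun _ => _) =
    fun t => 2 * e^-1 * (oneDsqr (2 * pi / e * t + 0))^-1).
    apply: measurable_funM => //.
    have mo : measurable_fun setT (fun t : R => (oneDsqr t)^-1).
      by apply: continuous_measurable_fun; exact: continuous_oneDsqrV.
    apply: (measurableT_comp mo).
    by apply: measurable_funD => //; exact: measurable_funM.
  by apply/funext => t; exact: poisson1E.
under eq_integral => t _.
  rewrite /= ger0_norm ?divr_ge0 ?mulr_ge0 ?(ltW e0) ?(ltW (poisson1_gt0 t))//.
  over.
by rewrite integral_poisson1 ltry.
Qed.

Lemma Rint_poisson1 : \int[leb]_t (2 * e / (e ^+ 2 + (2 * pi * t) ^+ 2)) = 1.
Proof. by rewrite /Rintegral integral_poisson1. Qed.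

End poisson1_complex.

(** * Product Poisson kernels in dimension n *)

Section poisson.
Context {R : realType} (n : nat).
Local Notation V := 'rV[R]_n.
Local Notation mu := (@lebesgue_row R n).
Implicit Types (e : R) (x y z : V).

(** Abel's damping factor and its Fourier transform, taken as products over the coordinates so that
    their integrals factor into one-dimensional ones. [weight] is a strictly positive integrable
    function used as a universal majorant. *)
Definition expw e x : R := \prod_i expR (- (e * `|x ord0 i|)).
Definition poisson e x : R := \prod_i (2 * e / (e ^+ 2 + (2 * pi * x ord0 i) ^+ 2)).
Definition weight x : R := \prod_i (oneDsqr (x ord0 i))^-1.

Lemma expw_ge0 e x : 0 <= expw e x.
Proof. by apply: prodr_ge0 => i _; exact: expR_ge0. Qed.

Lemma expw_le1 e x : 0 <= e -> expw e x <= 1.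
Proof.
move=> e0; rewrite /expw; apply: prodr_ile1 => i _.
by rewrite expR_ge0 expR_le1 oppr_le0 mulr_ge0.
Qed.

Lemma poisson_ge0 e x : 0 < e -> 0 <= poisson e x.
Proof.
move=> e0; apply: prodr_ge0 => i _.
by rewrite divr_ge0 ?mulr_ge0 ?(ltW e0)// ltW// poisson1_gt0.
Qed.

Lemma poissonN e x : poisson e (- x) = poisson e x.
Proof. by apply: eq_bigr => i _; rewrite mxE mulrN sqrrN. Qed.

Lemma weight_ge0 x : 0 <= weight x.
Proof.
by apply: prodr_ge0 => i _; rewrite invr_ge0 (le_trans ler01)// oneDsqr_ge1.
Qed.

Lemma weight_gt0 x : 0 < weight x.
Proof.
by apply: prodr_gt0 => i _; rewrite invr_gt0 (lt_le_trans ltr01)// oneDsqr_ge1.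
Qed.

Lemma rint_weight : rint mu weight.
Proof. by have [] := row_rprod (fun _ : 'I_n => @rint_oneDsqr R). Qed.

Lemma rint_expw e : 0 < e -> rint mu (expw e).
Proof. by move=> e0; have [] := row_rprod (fun _ : 'I_n => rint_expabs e0). Qed.

Lemma rint_poisson e : 0 < e -> rint mu (poisson e).
Proof. by move=> e0; have [] := row_rprod (fun _ : 'I_n => rint_poisson1 e0). Qed.

Lemma Rint_poisson e : 0 < e -> \int[mu]_x poisson e x = 1.
Proof.
move=> e0; have [_ ->] := row_rprod (fun _ : 'I_n => rint_poisson1 e0).
by rewrite big1// => i _; rewrite Rint_poisson1.
Qed.

Lemma Cint_expw_cis e z : 0 < e ->
  Cint mu (fun x => (expw e x)%:C%C * cis (2 * pi * dotr x z)) = (poisson e z)%:C%C.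
Proof.
move=> e0; have [_] := row_prod (fun i : 'I_n => cint_expabs_cis e0 (2 * pi * z ord0 i)).
under [in RHS]eq_bigr do rewrite Cint_expabs_cis//.
rewrite -rmorph_prod => <-; congr Cint; apply/funext => x.
rewrite big_split/= -rmorph_prod; congr (_ * _).
rewrite -cis_sum; congr cis; rewrite /dotr mulr_sumr; apply: eq_bigr => i _.
by rewrite [x ord0 i * _]mulrC mulrA.
Qed.

End poisson.

Section dotr_lemmas.
Context {R : realType} (n : nat).
Local Notation V := 'rV[R]_n.
Implicit Types x y z : V.

Lemma dotrC x y : dotr x y = dotr y x.
Proof. by apply: eq_bigr => i _; rewrite mulrC. Qed.
Lemma dotrNl x y : dotr (- x) y = - dotr x y.
Proof. by rewrite /dotr -sumrN; apply: eq_bigr => i _; rewrite mxE mulNr. Qed.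
Lemma dotrNr x y : dotr x (- y) = - dotr x y.
Proof. by rewrite dotrC dotrNl dotrC. Qed.
Lemma dotrDl x y z : dotr (x + y) z = dotr x z + dotr y z.
Proof. by rewrite /dotr -big_split; apply: eq_bigr => i _; rewrite mxE mulrDl. Qed.
Lemma dotrDr x y z : dotr z (x + y) = dotr z x + dotr z y.
Proof. by rewrite dotrC dotrDl !(dotrC z). Qed.
Lemma dotrBr x y z : dotr z (x - y) = dotr z x - dotr z y.
Proof. by rewrite dotrDr dotrNr. Qed.
Lemma dotrBl x y z : dotr (x - y) z = dotr x z - dotr y z.
Proof. by rewrite dotrDl dotrNl. Qed.
End dotr_lemmas.

(** * The Fourier transform of integrable functions and its inversion *)

Section fourier_basics.
Context {R : realType} (n : nat).
Local Notation V := 'rV[R]_n.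
Local Notation mu := (@lebesgue_row R n).
Local Notation tp := (2 * pi : R).
Implicit Types (f g : V -> R[i]) (e : R) (x y z : V).

Lemma fourierE f z : fourier f z = Cint mu (fun x => f x * cis (- (tp * dotr x z))).
Proof. by rewrite /fourier; under eq_fun do rewrite -cisN. Qed.

Lemma measurable_cos : measurable_fun setT (@cos R).
Proof. by apply: continuous_measurable_fun; exact: continuous_cos. Qed.
Lemma measurable_sin : measurable_fun setT (@sin R).
Proof. by apply: continuous_measurable_fun; exact: continuous_sin. Qed.

Lemma cmeas_cis d (T : measurableType d) (h : T -> R) : measurable_fun setT h ->
  cmeas (fun t => cis (h t)).
Proof.
by move=> mh; split; [exact: (measurableT_comp measurable_cos mh)|
  exact: (measurableT_comp measurable_sin mh)].
Qed.

Lemma cmeas_comp2 d (T : measurableType d) d' (T' : measurableType d') (h : T' -> T)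
    (f : T -> R[i]) : measurable_fun setT h -> cmeas f -> cmeas (fun t => f (h t)).
Proof. by move=> mh mf; have [] := cmeas_comp mh mf. Qed.

Lemma measurable_dotrl z (c : R) : measurable_fun setT (fun x : V => c * dotr x z).
Proof.
apply: measurable_funM => //.
exact: (measurable_fun_pair1 z (@measurable_dotr R n)).
Qed.

Lemma cmeas_fst f : cmeas f -> cmeas (fun w : V * V => f w.1).
Proof. by move=> mf; apply: (cmeas_comp2 _ mf); exact: measurable_fst. Qed.
Lemma cmeas_snd f : cmeas f -> cmeas (fun w : V * V => f w.2).
Proof. by move=> mf; apply: (cmeas_comp2 _ mf); exact: measurable_snd. Qed.

Lemma cint_cis f z (c : R) : cint mu f -> cint mu (fun x => f x * cis (c * dotr x z)).
Proof.
move=> fi; apply: (cintM fi); last by move=> x; rewrite cabs_cis; exact: lexx.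
by apply: cmeas_cis; exact: measurable_dotrl.
Qed.

Lemma cint_cisN f z : cint mu f -> cint mu (fun x => f x * cis (- (tp * dotr x z))).
Proof. by move=> /(cint_cis z (- tp)); under eq_fun do rewrite mulNr. Qed.

Lemma fourier_le f z : cint mu f -> cabs (fourier f z) <= \int[mu]_x cabs (f x).
Proof.
move=> fi; rewrite fourierE (le_trans (cabs_Cint_le (cint_cisN z fi)))//.
by under eq_Rintegral do rewrite cabsM cabs_cis mulr1.
Qed.

Lemma cmeas_kernel f g : cmeas f -> cmeas g ->
  cmeas (fun w : V * V => f w.1 * cis (- (tp * dotr w.1 w.2)) * g w.2).
Proof.
move=> mf mg; apply: cmeasM; last exact: cmeas_snd.
apply: cmeasM; first exact: cmeas_fst.
apply: cmeas_cis; apply: measurableT_comp => //.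
by apply: measurable_funM => //; exact: measurable_dotr.
Qed.

Lemma multiplication_formula f g : cint mu f -> cint mu g ->
  Cint mu (fun z => fourier f z * g z) = Cint mu (fun x => f x * fourier g x).
Proof.
move=> fi gi.
have := @Cfubini_prod _ _ _ _ _ mu mu (@sigma_finite_lebesgue_row R n)
  (@sigma_finite_lebesgue_row R n) _ _ _ (cmeas_kernel (cint_meas fi) (cint_meas gi))
  (cint_cabs fi) (cint_cabs gi) (fun=> cabs_ge0 _) (fun=> cabs_ge0 _).
move=> /(_ _)/= h; rewrite -[RHS](_ : Cint mu (fun x => Cint mu (fun y =>
    f x * cis (- (tp * dotr x y)) * g y)) = _); last first.
  congr Cint; apply/funext => x; rewrite fourierE -CintZ; last exact: cint_cisN.
  by congr Cint; apply/funext => y; rewrite [dotr y x]dotrC mulrA mulrAC.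
rewrite h; last by move=> x y; rewrite !cabsM cabs_cis mulr1.
congr Cint; apply/funext => z; rewrite fourierE [LHS]mulrC -CintZ; last exact: cint_cisN.
by congr Cint; apply/funext => x; rewrite mulrC.
Qed.

Lemma expwE e x : expw e x = expR (- (e * \sum_i `|x ord0 i|)).
Proof. by rewrite /expw -expR_sum mulr_sumr sumrN. Qed.

Lemma expw_gt0 e x : 0 < expw e x.
Proof. by apply: prodr_gt0 => i _; exact: expR_gt0. Qed.

(** The kernel is not integrable in the frequency variable, so Fubini does not apply to it directly.
    The factor [expw 1] makes it integrable on the product and, being nonzero, is divided out
    afterwards. *)
Lemma fourier_meas f : cint mu f -> cmeas (fourier f).
Proof.
move=> fi; have ei : cint mu (fun x => (expw 1 x)%:C%C) by exact/cint_real/rint_expw.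
have := @Cfubini_prod_cint _ _ _ _ _ mu mu (@sigma_finite_lebesgue_row R n)
  (@sigma_finite_lebesgue_row R n) (fun w => f w.2 * cis (- (tp * dotr w.2 w.1)) *
    (expw 1 w.1)%:C%C) (fun x => expw 1 x) (fun y => cabs (f y)).
have mk : cmeas (fun w : V * V => f w.2 * cis (- (tp * dotr w.2 w.1)) *
    (expw 1 w.1)%:C%C).
  apply: cmeasM; last exact: (cmeas_fst (cint_meas ei)).
  apply: cmeasM; first exact: (cmeas_snd (cint_meas fi)).
  apply: cmeas_cis; apply: measurableT_comp => //.
  apply: measurable_funM => //; under eq_fun do rewrite dotrC.
  exact: measurable_dotr.
move=> /(_ mk (rint_expw _ ltr01) (cint_cabs fi) (expw_ge0 1) (fun=> cabs_ge0 _)).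
have bd x y : cabs (f y * cis (- (tp * dotr y x)) * (expw 1 x)%:C%C) <= expw 1 x * cabs (f y).
  by rewrite !cabsM cabs_cis mulr1 cabs_real ger0_norm ?expw_ge0// mulrC.
move=> /(_ bd) /cint_meas h.
have : cmeas (fun x => (expw 1 x)^-1%:C%C * (fourier f x * (expw 1 x)%:C%C)).
  apply: cmeasM.
    apply: cmeas_real; under eq_fun do rewrite expwE expRN invrK mul1r.
    apply: (measurableT_comp (@measurable_expR R)); apply: measurable_sum => i.
    by apply: measurableT_comp => //; exact: measurable_coord.
  move: h; congr cmeas; apply/funext => x; rewrite fourierE [RHS]mulrC -CintZ.
    by congr Cint; apply/funext => y; rewrite mulrC.
  exact: cint_cisN.
congr cmeas; apply/funext => x; rewrite mulrCA -rmorphM/= mulVf ?mulr1//.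
by rewrite gt_eqF// expw_gt0.
Qed.

Lemma fourier_expw_cis e x y : 0 < e ->
  fourier (fun z => (expw e z)%:C%C * cis (tp * dotr z x)) y = (poisson e (x - y))%:C%C.
Proof.
move=> e0; rewrite -Cint_expw_cis// fourierE; congr Cint; apply/funext => z.
by rewrite -mulrA -cisD -mulrBr -dotrBr.
Qed.

Lemma cint_expw_cis e x : 0 < e -> cint mu (fun z => (expw e z)%:C%C * cis (tp * dotr z x)).
Proof. by move=> e0; apply: cint_cis; apply: cint_real; exact: rint_expw. Qed.

(** The multiplication formula against a damped character, whose transform is the Poisson kernel
    centred at [x]: Abel means of the inversion integral are Poisson averages of [f]. *)
Lemma Cint_fourier_expw f e x : 0 < e -> cint mu f ->
  Cint mu (fun z => fourier f z * ((expw e z)%:C%C * cis (tp * dotr z x))) =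
  Cint mu (fun y => f y * (poisson e (x - y))%:C%C).
Proof.
move=> e0 fi; rewrite multiplication_formula//; last exact: cint_expw_cis.
by congr Cint; apply/funext => y; rewrite fourier_expw_cis.
Qed.

Lemma poisson_scale e x : 0 < e -> e ^+ n * poisson e (e *: x) = poisson 1 x.
Proof.
move=> e0; rewrite -{1}[n]card_ord -prodr_const -big_split; apply: eq_bigr => i _ /=.
have := poisson1_gt0 (@ltr01 R) (x ord0 i); rewrite mxE expr1n mulr1.
rewrite [tp * (e * _)]mulrCA; move: (tp * x ord0 i) => u h.
by field; rewrite !gt_eqF//= exprMn -{1}[e ^+ 2]mulr1 -mulrDr mulr_gt0// exprn_gt0.
Qed.

Lemma cvg_harmonic_expw x : expw (k.+1%:R^-1) x @[k --> \oo] --> (1 : R).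
Proof.
under eq_fun do rewrite expwE.
have h : - (k.+1%:R^-1 * \sum_i `|x ord0 i|) @[k --> \oo] --> - (0 * \sum_i `|x ord0 i|).
  by apply: cvgN; apply: cvgM; [exact: cvg_harmonic|exact: cvg_cst].
have := continuous_cvg _ (@continuous_expR R _) h.
rewrite mul0r oppr0 expR0. exact.
Qed.

(** Substituting $x-y/(k+1)$ for $y$ turns the shrinking kernel into the fixed [poisson 1], and
    boundedness of [f] supplies the majorant. Continuity is asked only along the sequences met by
    this substitution. *)
Lemma poisson_cvg f x (B : R) : cint mu f -> (forall y, cabs (f y) <= B) ->
  (forall y, ccvg \oo (fun k => f (x - k.+1%:R^-1 *: y)) (f x)) ->
  ccvg \oo (fun k => Cint mu (fun y => f y * (poisson (k.+1%:R^-1) (x - y))%:C%C)) (f x).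
Proof.
move=> fi fB fx.
have e0 (k : nat) : (0 : R) < k.+1%:R^-1 by rewrite invr_gt0.
have ip : cint mu (fun y => (poisson 1 y)%:C%C) by exact/cint_real/rint_poisson.
have -> : f x = Cint mu (fun y => f x * (poisson 1 y)%:C%C).
  by rewrite CintZ// Cint_real Rint_poisson// mulr1.
have E k : Cint mu (fun y => f y * (poisson (k.+1%:R^-1) (x - y))%:C%C) =
    Cint mu (fun y => f (x - k.+1%:R^-1 *: y) * (poisson 1 y)%:C%C).
  have en0 : - k.+1%:R^-1 != 0 :> R by rewrite oppr_eq0 gt_eqF.
  have ikp : cint mu (fun y => (poisson (k.+1%:R^-1) (x - y))%:C%C).
    by apply: (@cint_reflect R n x (fun y => (poisson (k.+1%:R^-1) y)%:C%C));
      exact/cint_real/rint_poisson.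
  have ii : cint mu (fun y => f y * (poisson (k.+1%:R^-1) (x - y))%:C%C).
    under eq_fun do rewrite mulrC.
    by apply: (cintM ikp (cint_meas fi)) => y; exact: fB.
  rewrite (Cint_affine x en0 ii) -CintZ; last exact: (cint_affine x en0 ii).
  congr Cint; apply/funext => y; rewrite mulrCA normrN ger0_norm ?(ltW (e0 k))//.
  have -> : x - (- k.+1%:R^-1 *: y + x) = k.+1%:R^-1 *: y.
    by rewrite scaleNr opprD opprK addrCA subrr addr0.
  by rewrite scaleNr [- _ + x]addrC -rmorphM/= poisson_scale.
apply: ccvg_near (fun k => esym (E k)) _.
apply: (@cdominated _ _ _ mu _ _ (fun y => B * poisson 1 y)).
- move=> k; apply: cmeasM; last exact: (cint_meas ip).
  apply: (cmeas_comp2 _ (cint_meas fi)).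
  apply: measurable_rowP => i; under eq_fun do rewrite !mxE.
  apply: measurable_funB => //; apply: measurable_funM => //.
  exact: measurable_coord.
- by apply: cmeasM; [exact: cmeas_cst|exact: (cint_meas ip)].
- by move=> y; apply: ccvgM; [exact: fx|exact: ccvg_cst].
- by apply: rintZ; exact: rint_poisson.
- move=> k y; rewrite cabsM cabs_real ger0_norm ?poisson_ge0//.
  by rewrite ler_wpM2r ?poisson_ge0.
Qed.

(** The Abel means have two limits: the inversion integral, by domination by $|\hat f|$, and [f x],
    by [poisson_cvg]. *)
Lemma fourier_inversion f x (B : R) : cint mu f -> cint mu (fourier f) ->
  (forall y, cabs (f y) <= B) ->
  (forall y, ccvg \oo (fun k => f (x - k.+1%:R^-1 *: y)) (f x)) ->
  Cint mu (fun z => fourier f z * cis (tp * dotr z x)) = f x.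
Proof.
move=> fi ffi fB fx; have h1 := poisson_cvg fi fB fx.
apply: ccvg_unique h1.
have e0 (k : nat) : (0 : R) < k.+1%:R^-1 by rewrite invr_gt0.
apply: ccvg_near (fun k => Cint_fourier_expw x (e0 k) fi) _.
apply: (@cdominated _ _ _ mu _ _ (fun y => cabs (fourier f y))).
- move=> k; apply: cmeasM; first exact: (cint_meas ffi).
  by apply: (@cint_meas _ _ _ mu); apply: cint_expw_cis; rewrite invr_gt0.
- by apply: (@cint_meas _ _ _ mu); exact: cint_cis.
- move=> y; apply: ccvgM; first exact: ccvg_cst.
  rewrite -[X in ccvg _ _ X]mul1r; apply: ccvgM; last exact: ccvg_cst.
  by split; [exact: cvg_harmonic_expw|exact: cvg_cst].
- exact: cint_cabs.
- move=> k y; rewrite !cabsM cabs_cis mulr1 cabs_real ger0_norm ?expw_ge0//.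
  by rewrite ler_piMr ?cabs_ge0 ?expw_le1// invr_ge0.
Qed.

End fourier_basics.

(** * A Schur test for convolution with a kernel of mass at most one *)

Section amgm.
Context {R : realType} (n : nat).
Local Notation V := 'rV[R]_n.
Local Notation mu := (@lebesgue_row R n).
Local Open Scope ereal_scope.

Lemma ge0_integral_shift (b : V) (f : V -> \bar R) : measurable_fun setT f ->
  (forall x, 0 <= f x) -> \int[mu]_x f (x + b)%R = \int[mu]_x f x.
Proof.
move=> mf f0; rewrite [RHS](@ge0_integral_affine R n 1 b)//.
rewrite normr1 expr1n mul1e; apply: eq_integral => x _; by rewrite scale1r.
Qed.

Lemma ge0_integral_reflect (b : V) (f : V -> \bar R) : measurable_fun setT f ->
  (forall x, 0 <= f x) -> \int[mu]_x f (b - x)%R = \int[mu]_x f x.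
Proof.
move=> mf f0; rewrite [RHS](@ge0_integral_affine R n (-1) b)//.
rewrite normrN normr1 expr1n mul1e; apply: eq_integral => x _.
by rewrite scaleN1r addrC.
Qed.

Variables (a b p : V -> R).
Hypotheses (ma : measurable_fun setT a) (mb : measurable_fun setT b).
Hypotheses (mp : measurable_fun setT p).
Hypotheses (a0 : forall x, (0 <= a x)%R) (b0 : forall x, (0 <= b x)%R).
Hypotheses (p0 : forall x, (0 <= p x)%R) (p1 : \int[mu]_x (p x)%:E <= 1).

Let mpsub : measurable_fun setT (fun z : V * V => p (z.1 - z.2)%R).
Proof. exact: (measurableT_comp mp (@measurable_subrow R n)). Qed.

Let msq (c : V -> R) : measurable_fun setT c -> measurable_fun setT (fun x => c x ^+ 2)%R.
Proof. by move=> mc; exact: measurable_funX. Qed.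

Let m1 (c : V -> R) : measurable_fun setT c ->
  measurable_fun setT (fun z : V * V => c z.1 ^+ 2 * p (z.1 - z.2))%R.
Proof.
move=> mc; apply: measurable_funM => //.
exact: (measurableT_comp (msq mc) measurable_fst).
Qed.

Let m2 (c : V -> R) : measurable_fun setT c ->
  measurable_fun setT (fun z : V * V => c z.2 ^+ 2 * p (z.1 - z.2))%R.
Proof.
move=> mc; apply: measurable_funM => //.
exact: (measurableT_comp (msq mc) measurable_snd).
Qed.

Let half (c : V -> R) (q : V -> V -> R) : measurable_fun setT c ->
  (forall x, measurable_fun setT (q x)) -> (forall x y, 0 <= q x y)%R ->
  (forall x, \int[mu]_y (q x y)%:E <= 1) ->
  measurable_fun setT (fun x => \int[mu]_y (c x ^+ 2 * q x y)%:E) ->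
  \int[mu]_x \int[mu]_y (c x ^+ 2 * q x y)%:E <= \int[mu]_x (c x ^+ 2)%:E.
Proof.
move=> mc mq q0 q1 mi; apply: ge0_le_integral => //.
- by move=> x _; apply: integral_ge0 => y _; rewrite lee_fin mulr_ge0 ?sqr_ge0.
- by apply/measurable_EFinP; exact: (msq mc).
move=> x _; under eq_integral do rewrite EFinM.
rewrite ge0_integralZl//.
- by rewrite -[leRHS]mule1 lee_wpmul2l// lee_fin sqr_ge0.
- exact/measurable_EFinP.
- by move=> y _; rewrite lee_fin.
- by rewrite lee_fin sqr_ge0.
Qed.

Let sf := @sigma_finite_lebesgue_row R n.

(** Pointwise $abp\le\frac12(a^2+b^2)p$, and integrating $p(x-y)$ in either variable gives at most
    1. No finiteness of the right-hand side is required. *)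
Lemma amgm_convolution :
  \int[mu]_x \int[mu]_y (a x * b y * p (x - y))%:E <=
  (2^-1)%:E * (\int[mu]_x (a x ^+ 2)%:E + \int[mu]_x (b x ^+ 2)%:E).
Proof.
have tm (f : V * V -> R) : measurable_fun setT f -> (forall z, 0 <= f z)%R ->
    measurable_fun setT (fun x => \int[mu]_y (f (x, y))%:E).
  move=> mf f0; apply: (@sf_measurable_tonelli _ _ _ _ _ mu sf (EFin \o f)).
    exact/measurable_EFinP.
  by move=> z; rewrite lee_fin.
pose I1 := \int[mu]_x \int[mu]_y (a x ^+ 2 * p (x - y))%:E.
pose I2 := \int[mu]_x \int[mu]_y (b y ^+ 2 * p (x - y))%:E.
have mab : measurable_fun setT (fun z : V * V => a z.1 * b z.2 * p (z.1 - z.2))%R.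
  apply: measurable_funM => //; apply: measurable_funM.
    exact: (measurableT_comp ma measurable_fst).
  exact: (measurableT_comp mb measurable_snd).
have s1 x : measurable_fun setT (fun y : V => (a x ^+ 2 * p (x - y))%:E).
  by apply/measurable_EFinP; exact: (measurable_fun_pair2 x (m1 ma)).
have s2 x : measurable_fun setT (fun y : V => (b y ^+ 2 * p (x - y))%:E).
  by apply/measurable_EFinP; exact: (measurable_fun_pair2 x (m2 mb)).
have t1 := tm _ (m1 ma) (fun z => mulr_ge0 (sqr_ge0 _) (p0 _)).
have t2 := tm _ (m2 mb) (fun z => mulr_ge0 (sqr_ge0 _) (p0 _)).
have n1 x : 0 <= \int[mu]_y (a x ^+ 2 * p (x - y))%:E.
  by apply: integral_ge0 => y _; rewrite lee_fin mulr_ge0 ?sqr_ge0.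
have n2 x : 0 <= \int[mu]_y (b y ^+ 2 * p (x - y))%:E.
  by apply: integral_ge0 => y _; rewrite lee_fin mulr_ge0 ?sqr_ge0.
apply: (@le_trans _ _ ((2^-1)%:E * (I1 + I2))).
  rewrite /I1 /I2 -ge0_integralD// -ge0_integralZl//; last 2 first.
  - exact: emeasurable_funD.
  - by move=> x _; exact: adde_ge0.
  apply: ge0_le_integral => //.
  - by move=> x _; apply: integral_ge0 => y _; rewrite lee_fin !mulr_ge0.
  - exact: (tm _ mab (fun z => mulr_ge0 (mulr_ge0 (a0 _) (b0 _)) (p0 _))).
  - by apply: emeasurable_funM => //; exact: emeasurable_funD.
  move=> x _; rewrite -ge0_integralD//; last 2 first.
  - by move=> y _; rewrite lee_fin mulr_ge0 ?sqr_ge0.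
  - by move=> y _; rewrite lee_fin mulr_ge0 ?sqr_ge0.
  rewrite -ge0_integralZl//; last 2 first.
  - exact: emeasurable_funD.
  - by move=> y _; rewrite adde_ge0// lee_fin mulr_ge0 ?sqr_ge0.
  apply: ge0_le_integral => //.
  - by move=> y _; rewrite lee_fin !mulr_ge0.
  - by apply/measurable_EFinP; exact: (measurable_fun_pair2 x mab).
  - by apply: emeasurable_funM => //; exact: emeasurable_funD.
  move=> y _; rewrite -EFinD -EFinM lee_fin -mulrDl mulrA ler_wpM2r//.
  by have := sqr_ge0 (a x - b y)%R; nra.
rewrite lee_wpmul2l ?lee_fin ?invr_ge0// leeD//.
  apply: (@half a (fun x y => p (x - y)%R)) => //.
  - by move=> x; exact: (measurable_fun_pair2 x mpsub).
  - by move=> x; rewrite (@ge0_integral_reflect x (EFin \o p))//; exact/measurable_EFinP.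
rewrite /I2 (@sf_fubini_tonelli _ _ _ _ _ mu mu sf sf
  (fun z => (b z.2 ^+ 2 * p (z.1 - z.2))%:E))//=; last 2 first.
- by apply/measurable_EFinP; exact: (m2 mb).
- by move=> z; rewrite lee_fin mulr_ge0 ?sqr_ge0.
apply: (@half b (fun y x => p (x - y)%R)) => //.
- by move=> y; exact: (measurable_fun_pair1 y mpsub).
- by move=> y; rewrite (@ge0_integral_shift (- y) (EFin \o p))//; exact/measurable_EFinP.
- have ms : measurable_fun setT (fun z : V * V => b z.1 ^+ 2 * p (z.2 - z.1))%R.
    rewrite (_ : (fun z => _) =
      (fun z : V * V => b z.2 ^+ 2 * p (z.1 - z.2))%R \o (fun z => (z.2, z.1)))//.
    apply: measurableT_comp; first exact: (m2 mb).
    by apply: measurable_fun_pair; [exact: measurable_snd|exact: measurable_fst].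
  exact: (tm _ ms (fun z => mulr_ge0 (sqr_ge0 _) (p0 _))).
Qed.

End amgm.

(** * The Plancherel inequality for integrable functions *)

Section plancherel.
Context {R : realType} (n : nat).
Local Notation V := 'rV[R]_n.
Local Notation mu := (@lebesgue_row R n).
Local Notation tp := (2 * pi : R).

Lemma complex_conjM (z w : R[i]) : (z * w)^*%C = z^*%C * w^*%C.
Proof. exact: rmorphM. Qed.

Lemma cabs_sqr_conj (w : R[i]) : (cabs w ^+ 2)%:C%C = w * w^*%C.
Proof.
apply: complex_ext; case: w => u v; rewrite ?ReM ?ImM /=.
  by rewrite sqr_sqrtr ?addr_ge0 ?sqr_ge0// mulrN opprK !expr2.
by rewrite mulrN [v * u]mulrC addNr.
Qed.

Lemma cabs_Cint_le_ereal d (T : measurableType d) (m : {measure set T -> \bar R})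
    (f : T -> R[i]) : cint m f -> ((cabs (Cint m f))%:E <= \int[m]_x (cabs (f x))%:E)%E.
Proof.
move=> fi; have := cabs_Cint_le fi; rewrite -lee_fin /Rintegral fineK//.
exact: (integrable_fin_num measurableT (cint_cabs fi)).
Qed.

Variable g : V -> R[i].
Hypothesis gi : cint mu g.

Let cgi : cint mu (fun x => (g x)^*%C).
Proof.
apply: (cint_le (cmeas_conj (cint_meas gi)) (cint_cabs gi)) => x.
by rewrite cabs_conj.
Qed.

Let fourier_conj z : (fourier g z)^*%C = fourier (fun x => (g x)^*%C) (- z).
Proof.
rewrite !fourierE -Cint_conj; last exact: cint_cisN.
congr Cint; apply/funext => x; rewrite complex_conjM.
by rewrite cis_conj dotrNr mulrN.
Qed.

(** The energy density of the transform with Abel damping. It is integrable since the transform of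
    an integrable function is bounded. *)
Let h e z : R := cabs (fourier g z) ^+ 2 * expw e z.

Let M := \int[mu]_x cabs (g x).

Let mh e : measurable_fun setT (h e).
Proof.
apply: measurable_funM; first exact: (measurable_funX 2 (cmeas_cabs (fourier_meas gi))).
rewrite (_ : expw e = fun z => expR (- (e * \sum_i `|z ord0 i|))); last first.
  by apply/funext => z; exact: expwE.
apply: (measurableT_comp (@measurable_expR R)); apply: measurableT_comp => //.
apply: measurable_funM => //; apply: measurable_sum => i.
by apply: measurableT_comp => //; exact: measurable_coord.
Qed.

Let ih e : 0 < e -> rint mu (h e).
Proof.
move=> e0; apply: (@rint_le _ _ _ _ _ (fun z => M ^+ 2 * expw e z)) => //.
  by apply: rintZ; exact: rint_expw.
move=> z; rewrite normrM !ger0_norm ?expw_ge0 ?sqr_ge0// ler_wpM2r ?expw_ge0//.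
by rewrite ler_sqr ?nnegrE ?cabs_ge0 ?fourier_le//; apply: Rintegral_ge0 => x _; exact: cabs_ge0.
Qed.

Let b e z := (fourier g z)^*%C * (expw e z)%:C%C.

Let bi e : 0 < e -> cint mu (b e).
Proof.
move=> e0; rewrite /b; under eq_fun do rewrite mulrC.
apply: (@cintM _ _ _ _ _ _ M).
- exact/cint_real/rint_expw.
- exact: cmeas_conj (fourier_meas gi).
- by move=> z; rewrite cabs_conj fourier_le.
Qed.

Let hE e : 0 < e -> (\int[mu]_z h e z)%:C%C = Cint mu (fun x => g x * fourier (b e) x).
Proof.
move=> e0; rewrite -Cint_real -multiplication_formula//; last exact: bi.
by congr Cint; apply/funext => z; rewrite /h /b rmorphM mulrA -cabs_sqr_conj.
Qed.

(** Up to the reflection $z\mapsto-z$, [b e] is the damped transform of the conjugate of [g], so its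
    transform is the Poisson average of that conjugate. *)
Let fb e x : 0 < e ->
  fourier (b e) x = Cint mu (fun y => (g y)^*%C * (poisson e (x - y))%:C%C).
Proof.
move=> e0; rewrite -(Cint_fourier_expw x e0 cgi).
pose k z := fourier (fun x => (g x)^*%C) z * ((expw e z)%:C%C * cis (tp * dotr z x)).
have ki : cint mu k.
  rewrite /k; under eq_fun do rewrite mulrC.
  apply: (@cintM _ _ _ _ _ _ M).
  - exact: cint_expw_cis.
  - exact: fourier_meas.
  - move=> z; rewrite (le_trans (fourier_le _ cgi))//.
    by under eq_Rintegral do rewrite cabs_conj.
rewrite -(Cint_reflect 0 ki) fourierE; congr Cint; apply/funext => z.
rewrite /k /b sub0r -fourier_conj dotrNl mulrN mulrA.
suff -> : expw e (- z) = expw e z by [].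
by apply: eq_bigr => i _; rewrite mxE normrN.
Qed.

Lemma poisson_le e (x : V) : 0 < e -> poisson e x <= (2 / e) ^+ n.
Proof.
move=> e0; rewrite -[n in leRHS]card_ord -prodr_const; apply: ler_prod => i _.
rewrite divr_ge0 ?mulr_ge0 ?(ltW e0) ?(ltW (poisson1_gt0 e0 _))//=.
rewrite ler_pdivrMr ?poisson1_gt0// -subr_ge0; move: (tp * x ord0 i) => u.
rewrite (_ : _ - _ = 2 / e * u ^+ 2); last by field; rewrite gt_eqF.
by rewrite mulr_ge0 ?sqr_ge0// divr_ge0 ?ltW.
Qed.

(** The damped energy equals $\iint g(x)\overline{g(y)}P_e(x-y)\,dy\,dx$, to which
    [amgm_convolution] applies with both functions equal to $|g|$. *)
Let hle e : 0 < e -> (\int[mu]_z (h e z)%:E <= \int[mu]_x (cabs (g x) ^+ 2)%:E)%E.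
Proof.
move=> e0; have p0 x : 0 <= @poisson R n e x by exact: poisson_ge0.
have mg := cmeas_cabs (cint_meas gi); have mp := rint_meas (@rint_poisson R n e e0).
have pE : (\int[mu]_x (poisson e x)%:E = 1)%E.
  rewrite -(fineK (integrable_fin_num measurableT (@rint_poisson R n e e0))).
  by rewrite -/(Rintegral _ _ _) Rint_poisson.
have h0 z : 0 <= h e z by rewrite mulr_ge0 ?sqr_ge0 ?expw_ge0.
have := @amgm_convolution R n _ _ _ mg mg mp (fun=> cabs_ge0 _) (fun=> cabs_ge0 _) p0.
rewrite pE => /(_ (lexx _)) amgm.
have half2 : ((2^-1)%:E * (\int[mu]_x (cabs (g x) ^+ 2)%:E + \int[mu]_x (cabs (g x) ^+ 2)%:E) =
    \int[mu]_x (cabs (g x) ^+ 2)%:E)%E.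
  case: (\int[mu]_x _)%E => [r||] //=; last by rewrite gt0_muleNy.
    by rewrite -EFinD -EFinM; congr EFin; field.
  by rewrite gt0_muley.
rewrite half2 in amgm; apply: le_trans amgm.
have -> : (\int[mu]_z (h e z)%:E = (cabs (\int[mu]_z h e z)%:C%C)%:E)%E.
  rewrite cabs_real ger0_norm; last by apply: Rintegral_ge0 => z _.
  by rewrite /Rintegral fineK//; exact: (integrable_fin_num measurableT (ih e0)).
rewrite hE//.
have gbi : cint mu (fun x => g x * fourier (b e) x).
  apply: (cintM gi); first exact/fourier_meas/bi.
  by move=> x; apply: fourier_le; exact: bi.
have gpi x : cint mu (fun y => (g y)^*%C * (poisson e (x - y))%:C%C).
  apply: (@cintM _ _ _ _ _ _ ((2 / e) ^+ n)) => //.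
    apply: cmeas_real; apply: (measurableT_comp mp).
    exact: (measurable_fun_pair2 x (@measurable_subrow R n)).
  by move=> y; rewrite cabs_real ger0_norm ?poisson_ge0// poisson_le.
have msub : measurable_fun setT (fun w : V * V => poisson e (w.1 - w.2)).
  exact: (measurableT_comp mp (@measurable_subrow R n)).
have mgg : measurable_fun setT
    (fun w : V * V => cabs (g w.1) * cabs (g w.2) * poisson e (w.1 - w.2)).
  apply: measurable_funM => //; apply: measurable_funM.
    exact: (measurableT_comp mg measurable_fst).
  exact: (measurableT_comp mg measurable_snd).
apply: le_trans (cabs_Cint_le_ereal gbi) _; apply: ge0_le_integral => //.
- by move=> x _; rewrite lee_fin cabs_ge0.
- by apply/measurable_EFinP; exact: cmeas_cabs (cint_meas gbi).
- apply: (@sf_measurable_tonelli _ _ _ _ _ mu (@sigma_finite_lebesgue_row R n)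
    (fun w => (cabs (g w.1) * cabs (g w.2) * poisson e (w.1 - w.2))%:E)).
    exact/measurable_EFinP.
  by move=> w; rewrite lee_fin !mulr_ge0 ?cabs_ge0.
move=> x _; rewrite cabsM EFinM fb//.
under eq_integral do rewrite -mulrA EFinM.
rewrite ge0_integralZl//.
- apply: lee_wpmul2l; first by rewrite lee_fin cabs_ge0.
  rewrite (le_trans (cabs_Cint_le_ereal (gpi x)))// le_eqVlt; apply/orP; left.
  apply/eqP; apply: eq_integral => y _.
  by rewrite cabsM cabs_conj cabs_real ger0_norm.
- apply/measurable_EFinP; apply: measurable_funM => //.
  exact: (measurable_fun_pair2 x msub).
- by move=> y _; rewrite lee_fin mulr_ge0 ?cabs_ge0.
- by rewrite lee_fin cabs_ge0.
Qed.

(** The damping is removed by monotone convergence. Only this inequality is established, for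
    integrable [g]; its right-hand side may be infinite. *)
Lemma plancherel_le :
  (\int[mu]_z (cabs (fourier g z) ^+ 2)%:E <= \int[mu]_x (cabs (g x) ^+ 2)%:E)%E.
Proof.
have e0 (k : nat) : (0 : R) < k.+1%:R^-1 by rewrite invr_gt0.
have cvh z : (fun k => (h (k.+1%:R^-1) z)%:E) @ \oo --> (cabs (fourier g z) ^+ 2)%:E.
  apply: cvg_EFin; first exact: nearW.
  rewrite -[X in _ --> X]mulr1; apply: cvgM; first exact: cvg_cst.
  exact: cvg_harmonic_expw.
have ndh z : nondecreasing_seq (fun k => (h (k.+1%:R^-1) z)%:E).
  move=> k l kl; rewrite lee_fin /h ler_wpM2l ?sqr_ge0// !expwE ler_expR lerN2.
  by rewrite ler_wpM2r ?sumr_ge0// lef_pV2 ?posrE// ler_nat.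
have := @cvg_monotone_convergence _ _ _ mu setT measurableT
  (fun k z => (h (k.+1%:R^-1) z)%:E) (fun k => (measurable_EFinP _ _).2 (mh _))
  (fun k x _ => mulr_ge0 (sqr_ge0 _) (expw_ge0 _ _)) (fun x _ => ndh x).
rewrite (_ : (fun x => limn _) = fun z => (cabs (fourier g z) ^+ 2)%:E); last first.
  by apply/funext => z; apply/cvg_lim; [|exact: cvh].
move=> cv; rewrite -(cvg_lim _ cv)//; apply: lime_le; first by apply/cvg_ex; eexists; exact: cv.
by apply: nearW => k; exact: hle.
Qed.

End plancherel.

(** * Directional derivatives and the calculus of smooth functions *)

Lemma is_derive_affine {R : realType} (g : R -> R) (a b x dg : R) :
  is_derive (a * x + b) 1 g dg -> is_derive x 1 (fun y => g (a * y + b)) (a * dg).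
Proof.
move=> h; apply: trigger_derive; rewrite /GRing.scale/=.
by rewrite addr0 mulr1 mulrC.
Qed.

Lemma mvt_le {R : realType} (f df : R -> R) (B a b : R) :
  (forall t : R, is_derive t 1 f (df t)) -> (forall t : R, `|df t| <= B) ->
  `|f a - f b| <= B * `|a - b|.
Proof.
move=> fd fB; wlog ab : a b / a < b => [H|].
  have [/H//|ba|->] := ltgtP a b; last by rewrite !subrr normr0 mulr0.
  by rewrite distrC [`|a - b|]distrC; exact: H.
rewrite distrC [`|a - b|]distrC.
have [|c _ ->] := @MVT R f df a b ab (fun t _ => fd t).
  by apply: derivable_within_continuous => t _; case: (fd t).
by rewrite normrM ler_wpM2r.
Qed.

Section directional.
Context {R : realType} (n : nat).
Local Notation V := 'rV[R]_n.
Implicit Types (f g : V -> R) (x v : V).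

(** A directional derivative is the derivative at 0 of the restriction to a line. The chain rules
    for affine maps and for functions of a linear form are reduced to one variable in this way. *)
Lemma is_derive_line f x v (df : R) : is_derive x v f df <->
  is_derive (0 : R) 1 (fun t : R => f (t *: v + x)) df.
Proof.
have E : (fun h : R => h^-1 *: (f (h *: v + x) - f x)) =
    (fun h : R => h^-1 *: ((fun t : R => f (t *: v + x)) (h *: 1 + 0) -
      (fun t : R => f (t *: v + x)) 0)).
  by apply/funext => h; rewrite scale0r add0r addr0 [h *: 1]mulr1.
split=> [[d1 d2]|[d1 d2]]; apply: DeriveDef.
- by move: d1; rewrite /derivable /= E.
- by rewrite -d2 /derive /= E.
- by rewrite /derivable /= E.
- by rewrite -d2 /derive /= E.
Qed.

Lemma is_derive_line_at f x v (t : R) : derivable f (t *: v + x) v ->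
  is_derive t 1 (fun t : R => f (t *: v + x)) ('D_v f (t *: v + x)).
Proof.
move=> /derivableP/is_derive_line h.
have h1 : is_derive (1 * t + (- t)) 1 (fun u : R => f (u *: v + (t *: v + x)))
    ('D_v f (t *: v + x)) by rewrite mul1r subrr.
have := is_derive_affine h1; rewrite mul1r; congr (is_derive _ _ _ _).
by apply/funext => u; rewrite mul1r addrA -scalerDl addrNK.
Qed.

Lemma is_derive_comp_affine f x v (a : R) (b : V) : derivable f (a *: x + b) v ->
  is_derive x v (fun y => f (a *: y + b)) (a * 'D_v f (a *: x + b)).
Proof.
move=> /derivableP/is_derive_line h; apply/is_derive_line.
have h1 : is_derive (a * 0 + 0) 1 (fun u : R => f (u *: v + (a *: x + b)))
    ('D_v f (a *: x + b)) by rewrite mulr0 addr0.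
have := is_derive_affine h1; congr (is_derive _ _ _ _).
by apply/funext => u; rewrite addr0 scalerDr scalerA addrA.
Qed.

Lemma is_derive_ridge (g : R -> R) (l : V -> R) x v (c dg : R) :
  (forall (t : R) y, l (t *: v + y) = t * l v + l y) ->
  is_derive (l x + c) 1 g dg -> is_derive x v (fun y => g (l y + c)) (l v * dg).
Proof.
move=> ll h; apply/is_derive_line.
have h1 : is_derive (l v * 0 + (l x + c)) 1 g dg by rewrite mulr0 add0r.
have := is_derive_affine h1; congr (is_derive _ _ _ _).
by apply/funext => u; rewrite ll mulrC addrA.
Qed.

Local Notation e_ j := (delta_mx ord0 j : V).

Lemma partial_lipschitz f (B : R) : (forall x j, derivable f x (e_ j)) ->
  (forall x j, `|'D_(e_ j) f x| <= B) ->
  forall x y, `|f x - f y| <= n%:R * B * `|x - y|.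
Proof.
move=> fd fB x y.
(* The path from [y] to [x] that changes one coordinate at a time; each step costs one mean value
   inequality. *)
pose z k : V := \row_i if (i < k)%N then x ord0 i else y ord0 i.
have zn : z n = x by apply/rowP => i; rewrite mxE ltn_ord.
have z0 : z 0%N = y by apply/rowP => i; rewrite mxE.
suff H k : (k <= n)%N -> `|f (z k) - f (z 0%N)| <= k%:R * B * `|x - y|.
  by have := H n (leqnn n); rewrite zn z0.
elim: k => [_|k IH kn]; first by rewrite subrr normr0 !mul0r.
pose j := Ordinal kn.
have zS : z k.+1 = (x ord0 j - y ord0 j) *: e_ j + z k.
  apply/rowP => i; rewrite !mxE eqxx /= ltnS.
  have [ij|ij] := eqVneq i j.
    by rewrite ij /= leqnn ltnn mulr1 addrNK.
  rewrite mulr0 add0r leq_eqVlt.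
  by rewrite (_ : (i == k :> nat) = false)//; apply: negbTE.
have step : `|f (z k.+1) - f (z k)| <= B * `|x - y|.
  rewrite zS.
  have := @mvt_le R (fun t => f (t *: e_ j + z k)) _ B (x ord0 j - y ord0 j) 0
    (fun t => is_derive_line_at (fd _ _)) (fun t => fB _ _).
  rewrite scale0r add0r subr0 => /le_trans; apply.
  rewrite ler_wpM2l//; first by apply: le_trans (fB x j).
  by have := coord_le_norm (x - y) j; rewrite !mxE.
rewrite -addn1 natrD !mulrDl mul1r [leRHS]addrC.
rewrite (_ : _ - _ = (f (z k.+1) - f (z k)) + (f (z k) - f (z 0%N))); last first.
  by rewrite addrA addrNK addn1.
by rewrite (le_trans (ler_normD _ _))// lerD// IH// ltnW.
Qed.

End directional.

Section smooth_functions.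
Context {R : realType} (n : nat).
Local Notation V := 'rV[R]_n.
Local Notation e_ j := (delta_mx ord0 j : V).
Implicit Types (f g : V -> R).

(** Smoothness up to order [k], organised by the derivative taken first. This allows induction on
    [k] for sums, products and compositions, which the quantification over all index sequences in
    [real_smooth] does not. *)
Fixpoint Cn k f : Prop := continuous f /\
  if k is k'.+1 then forall j, (forall x, derivable f x (e_ j)) /\ Cn k' ('D_(e_ j) f)
  else True.

Lemma Cn_cont k f : Cn k f -> continuous f. Proof. by case: k => [|k] []. Qed.

Lemma CnW k f : Cn k.+1 f -> Cn k f.
Proof.
elim: k f => [|k IH] f [cf df]; first by [].
split => // j; have [d1 d2] := df j; split => //; exact: IH.
Qed.

Lemma partial_rcons s j f : partial (rcons s j) f = partial s ('D_(e_ j) f).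
Proof. by rewrite /partial foldr_rcons. Qed.

Lemma smooth_D j f : real_smooth f -> real_smooth ('D_(e_ j) f).
Proof. by move=> sf s; have := sf (rcons s j); rewrite partial_rcons. Qed.

Lemma smooth_Cn f : real_smooth f <-> forall k, Cn k f.
Proof.
split=> [sf k|Cf].
  elim: k f sf => [|k IH] f sf; split => //.
  - by have [] := sf [::].
  - by have [] := sf [::].
  - move=> j; split; first by move=> x; have [_] := sf [::]; exact.
    by apply: IH; exact: smooth_D.
have H s : forall k, Cn k (partial s f).
  elim: s => [//|j s IH] k /=.
  by have [_ /(_ j)[_]] := IH k.+1.
by move=> s; have [c d] := H s 1%N; split => // x j; have [] := d j.
Qed.

Lemma continuousD_fun f g : continuous f -> continuous g -> continuous (fun x => f x + g x).
Proof. by move=> cf cg x; exact: (cvgD (cf x) (cg x)). Qed.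
Lemma continuousM_fun f g : continuous f -> continuous g -> continuous (fun x => f x * g x).
Proof. by move=> cf cg x; exact: (cvgM (cf x) (cg x)). Qed.

Lemma CnD k f g : Cn k f -> Cn k g -> Cn k (fun x => f x + g x).
Proof.
elim: k f g => [|k IH] f g [cf df] [cg dg]; (split; first exact: continuousD_fun) => //.
move=> j; have [f1 f2] := df j; have [g1 g2] := dg j; split.
  by move=> x; apply: derivableD.
rewrite (_ : 'D_(e_ j) _ = fun x => 'D_(e_ j) f x + 'D_(e_ j) g x); first exact: IH.
by apply/funext => x; exact: deriveD.
Qed.

Lemma CnM k f g : Cn k f -> Cn k g -> Cn k (fun x => f x * g x).
Proof.
elim: k f g => [|k IH] f g hf hg; have [cf df] := hf; have [cg dg] := hg;
  (split; first exact: continuousM_fun) => //.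
move=> j; have [f1 f2] := df j; have [g1 g2] := dg j; split.
  by move=> x; apply: derivableM.
rewrite (_ : 'D_(e_ j) _ = fun x => f x * 'D_(e_ j) g x + g x * 'D_(e_ j) f x).
  by apply: CnD; apply: IH => //; exact: CnW.
by apply/funext => x; exact: deriveM.
Qed.

Lemma Cn_cst k (c : R) : Cn k (fun=> c).
Proof.
elim: k c => [|k IH] c; (split; first exact: cst_continuous) => //.
move=> j; split; first by move=> x; exact: derivable_cst.
rewrite (_ : 'D_(e_ j) _ = fun=> 0)//.
by apply/funext => x; exact: derive_cst.
Qed.

Lemma continuous_affine_row (a : R) (b : V) : continuous (fun x : V => a *: x + b).
Proof. by move=> x; exact: (cvgD (@scaler_continuous _ _ a x) (cvg_cst b)). Qed.

Lemma Cn_affine k f (a : R) (b : V) : Cn k f -> Cn k (fun x => f (a *: x + b)).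
Proof.
elim: k f => [|k IH] f [cf df]; (split; first by
  move=> x; apply: (continuous_comp (@continuous_affine_row a b x) (cf _))) => //.
move=> j; have [f1 f2] := df j; split.
  by move=> x; have [] := @is_derive_comp_affine R n f x (e_ j) a b (f1 _).
rewrite (_ : 'D_(e_ j) _ = fun x => a * 'D_(e_ j) f (a *: x + b)).
  exact: (CnM (Cn_cst k a) (IH _ f2)).
by apply/funext => x; have [] := @is_derive_comp_affine R n f x (e_ j) a b (f1 _).
Qed.

Lemma smoothD f g : real_smooth f -> real_smooth g -> real_smooth (fun x => f x + g x).
Proof.
by move=> /smooth_Cn hf /smooth_Cn hg; apply/smooth_Cn => k; exact: CnD.
Qed.
Lemma smoothM f g : real_smooth f -> real_smooth g -> real_smooth (fun x => f x * g x).
Proof.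
by move=> /smooth_Cn hf /smooth_Cn hg; apply/smooth_Cn => k; exact: CnM.
Qed.
Lemma smooth_cst (c : R) : real_smooth (fun _ : V => c).
Proof. by apply/smooth_Cn => k; exact: Cn_cst. Qed.
Lemma smoothZ (c : R) f : real_smooth f -> real_smooth (fun x => c * f x).
Proof. by apply: smoothM; exact: smooth_cst. Qed.
Lemma smoothN f : real_smooth f -> real_smooth (fun x => - f x).
Proof. by move=> /(smoothZ (-1)); under eq_fun do rewrite mulN1r. Qed.
Lemma smoothB f g : real_smooth f -> real_smooth g -> real_smooth (fun x => f x - g x).
Proof. by move=> hf /smoothN hg; exact: smoothD. Qed.
Lemma smooth_affine f (a : R) (b : V) : real_smooth f -> real_smooth (fun x => f (a *: x + b)).
Proof. by move=> /smooth_Cn hf; apply/smooth_Cn => k; exact: Cn_affine. Qed.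
Lemma smooth_prod m (F : 'I_m -> V -> R) : (forall i, real_smooth (F i)) ->
  real_smooth (fun x => \prod_(i < m) F i x).
Proof.
elim: m F => [|m IH] F hF; first by under eq_fun do rewrite big_ord0; exact: smooth_cst.
by under eq_fun do rewrite big_ord_recl; apply: smoothM => //; exact: IH.
Qed.

Lemma smooth_cont f : real_smooth f -> continuous f.
Proof. by move=> /(_ [::]) []. Qed.
Lemma smooth_derivable f x j : real_smooth f -> derivable f x (e_ j).
Proof. by move=> /(_ [::]) [_]; exact. Qed.
Lemma smooth_partial s f : real_smooth f -> real_smooth (partial s f).
Proof.
by elim/last_ind: s f => [//|s j IH] f sf; rewrite partial_rcons; apply/IH/smooth_D.
Qed.

(** The one-variable counterpart, with the derivative given as a witness, so that an explicit family
    closed under differentiation is smooth by induction. *)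
Fixpoint Sm k (g : R -> R) : Prop := continuous g /\
  if k is k'.+1 then exists g' : R -> R, (forall t, is_derive t (1 : R) g (g' t)) /\ Sm k' g'
  else True.

Lemma SmD k (g h : R -> R) : Sm k g -> Sm k h -> Sm k (fun t => g t + h t).
Proof.
elim: k g h => [|k IH] g h [cg dg] [ch dh]; (split; first by
  move=> x; exact: (cvgD (cg x) (ch x))) => //.
have [g' [g1 g2]] := dg; have [h' [h1 h2]] := dh; exists (fun t => g' t + h' t).
by split; [move=> t; apply: is_deriveD|exact: IH].
Qed.

Lemma SmZ k c (g : R -> R) : Sm k g -> Sm k (fun t => c * g t).
Proof.
elim: k g => [|k IH] g [cg dg]; (split; first by
  move=> x; exact: (cvgM (cvg_cst c) (cg x))) => //.
have [g' [g1 g2]] := dg; exists (fun t => c * g' t).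
by split; [move=> t; apply: is_deriveZ|exact: IH].
Qed.

Lemma Cn_ridge k (g : R -> R) (l : V -> R) (c : R) : continuous l ->
  (forall v (t : R) y, l (t *: v + y) = t * l v + l y) ->
  Sm k g -> Cn k (fun x => g (l x + c)).
Proof.
move=> cl ll.
elim: k g => [|k IH] g [cg dg].
  split => // x; apply: (@continuous_comp _ _ _ (fun x => l x + c) g); last exact: cg.
  exact: (cvgD (cl x) (cvg_cst c)).
split.
  move=> x; apply: (@continuous_comp _ _ _ (fun x => l x + c) g); last exact: cg.
  exact: (cvgD (cl x) (cvg_cst c)).
have [g' [g1 g2]] := dg => j; split.
  by move=> x; have [] := is_derive_ridge (ll (e_ j)) (g1 (l x + c)).
rewrite (_ : 'D_(e_ j) _ = fun x => l (e_ j) * g' (l x + c)).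
  exact: (CnM (Cn_cst k (l (e_ j))) (IH _ g2)).
by apply/funext => x; have [] := is_derive_ridge (ll (e_ j)) (g1 (l x + c)).
Qed.

Lemma smooth_ridge (g : R -> R) (l : V -> R) (c : R) : continuous l ->
  (forall v (t : R) y, l (t *: v + y) = t * l v + l y) ->
  (forall k, Sm k g) -> real_smooth (fun x => g (l x + c)).
Proof. by move=> cl ll gs; apply/smooth_Cn => k; exact: Cn_ridge. Qed.

End smooth_functions.

(** * Smooth cut-off functions on the line *)

Section beta.
Context {R : realType}.

Lemma Sm_cos k (c : R) : Sm k (fun t : R => cos (t + c)).
Proof.
have cc (d : R) : continuous (fun t : R => cos (t + d)).
  move=> t; apply: (@continuous_comp _ _ _ (fun t => t + d) cos); last exact: continuous_cos.
  exact: (cvgD cvg_id (cvg_cst d)).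
elim: k c => [|k IH] c; (split; first exact: cc) => //.
exists (fun t => cos (t + (c + pi / 2))); split; last exact: IH.
move=> t; apply: trigger_derive; rewrite /GRing.scale/=.
by rewrite addrA cosDpihalf addr0 mulr1.
Qed.

(** The classical $e^{-1/t}$ extended by 0, for $k=0$. The whole family is needed because
    $\beta_k'=\beta_{k+2}-k\beta_{k+1}$, so its linear span is closed under differentiation. *)
Definition beta k (t : R) : R := if 0 < t then t ^- k * expR (- t^-1) else 0.

Lemma beta_ge0 k t : 0 <= beta k t.
Proof.
by rewrite /beta; case: ifP => // t0; rewrite mulr_ge0 ?expR_ge0// invr_ge0 exprn_ge0 ?ltW.
Qed.

Lemma beta_le0 k t : t <= 0 -> beta k t = 0.
Proof. by rewrite /beta ltNge => ->. Qed.

Lemma beta_gt0 k t : 0 < t -> 0 < beta k t.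
Proof. by move=> t0; rewrite /beta t0 mulr_gt0 ?expR_gt0// invr_gt0 exprn_gt0. Qed.

Lemma beta0_le1 t : beta 0 t <= 1.
Proof.
rewrite /beta; case: ifP => // t0.
by rewrite expr0 invr1 mul1r expR_le1 oppr_le0 invr_ge0 ltW.
Qed.

(** From $e^{1/t}\ge t^{-(k+1)}/(k+1)!$. Applied to $\beta_{k+1}(t)=\beta_k(t)/t$, it shows that the
    difference quotient of $\beta_k$ at 0 tends to 0. *)
Lemma beta_le k t : 0 <= t -> beta k t <= (k.+1)`!%:R * t.
Proof.
move=> t0; rewrite /beta; case: ifPn => [{}t0|_]; last by rewrite mulr_ge0.
have := @expR_ge1Dxn R t^-1 k; rewrite invr_ge0 => /(_ (ltW t0)) h.
have h2 : t ^- k.+1 / (k.+1)`!%:R <= expR t^-1.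
  by apply: le_trans h; rewrite -exprVn lerDr.
rewrite expRN ler_pdivrMr ?expR_gt0//.
rewrite (_ : t ^- k = ((k.+1)`!%:R * t) * (t ^- k.+1 / (k.+1)`!%:R)).
  by rewrite ler_wpM2l// mulr_ge0 ?ler0n ?ltW.
have f0 : (k.+1)`!%:R != 0 :> R by rewrite pnatr_eq0 -lt0n fact_gt0.
by rewrite exprS; field; rewrite f0/= expf_neq0 gt_eqF.
Qed.

Lemma beta_div k t : t != 0 -> t^-1 * beta k t = beta k.+1 t.
Proof.
move=> t0; rewrite /beta; case: ifP => _; last by rewrite mulr0.
by rewrite exprS invfM mulrA.
Qed.

Lemma is_derive_exprV k (t : R) : t != 0 ->
  is_derive t 1 (fun u => (u ^+ k)^-1) (- k%:R * t ^- k.+1).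
Proof.
move=> t0; have h : is_derive t (1 : R) (fun u : R => u ^+ k) (k%:R * t ^+ k.-1).
  elim: k => [|k IH]; first by rewrite mul0r; exact: is_derive_cst.
  have -> : (fun u : R => u ^+ k.+1) = (fun u : R => u * u ^+ k).
    by apply/funext => u; rewrite exprS.
  apply: trigger_derive; rewrite /GRing.scale/= mulr1.
  by case: k {IH} => [|k] /=; rewrite ?exprS; ring.
have tk : t ^+ k != 0 by rewrite expf_neq0.
have := @is_deriveV R (fun u : R => u ^+ k) t _ 1 tk h; congr (is_derive _ _ _ _).
rewrite /GRing.scale /=; case: k {h} tk => [|k] tk; first by rewrite oppr0 !mul0r mulr0.
have tk' : t ^+ k != 0 by rewrite expf_neq0.
by rewrite !exprS /=; field; rewrite t0 tk'.
Qed.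

Lemma is_derive_beta k (t : R) :
  is_derive t 1 (beta k) (beta k.+2 t + (- k%:R) * beta k.+1 t).
Proof.
have [t0|t0|->] := ltgtP t 0.
- have E : {near t, (fun=> 0 : R) =1 beta k}.
    near=> u; rewrite beta_le0// ltW//; near: u; exact: lt_nbhsl.
  apply: DeriveDef; first exact: (near_eq_derivable E (derivable_cst _ _ _)).
  by rewrite -(near_eq_derive _ E) derive_cst !beta_le0 ?(ltW t0)// mulr0 addr0.
- pose g (u : R) : R := (u ^+ k)^-1 * expR (- u^-1).
  have E : {near t, g =1 beta k}.
    near=> u; rewrite /beta /g ifT//; near: u; exact: lt_nbhsr.
  have tn0 : t != 0 by rewrite gt_eqF.
  have gd : is_derive t 1 g (beta k.+2 t + (- k%:R) * beta k.+1 t).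
    have h1 := is_derive_exprV k tn0.
    have h2 : is_derive t (1 : R) (fun u : R => u^-1) (- t ^- 2).
      have := is_derive_exprV 1 tn0; rewrite mulN1r.
      by under [X in is_derive _ _ X]eq_fun do rewrite expr1.
    apply: trigger_derive; rewrite /GRing.scale /= /beta t0 !exprS.
    move: (expR _) => e; have tk' : t ^+ k != 0 by rewrite expf_neq0.
    by field; rewrite tn0 tk'.
  apply: DeriveDef; first by apply: (near_eq_derivable E); case: gd.
  by rewrite -(near_eq_derive _ E); case: gd.
- have h : h^-1 *: ((beta k \o shift 0) (h *: (1 : R)) - beta k 0) @[h --> 0^'] --> (0 : R).
    rewrite (_ : (fun h => _) = fun h : R => h^-1 * beta k h); last first.
      by apply/funext => u; rewrite /= addr0 [u *: 1]mulr1 [beta k 0]beta_le0// subr0.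
    apply/cvgrPdist_le => e e0; near=> u.
    have u0 : u != 0 by near: u; exact: nbhs_dnbhs_neq.
    rewrite sub0r normrN beta_div// ger0_norm ?beta_ge0//.
    have [un|up] := lerP u 0; first by rewrite beta_le0// ltW.
    rewrite (le_trans (beta_le _ (ltW up)))// mulrC -ler_pdivlMr ?ltr0n ?fact_gt0//.
    rewrite (le_trans (ler_norm _))//.
    near: u; apply: dnbhs0_le.
    by rewrite divr_gt0 ?ltr0n ?fact_gt0.
  rewrite !beta_le0// mulr0 addr0; apply: DeriveDef.
    by apply/cvg_ex; exists 0.
  by apply/cvg_lim.
Unshelve. all: by end_near. Qed.

Lemma Sm_beta m k : Sm m (beta k).
Proof.
have cb j : continuous (beta j).
  move=> t; apply: differentiable_continuous; apply/derivable1_diffP.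
  by case: (is_derive_beta j t).
elim: m k => [|m IH] k; (split; first exact: cb) => //.
exists (fun t => beta k.+2 t + (- k%:R) * beta k.+1 t); split.
  by move=> t; exact: is_derive_beta.
by apply: SmD; [exact: IH|apply: SmZ; exact: IH].
Qed.
End beta.

Section coordinate_functions.
Context {R : realType} (n : nat).
Local Notation V := 'rV[R]_n.
Local Notation e_ j := (delta_mx ord0 j : V).

Lemma continuous_coord (i : 'I_n) : continuous (fun x : V => x ord0 i).
Proof. exact: coord_continuous. Qed.

Lemma smooth_coord1 (g : R -> R) (a c : R) (i : 'I_n) : (forall k, Sm k g) ->
  real_smooth (fun x : V => g (a * x ord0 i + c)).
Proof.
move=> gs; apply: (@smooth_ridge R n g (fun x : V => a * x ord0 i)) => //.
  by move=> x; exact: (cvgM (cvg_cst a) (@continuous_coord i x)).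
by move=> v t y; rewrite !mxE mulrDr mulrCA.
Qed.

Lemma continuous_dotr (x : V) : continuous (fun z : V => dotr x z).
Proof.
rewrite /dotr; elim: (index_enum 'I_n) => [|i r IH].
  by under eq_fun do rewrite big_nil; exact: cst_continuous.
under eq_fun do rewrite big_cons; move=> z.
exact: (cvgD (cvgM (cvg_cst (x ord0 i)) (@continuous_coord i z)) (IH z)).
Qed.

Lemma dotr_line (x v y : V) (t : R) : dotr x (t *: v + y) = t * dotr x v + dotr x y.
Proof.
rewrite /dotr mulr_sumr -big_split; apply: eq_bigr => i _.
by rewrite !mxE /= mulrDr mulrCA.
Qed.

Lemma dotr_delta (x : V) j : dotr x (e_ j) = x ord0 j.
Proof.
rewrite /dotr (bigD1 j)//= big1 ?addr0 ?mxE ?eqxx ?mulr1//.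
by move=> i ij; rewrite mxE (negbTE ij) andbF mulr0.
Qed.

Lemma smooth_cos_dotr (x : V) (a c : R) : real_smooth (fun z : V => cos (a * dotr x z + c)).
Proof.
have := @smooth_ridge R n cos (fun z => a * dotr x z) c; apply.
- by move=> z; exact: (cvgM (cvg_cst a) (@continuous_dotr x z)).
- by move=> v t y; rewrite dotr_line mulrDr mulrCA.
- move=> k; have := @Sm_cos R k 0; congr (Sm k _).
  by apply/funext => t; rewrite addr0.
Qed.

(** Since $-\sin t=\cos(t+\pi/2)$, each derivative multiplies by a coordinate and advances the phase
    by $\pi/2$. A single family indexed by the phase therefore covers all derivatives of cosine and
    sine. *)
Lemma partial_cos_dotr (s : seq 'I_n) (x : V) (a c : R) :
  partial s (fun z : V => cos (a * dotr x z + c)) =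
  fun z => (\prod_(j <- s) (a * x ord0 j)) * cos (a * dotr x z + (c + pi / 2 * (size s)%:R)).
Proof.
elim: s => [|j s IH].
  by apply/funext => z; rewrite big_nil mul1r mulr0 addr0.
apply/funext => z; rewrite /= -/(partial s _) IH.
set A := \prod_(j <- s) _; set d := c + pi / 2 * (size s)%:R.
have h : is_derive z (e_ j) (fun z : V => cos (a * dotr x z + d))
    (a * x ord0 j * (- sin (a * dotr x z + d))).
  rewrite -(dotr_delta x j).
  apply: (@is_derive_ridge R n cos (fun z => a * dotr x z)).
    by move=> t y; rewrite dotr_line mulrDr mulrCA.
have := is_deriveZ A h => -[_]; rewrite /GRing.scale /= => ->.
rewrite big_cons -/A -cosDpihalf mulrA [A * _]mulrC.
by congr (_ * cos _); rewrite /d /= -[(size s).+1]addn1 natrD mulrDr mulr1 !addrA.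
Qed.
End coordinate_functions.

(** * Real and complex test functions *)

Section test_functions.
Context {R : realType} (n : nat).
Local Notation V := 'rV[R]_n.
Local Notation e_ j := (delta_mx ord0 j : V).
Implicit Types (g h : V -> R) (k : R).

Lemma compact_cube k : compact (cube n k : set V).
Proof.
rewrite cubeE; apply: (@rV_compact R n (fun=> `[- k, k]%classic)) => i.
exact: segment_compact.
Qed.

Lemma closed_cube k : closed (cube n k : set V).
Proof. by apply: compact_closed; [exact: norm_hausdorff|exact: compact_cube]. Qed.

Definition supp_in k (T : nmodType) (g : V -> T) := forall x, ~ cube n k x -> g x = 0.

Lemma cube_sub k k' : k <= k' -> (cube n k : set V) `<=` cube n k'.
Proof. by move=> kk x h i; exact: le_trans (h i) _. Qed.

Lemma supp_inW k k' (T : nmodType) (g : V -> T) : k <= k' -> supp_in k g -> supp_in k' g.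
Proof. by move=> kk h x xk; apply: h => /(cube_sub kk). Qed.

Lemma partial_supp k s g : supp_in k g -> supp_in k (partial s g).
Proof.
move=> hg; elim: s => [//|j s IH] x xk /=; rewrite -/(partial s g).
rewrite (@near_eq_derive _ _ _ (partial s g) (fun=> 0) x).
  exact: derive_cst.
have ho : open (~` cube n k : set V) by apply: closed_openC; exact: closed_cube.
by apply: filterS (open_nbhs_nbhs (conj ho xk)) => y; exact: IH.
Qed.

(** Compact support is recorded as vanishing outside a cube, a form that passes directly to sums,
    products, derivatives and convolutions. *)
Definition rtest g := real_smooth g /\ exists k, supp_in k g.

Lemma rtest_D s g : rtest g -> rtest (partial s g).
Proof.
move=> [sg [k gk]]; split; first exact: smooth_partial.
by exists k; exact: partial_supp.
Qed.

Lemma supp_bounded k g : continuous g -> supp_in k g -> exists2 B, 0 <= B & forall x, `|g x| <= B.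
Proof.
move=> cg gk.
have /compact_bounded/pinfty_ex_gt0 [M M0 hM] : compact [set g x | x in cube n k].
  by apply: continuous_compact; [exact: continuous_subspaceT|exact: compact_cube].
exists M; first exact: ltW.
move=> x; have [xk|xk] := pselect (cube n k x); last by rewrite gk// normr0 ltW.
by apply: hM; exists x.
Qed.

Lemma rtest_bounded s g : rtest g -> exists2 B, 0 <= B & forall x, `|partial s g x| <= B.
Proof.
by move=> /(rtest_D s) [/smooth_cont cg [k gk]]; exact: supp_bounded gk.
Qed.

Lemma test_supp (phi : V -> R[i]) (Omega : set V) : test_function Omega phi ->
  exists2 k : R, 0 <= k & supp_in k phi.
Proof.
move=> [_ /compact_bounded/pinfty_ex_gt0 [M M0 hM] _]; exists M; first exact: ltW.
move=> x xM; apply: contrapT => /eqP px; apply: xM.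
by apply/cube_norm; [exact: ltW|apply: hM; apply: subset_closure].
Qed.

Lemma test_rtest (phi : V -> R[i]) (Omega : set V) : test_function Omega phi ->
  rtest (Re \o phi) /\ rtest (Im \o phi).
Proof.
move=> tphi; have [k k0 pk] := test_supp tphi; have [[s1 s2] _ _] := tphi.
by split; split => //; exists k => x /pk /= ->.
Qed.

Lemma supp_compact k (phi : V -> R[i]) : supp_in k phi ->
  csupport phi `<=` cube n k /\ compact (csupport phi).
Proof.
move=> pk; have sub : csupport phi `<=` cube n k.
  rewrite (closure_id (cube n k)).1; last exact: closed_cube.
  apply: closure_subset => x /= px.
  by apply: contrapT => /pk p0; rewrite p0 eqxx in px.
split => //; apply: subclosed_compact sub; [exact: closed_closure|exact: compact_cube].
Qed.

Lemma rtest_test (phi : V -> R[i]) : rtest (Re \o phi) -> rtest (Im \o phi) ->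
  test_function setT phi.
Proof.
move=> [s1 [k1 h1]] [s2 [k2 h2]].
have hk : supp_in (Num.max k1 k2) phi.
  move=> x xk; apply: complex_ext; [apply: h1|apply: h2] => xk'; apply: xk;
  by apply: cube_sub xk'; rewrite le_max lexx ?orbT.
by have [_ c] := supp_compact hk.
Qed.

Lemma rtestD g h : rtest g -> rtest h -> rtest (fun x => g x + h x).
Proof.
move=> [sg [k gk]] [sh [l hl]]; split; first exact: smoothD.
exists (Num.max k l) => x xk.
have kl : k <= Num.max k l by rewrite le_max lexx.
have lk : l <= Num.max k l by rewrite le_max lexx orbT.
by rewrite (supp_inW kl gk xk) (supp_inW lk hl xk) addr0.
Qed.

Lemma rtestMl g h : real_smooth g -> rtest h -> rtest (fun x => g x * h x).
Proof.
move=> sg [sh [l hl]]; split; first exact: smoothM.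
by exists l => x xl; rewrite hl// mulr0.
Qed.

Lemma rtest_affine g (a : R) (b : V) : a != 0 -> rtest g -> rtest (fun x => g (a *: x + b)).
Proof.
move=> a0 [sg [k gk]]; split; first exact: smooth_affine.
exists ((`|k| + `|b|) / `|a|) => x xk; apply: gk => h; apply: xk.
have k0 : 0 <= `|k| by [].
apply/cube_norm; first by rewrite divr_ge0// addr_ge0.
rewrite ler_pdivlMr ?normr_gt0// mulrC -normrZ.
have {}h : `|a *: x + b| <= `|k| by apply/cube_norm => //; exact: cube_sub (ler_norm k) _ h.
rewrite -[a *: x](addrK b) (le_trans (ler_normB _ _))// lerD//.
Qed.

(** A smooth function positive exactly on the open box between [a] and [b], for [m > 0]. As [m]
    grows it tends to the indicator of that box, because [beta 0] tends to 1 at infinity. *)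
Definition box_bump (a b : V) (m : R) (x : V) : R :=
  \prod_(i < n) (beta 0 (m * (x ord0 i - a ord0 i)) * beta 0 (m * (b ord0 i - x ord0 i))).

Lemma box_bump_ge0 (a b : V) (m : R) (x : V) : 0 <= box_bump a b m x.
Proof. by apply: prodr_ge0 => i _; rewrite mulr_ge0 ?beta_ge0. Qed.

Lemma box_bump_le1 (a b : V) (m : R) (x : V) : box_bump a b m x <= 1.
Proof.
apply: prodr_ile1 => i _; rewrite mulr_ge0 ?beta_ge0//=.
by rewrite mulr_ile1 ?beta_ge0 ?beta0_le1.
Qed.

Lemma box_bump_out (a b : V) (m : R) (x : V) : 0 < m ->
  ~ (forall i, a ord0 i < x ord0 i < b ord0 i) -> box_bump a b m x = 0.
Proof.
move=> m0 /existsNP [i hi]; rewrite /box_bump (bigD1 i)//=.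
have [h1|h1] := lerP (x ord0 i) (a ord0 i).
  by rewrite beta_le0 ?mul0r// pmulr_rle0// subr_le0.
have [h2|h2] := lerP (b ord0 i) (x ord0 i).
  by rewrite [X in _ * X * _]beta_le0 ?mulr0 ?mul0r// pmulr_rle0// subr_le0.
by exfalso; apply: hi; rewrite h1 h2.
Qed.

Lemma box_bump_gt0 (a b : V) (m : R) (x : V) : 0 < m ->
  (forall i, a ord0 i < x ord0 i < b ord0 i) -> 0 < box_bump a b m x.
Proof.
move=> m0 h; apply: prodr_gt0 => i _; have /andP[h1 h2] := h i.
by rewrite mulr_gt0// beta_gt0// mulr_gt0// subr_gt0.
Qed.

Lemma box_bump_smooth (a b : V) (m : R) : real_smooth (box_bump a b m).
Proof.
apply: smooth_prod => i; apply: smoothM.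
  have := @smooth_coord1 R n (beta 0) m (- (m * a ord0 i)) i (fun j : nat => Sm_beta j 0).
  by congr real_smooth; apply/funext => x; rewrite mulrBr.
have := @smooth_coord1 R n (beta 0) (- m) (m * b ord0 i) i (fun j : nat => Sm_beta j 0).
by congr real_smooth; apply/funext => x; rewrite mulrBr mulNr addrC.
Qed.

Lemma box_bump_supp (a b : V) (m : R) : 0 < m -> supp_in (`|a| + `|b|) (box_bump a b m).
Proof.
move=> m0 x xk; apply: box_bump_out => // h; apply: xk => i.
have /andP[h1 h2] := h i; have := coord_le_norm a i; have := coord_le_norm b i.
rewrite !ler_norml => /andP[_ h3] /andP[h4 _].
apply/andP; split; first by rewrite opprD (le_trans _ (ltW h1))// (le_trans _ h4)// lerBlDr lerDl.
by rewrite (le_trans (ltW h2))// (le_trans h3)// lerDr.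
Qed.

Lemma box_bump_rtest (a b : V) (m : R) : 0 < m -> rtest (box_bump a b m).
Proof.
by move=> m0; split; [exact: box_bump_smooth|eexists; exact: box_bump_supp].
Qed.

End test_functions.

Section partial_algebra.
Context {R : realType} (n : nat).
Local Notation V := 'rV[R]_n.
Local Notation e_ j := (delta_mx ord0 j : V).
Implicit Types (f g : V -> R).

Lemma partialD s f g : real_smooth f -> real_smooth g ->
  partial s (fun x => f x + g x) = fun x => partial s f x + partial s g x.
Proof.
move=> sf sg; elim: s => [//|j s IH].
rewrite /= -/(partial s _) IH; apply/funext => x; rewrite deriveD//.
  by apply: smooth_derivable; exact: smooth_partial.
by apply: smooth_derivable; exact: smooth_partial.
Qed.

Lemma partialZ s (c : R) f : real_smooth f ->
  partial s (fun x => c * f x) = fun x => c * partial s f x.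
Proof.
move=> sf; elim: s => [//|j s IH].
rewrite /= -/(partial s _) IH; apply/funext => x; rewrite deriveZ//.
by apply: smooth_derivable; exact: smooth_partial.
Qed.

Lemma partial_affine s (a : R) (b : V) f : real_smooth f ->
  partial s (fun x => f (a *: x + b)) = fun x => a ^+ size s * partial s f (a *: x + b).
Proof.
move=> sf; elim: s => [|j s IH]; first by apply/funext => x; rewrite expr0 mul1r.
rewrite /= -/(partial s _) IH; apply/funext => x.
have ss := smooth_partial s sf.
have := @is_derive_comp_affine R n (partial s f) x (e_ j) a b (smooth_derivable ss).
move=> [d1 d2]; rewrite deriveZ// d2.
by rewrite exprSr -mulrA.
Qed.

Lemma lipschitz_continuous f (C : R) : (forall x y, `|f x - f y| <= C * `|x - y|) ->
  continuous f.
Proof.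
move=> fC x; apply/(@cvgrPdist_le _ _ _ _ (nbhs_filter x)) => e e0.
have C0 : 0 < `|C| + 1 by rewrite ltr_wpDl.
have c0 : 0 < e / (`|C| + 1) by rewrite divr_gt0.
near=> y; rewrite (le_trans (fC x y))//.
apply: (@le_trans _ _ ((`|C| + 1) * `|x - y|)).
  by rewrite ler_wpM2r// (le_trans (ler_norm C))// lerDl.
rewrite mulrC -ler_pdivlMr//.
Unshelve. all: by end_near. Qed.

(** Finitely many index sequences have length at most [N]: in the induction the first index runs
    over a finite type, and the sum of the constants serves all of them. *)
Lemma seq_bound (P : seq 'I_n -> R -> Prop) :
  (forall s C C', C <= C' -> P s C -> P s C') -> (forall s, exists2 C, 0 <= C & P s C) ->
  forall N, exists2 C, 0 <= C & forall s, (size s <= N)%N -> P s C.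
Proof.
move=> mono ex N; elim: N P mono ex => [|N IH] P mono ex.
  by have [C C0 PC] := ex [::]; exists C => // -[|].
have [C0 C00 PC0] := ex [::].
have h j : exists C, 0 <= C /\ forall s, (size s <= N)%N -> P (j :: s) C.
  have [C ? ?] := IH (fun s => P (j :: s)) (fun s => mono (j :: s)) (fun s => ex (j :: s)).
  by exists C.
have [C hC] := choice h.
have S0 : 0 <= \sum_j C j by apply: sumr_ge0 => j _; have [] := hC j.
exists (C0 + \sum_j C j); first exact: addr_ge0.
move=> [_|j s sN]; first by apply: mono PC0; rewrite lerDl.
have [c0 /(_ s sN)] := hC j; apply: mono.
rewrite (bigD1 j)//= addrCA lerDl addr_ge0//.
by apply: sumr_ge0 => i _; have [] := hC i.
Qed.

End partial_algebra.

(** * Differentiation under the integral sign *)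

Section smooth_integral.
Context {R : realType} (n : nat) d (X : measurableType d) (m : {measure set X -> \bar R}).
Local Notation V := 'rV[R]_n.
Local Notation e_ j := (delta_mx ord0 j : V).
Variables (F : V -> X -> R) (G : seq 'I_n -> X -> R).
Hypothesis sF : forall x, real_smooth (F ^~ x).
Hypothesis mF : forall s y, measurable_fun setT (fun x => partial s (F ^~ x) y).
Hypothesis iG : forall s, rint m (G s).
Hypothesis FG : forall s y x, `|partial s (F ^~ x) y| <= G s x.

Let u s y := \int[m]_x partial s (F ^~ x) y.

Let G0 s x : 0 <= G s x. Proof. exact: le_trans (FG s 0 x). Qed.

Let iF s y : rint m (fun x => partial s (F ^~ x) y).
Proof. exact: rint_le (mF s y) (iG s) (FG s y). Qed.

Let isum s : rint m (fun x => \sum_j G (j :: s) x).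
Proof.
elim: (index_enum 'I_n) => [|j r IH].
  under eq_fun do rewrite big_nil.
  by rewrite /rint (_ : _ \o _ = cst 0%E)//; exact: integrable0.
by under eq_fun do rewrite big_cons; apply: rintD.
Qed.

(** The majorants of the derivatives one order higher provide a Lipschitz constant for each
    integrand, and their integral provides one for [u s]. *)
Let u_cont s : continuous (u s).
Proof.
apply: (@lipschitz_continuous _ _ _ (n%:R * \int[m]_x (\sum_j G (j :: s) x))) => y y'.
rewrite /u -RintegralB//; [|exact: iF|exact: iF].
have iB := rintD (iF s y) (rintN (iF s y')).
apply: (le_trans (le_normr_Rintegral measurableT iB)).
rewrite -mulrAC -RintegralZl//; last exact: isum.
apply: le_Rintegral => //.
- exact: (integrable_norm iB).
- exact: (rintZ _ (isum s)).
move=> x _; rewrite mulrAC.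
apply: partial_lipschitz => [z j|z j].
  by apply: smooth_derivable; exact: smooth_partial.
rewrite (le_trans (FG (j :: s) z x))// (bigD1 j)//= lerDl.
by apply: sumr_ge0.
Qed.

(** Restricted to the line in direction [j], this is one-variable differentiation under the integral
    on $]-1,1[$, dominated by [G (j :: s)]. *)
Let u_der s y j : is_derive y (e_ j) (u s) (u (j :: s) y).
Proof.
apply/is_derive_line.
pose f (t : R) x := partial s (F ^~ x) (t *: e_ j + y).
have fd (t : R) x : is_derive t 1 (f ^~ x) (partial (j :: s) (F ^~ x) (t *: e_ j + y)).
  by apply: is_derive_line_at; apply: smooth_derivable; exact: smooth_partial.
have I0 : (`]-1, 1[%classic : set R) 0 by rewrite /= in_itv/= ltrN10 ltr01.
have fG (t : R) x : (`]-1, 1[%classic : set R) t -> setT x -> `|partial1of2 f t x| <= G (j :: s) x.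
  by move=> _ _; rewrite partial1of2E; have [_ ->] := fd t x.
have fdd (t : R) x : (`]-1, 1[%classic : set R) t -> setT x -> derivable (f ^~ x) t 1.
  by move=> _ _; have [] := fd t x.
have h1 := @derivable_under_integral R _ X m f setT measurableT 0 (-1) 1 I0
  (fun t _ => iF s _) fdd (G (j :: s)) (G0 (j :: s)) (iG (j :: s)) fG.
have h2 := @differentiation_under_integral R _ X m f setT measurableT 0 (-1) 1 I0
  (fun t _ => iF s _) fdd (G (j :: s)) (G0 (j :: s)) (iG (j :: s)) fG.
apply: DeriveDef; first exact: h1.
rewrite -derive1E h2; apply: eq_Rintegral => x _.
by rewrite partial1of2E; have [_ ->] := fd 0 x; rewrite scale0r add0r.
Qed.

Lemma partial_integral s : partial s (fun y => \int[m]_x F y x) = u s.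
Proof.
elim: s => [//|j s IH]; rewrite /= -/(partial s _) IH.
by apply/funext => y; have [_] := u_der s y j.
Qed.

Lemma smooth_integral : real_smooth (fun y => \int[m]_x F y x).
Proof.
move=> s; rewrite partial_integral; split; first exact: u_cont.
by move=> x j; have [] := u_der s x j.
Qed.

Lemma partial_integralE s y :
  partial s (fun y => \int[m]_x F y x) y = \int[m]_x partial s (F ^~ x) y.
Proof. by rewrite partial_integral. Qed.

End smooth_integral.

(** * Correlations of a test function with an integrable function *)

Section real_convolution.
Context {R : realType} (n : nat).
Local Notation V := 'rV[R]_n.
Local Notation mu := (@lebesgue_row R n).
Implicit Types (a b : V -> R).

(** A correlation rather than a convolution: it is the average against [b x] of the functions
    [a (x - y)] of [y], the ones to which a distribution is applied in [toeplitz]. *)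
Definition rconv a b (y : V) := \int[mu]_x (a (x - y) * b x).

Variables (a b : V -> R).
Hypotheses (ta : rtest a) (ib : rint mu b).

Let sF x : real_smooth (fun y => a (x - y) * b x).
Proof.
under eq_fun do rewrite mulrC; apply: smoothZ.
have := smooth_affine (-1) x ta.1; congr real_smooth.
by apply/funext => y; rewrite scaleN1r addrC.
Qed.

Let pF s x : partial s (fun y => a (x - y) * b x) =
  fun y => (-1) ^+ size s * (partial s a (x - y) * b x).
Proof.
have sa := ta.1.
rewrite (_ : (fun y => _) = fun y => b x * (fun y => a (-1 *: y + x)) y); last first.
  by apply/funext => y; rewrite mulrC scaleN1r addrC.
rewrite partialZ; last exact: smooth_affine.
rewrite partial_affine//; apply/funext => y.
by rewrite mulrC scaleN1r addrC -mulrA.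
Qed.

Let msub (g : V -> R) y : real_smooth g -> measurable_fun setT (fun x : V => g (x - y)).
Proof.
move=> sg; have mg : measurable_fun setT g.
  by apply: continuous_measurable_row; exact: smooth_cont.
exact: (measurableT_comp mg (measurable_fun_pair1 y (@measurable_subrow R n))).
Qed.

Let mF s y : measurable_fun setT (fun x : V => partial s (fun y => a (x - y) * b x) y).
Proof.
under eq_fun do rewrite pF.
apply: measurable_funM => //; apply: measurable_funM; last exact: rint_meas ib.
by apply: msub; apply: smooth_partial; exact: ta.1.
Qed.

Let Gex s : exists B, forall x, `|partial s a x| <= B.
Proof. by have [B _ hB] := rtest_bounded s ta; exists B. Qed.

Let G s x := sval (cid (Gex s)) * `|b x|.

Let iG s : rint mu (G s).
Proof. by apply: rintZ; exact: (integrable_norm ib). Qed.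

Let FG s y x : `|partial s (fun y => a (x - y) * b x) y| <= G s x.
Proof.
rewrite pF normrM normrX normrN1 expr1n mul1r normrM /G ler_wpM2r//.
by case: cid => B /= hB.
Qed.

Lemma rconv_smooth : real_smooth (rconv a b).
Proof. exact: (smooth_integral sF mF iG FG). Qed.

Lemma rconv_cint y : rint mu (fun x => a (x - y) * b x).
Proof. exact: (rint_le (mF [::] y) (iG [::]) (FG [::] y)). Qed.

Lemma partial_rconv s y : partial s (rconv a b) y = (-1) ^+ size s * rconv (partial s a) b y.
Proof.
rewrite (partial_integralE sF mF iG FG) /rconv -RintegralZl//.
  by apply: eq_Rintegral => x _; rewrite pF.
have := rint_le (mF s y) (iG s) (FG s y); move=> /(rintZ ((-1) ^+ size s)).
congr (integrable _ _ _); apply/funext => x /=.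
by rewrite pF mulrA -exprMn mulrNN mulr1 expr1n mul1r.
Qed.

Lemma rconv_supp k r : supp_in k a -> supp_in r b -> supp_in (k + r) (rconv a b).
Proof.
move=> ak br y yk; rewrite /rconv.
rewrite (_ : (fun x => _) = cst 0); first by rewrite Rintegral_cst// mul0r.
apply/funext => x /=; have [xr|xr] := pselect (cube n r x); last by rewrite br// mulr0.
rewrite ak ?mul0r// => xk; apply: yk => i.
have := xr i; have := xk i; rewrite !mxE => h1 h2.
rewrite -[y ord0 i](subKr (x ord0 i)) (le_trans (ler_normB _ _))// addrC lerD//.
Qed.

Lemma rconv_rtest r : supp_in r b -> rtest (rconv a b).
Proof.
move=> br; split; first exact: rconv_smooth.
by have [_ [k ak]] := ta; exists (k + r); exact: rconv_supp.
Qed.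

End real_convolution.

Section complex_partial.
Context {R : realType} (n : nat).
Local Notation V := 'rV[R]_n.
Local Notation e_ j := (delta_mx ord0 j : V).
Implicit Types (phi psi : V -> R[i]) (c : R[i]).
Local Notation ctest := (test_function (setT : set V)).

Lemma csmoothD phi psi : smooth phi -> smooth psi -> smooth (fun x => phi x + psi x).
Proof.
move=> [p1 p2] [q1 q2]; split.
  by have := smoothD p1 q1; congr real_smooth; apply/funext => x; rewrite /= ReD.
by have := smoothD p2 q2; congr real_smooth; apply/funext => x; rewrite /= ImD.
Qed.

Lemma csmoothM phi psi : smooth phi -> smooth psi -> smooth (fun x => phi x * psi x).
Proof.
move=> [p1 p2] [q1 q2]; split.
  have := smoothB (smoothM p1 q1) (smoothM p2 q2); congr real_smooth.
  by apply/funext => x; rewrite /= ReM.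
have := smoothD (smoothM p1 q2) (smoothM p2 q1); congr real_smooth.
by apply/funext => x; rewrite /= ImM.
Qed.

Lemma csmooth_cst c : smooth (fun _ : V => c).
Proof. by split; exact: smooth_cst. Qed.

Lemma csmoothZ c phi : smooth phi -> smooth (fun x => c * phi x).
Proof. by apply: csmoothM; exact: csmooth_cst. Qed.

Lemma csmooth_affine (a : R) (b : V) phi : smooth phi -> smooth (fun x => phi (a *: x + b)).
Proof.
by move=> [p1 p2]; split; [have := smooth_affine a b p1|have := smooth_affine a b p2].
Qed.

Lemma csmooth_meas phi : smooth phi -> cmeas phi.
Proof.
by move=> [/smooth_cont p1 /smooth_cont p2]; split; exact: continuous_measurable_row.
Qed.

Lemma cpartialD s phi psi x : smooth phi -> smooth psi ->
  cpartial s (fun x => phi x + psi x) x = cpartial s phi x + cpartial s psi x.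
Proof.
move=> [p1 p2] [q1 q2]; apply: complex_ext; rewrite ?ReD ?ImD /=.
  rewrite (_ : Re \o _ = fun x => (Re \o phi) x + (Re \o psi) x) ?partialD//.
  by apply/funext => z; exact: ReD.
rewrite (_ : Im \o _ = fun x => (Im \o phi) x + (Im \o psi) x) ?partialD//.
by apply/funext => z; exact: ImD.
Qed.

Lemma cpartialZ s c phi x : smooth phi ->
  cpartial s (fun x => c * phi x) x = c * cpartial s phi x.
Proof.
move=> [p1 p2]; apply: complex_ext; rewrite ?ReM ?ImM /=.
  rewrite (_ : Re \o _ = fun x => Re c * (Re \o phi) x + (- Im c) * (Im \o phi) x).
    by rewrite partialD ?partialZ ?mulNr//; exact: smoothZ.
  by apply/funext => z; rewrite /= ReM mulNr.
rewrite (_ : Im \o _ = fun x => Re c * (Im \o phi) x + Im c * (Re \o phi) x).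
  by rewrite partialD ?partialZ//; exact: smoothZ.
by apply/funext => z; rewrite /= ImM.
Qed.

Lemma cpartial_affine s (a : R) (b : V) phi x : smooth phi ->
  cpartial s (fun x => phi (a *: x + b)) x = (a ^+ size s)%:C%C * cpartial s phi (a *: x + b).
Proof.
move=> [p1 p2]; apply: complex_ext; rewrite ?ReM ?ImM /= ?mul0r ?subr0 ?addr0.
  by have -> := partial_affine s a b p1.
by have -> := partial_affine s a b p2.
Qed.

Lemma ctestD phi psi : ctest phi -> ctest psi -> ctest (fun x => phi x + psi x).
Proof.
move=> /test_rtest[p1 p2] /test_rtest[q1 q2]; apply: rtest_test.
  by have := rtestD p1 q1; congr rtest; apply/funext => x; rewrite /= ReD.
by have := rtestD p2 q2; congr rtest; apply/funext => x; rewrite /= ImD.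
Qed.

Lemma ctestM phi psi : smooth phi -> ctest psi -> ctest (fun x => phi x * psi x).
Proof.
move=> sp tpsi; have [k k0 pk] := test_supp tpsi; have [ss _ _] := tpsi.
have hk : supp_in k (fun x => phi x * psi x) by move=> x /pk ->; rewrite mulr0.
by have [_ c] := supp_compact hk; split => //; exact: csmoothM.
Qed.

Lemma ctestZ c phi : ctest phi -> ctest (fun x => c * phi x).
Proof. by apply: ctestM; exact: csmooth_cst. Qed.

Lemma ctest_affine (a : R) (b : V) phi : a != 0 -> ctest phi ->
  ctest (fun x => phi (a *: x + b)).
Proof.
move=> a0 /test_rtest[p1 p2]; apply: rtest_test.
  exact: (rtest_affine b a0 p1).
exact: (rtest_affine b a0 p2).
Qed.

Lemma ctest_reflect (b : V) phi : ctest phi -> ctest (fun x => phi (b - x)).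
Proof.
have n0 : (-1 : R) != 0 by rewrite oppr_eq0 oner_eq0.
by move=> /(ctest_affine b n0); under eq_fun do rewrite scaleN1r addrC.
Qed.

Lemma ctest_shift (b : V) phi : ctest phi -> ctest (fun x => phi (x + b)).
Proof. by move=> /(ctest_affine b (oner_neq0 _)); under eq_fun do rewrite scale1r. Qed.

Lemma ctest0 : ctest (fun _ : V => 0).
Proof.
apply: rtest_test; split.
- exact: (@smooth_cst R n 0).
- by exists 0 => x _.
- exact: (@smooth_cst R n 0).
- by exists 0 => x _.
Qed.

Lemma cpartial_reflect s (b : V) phi x : smooth phi ->
  cpartial s (fun x => phi (b - x)) x = ((-1) ^+ size s)%:C%C * cpartial s phi (b - x).
Proof.
move=> sp; rewrite (_ : (fun x => _) = fun x => phi (-1 *: x + b)).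
  by rewrite cpartial_affine// scaleN1r addrC.
by apply/funext => z; rewrite scaleN1r addrC.
Qed.

Lemma cabs_signr k : cabs (((-1) ^+ k)%:C%C : R[i]) = 1.
Proof. by rewrite cabs_real normrX normrN1 expr1n. Qed.

Lemma ctest_bounded s phi : ctest phi -> exists2 B, 0 <= B & forall x, cabs (cpartial s phi x) <= B.
Proof.
move=> /test_rtest[/(rtest_bounded s)[B1 B10 h1] /(rtest_bounded s)[B2 B20 h2]].
exists (B1 + B2); first exact: addr_ge0.
move=> x; apply: (le_trans (cabs_le_ReIm (cpartial s phi x))).
exact: (lerD (h1 x) (h2 x)).
Qed.

Lemma cpartial0 phi x : cpartial [::] phi x = phi x.
Proof. by apply: complex_ext. Qed.

Lemma ctest_bounded0 phi : ctest phi -> exists2 B, 0 <= B & forall x, cabs (phi x) <= B.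
Proof.
by move=> /(ctest_bounded [::])[B B0 h]; exists B => // x; rewrite -cpartial0.
Qed.

Lemma ctest_lipschitz_s s phi : ctest phi ->
  exists2 L, 0 <= L & forall x y, cabs (cpartial s phi x - cpartial s phi y) <= L * `|x - y|.
Proof.
move=> tphi; have [p1 p2] := test_rtest tphi.
have [L hL] : exists L, 0 <= L /\ forall j x, cabs (cpartial (j :: s) phi x) <= L.
  have h j : exists B, 0 <= B /\ forall x, cabs (cpartial (j :: s) phi x) <= B.
    by have [B ? ?] := ctest_bounded (j :: s) tphi; exists B.
  have [B hB] := choice h; exists (\sum_j B j); split.
    by apply: sumr_ge0 => j _; have [] := hB j.
  move=> j x; have [_ /(_ x)] := hB j => /le_trans; apply.
  by rewrite (bigD1 j)//= lerDl sumr_ge0// => i _; have [] := hB i.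
have [L0 {}hL] := hL.
exists (n%:R * L + n%:R * L); first by rewrite addr_ge0// mulr_ge0.
move=> x y; rewrite (le_trans (cabs_le_ReIm _))// mulrDl lerD//.
  rewrite ReD ReN /=; apply: partial_lipschitz.
    by move=> z j; apply: smooth_derivable; apply: smooth_partial; exact: p1.1.
  by move=> z j; apply: le_trans (hL j z); exact: (Re_le_cabs (cpartial (j :: s) phi z)).
rewrite ImD ImN /=; apply: partial_lipschitz.
  by move=> z j; apply: smooth_derivable; apply: smooth_partial; exact: p2.1.
by move=> z j; apply: le_trans (hL j z); exact: (Im_le_cabs (cpartial (j :: s) phi z)).
Qed.

Lemma ctest_lipschitz phi N : ctest phi -> exists2 L, 0 <= L &
  forall s, (size s <= N)%N -> forall x y,
    cabs (cpartial s phi x - cpartial s phi y) <= L * `|x - y|.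
Proof.
move=> tphi; apply: (@seq_bound R n (fun s L => forall x y,
    cabs (cpartial s phi x - cpartial s phi y) <= L * `|x - y|)).
  by move=> s C C' CC' h x y; rewrite (le_trans (h x y))// ler_wpM2r.
by move=> s; exact: ctest_lipschitz_s.
Qed.

End complex_partial.

Section complex_convolution.
Context {R : realType} (n : nat).
Local Notation V := 'rV[R]_n.
Local Notation mu := (@lebesgue_row R n).
Local Notation ctest := (test_function (setT : set V)).

Definition cconv (a b : V -> R[i]) (y : V) : R[i] := Cint mu (fun x => a (x - y) * b x).

Variables (a b : V -> R[i]).
Hypotheses (ta : ctest a) (ib : cint mu b).

Let t1 : rtest (Re \o a). Proof. by have [] := test_rtest ta. Qed.
Let t2 : rtest (Im \o a). Proof. by have [] := test_rtest ta. Qed.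
Let sa : smooth a. Proof. by case: ta. Qed.

Let i1 := ib.1.
Let i2 := ib.2.

Let RecE : Re \o cconv a b = fun y => rconv (Re \o a) (Re \o b) y +
  (-1) * rconv (Im \o a) (Im \o b) y.
Proof.
apply/funext => y; rewrite /rconv mulN1r -RintegralB//; [|exact: rconv_cint|exact: rconv_cint].
by apply: eq_Rintegral => x _ /=; rewrite ReM.
Qed.

Let ImcE : Im \o cconv a b = fun y => rconv (Re \o a) (Im \o b) y +
  rconv (Im \o a) (Re \o b) y.
Proof.
apply/funext => y; rewrite /rconv -RintegralD//; [|exact: rconv_cint|exact: rconv_cint].
by apply: eq_Rintegral => x _ /=; rewrite ImM.
Qed.

Lemma cconv_smooth : smooth (cconv a b).
Proof.
split; rewrite ?RecE ?ImcE; apply: smoothD; do ?apply: smoothZ; exact: rconv_smooth.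
Qed.

Lemma cconv_int s y : cint mu (fun x => cpartial s a (x - y) * b x).
Proof.
have tp1 := rtest_D s t1; have tp2 := rtest_D s t2.
split.
  have := rintD (rconv_cint tp1 i1 y) (rintN (rconv_cint tp2 i2 y)).
  by congr (integrable _ _ _); apply/funext => x /=; rewrite ReM.
have := rintD (rconv_cint tp1 i2 y) (rconv_cint tp2 i1 y).
by congr (integrable _ _ _); apply/funext => x /=; rewrite ImM.
Qed.

Lemma cpartial_cconv s y : cpartial s (cconv a b) y =
  ((-1) ^+ size s)%:C%C * Cint mu (fun x => cpartial s a (x - y) * b x).
Proof.
have tp1 := rtest_D s t1; have tp2 := rtest_D s t2.
rewrite /cpartial RecE ImcE.
rewrite partialD; [|exact: rconv_smooth|by apply: smoothZ; exact: rconv_smooth].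
rewrite partialZ; last exact: rconv_smooth.
rewrite partialD; [|exact: rconv_smooth|exact: rconv_smooth].
rewrite !partial_rconv//; apply: complex_ext; rewrite ?ReM ?ImM /= ?mul0r ?subr0 ?addr0.
  rewrite mulN1r -mulrBr; congr (_ * _).
  rewrite /rconv -RintegralB//; [|exact: rconv_cint|exact: rconv_cint].
  by apply: eq_Rintegral => x _ /=; rewrite ReM.
rewrite -mulrDr; congr (_ * _).
rewrite /rconv -RintegralD//; [|exact: rconv_cint|exact: rconv_cint].
by apply: eq_Rintegral => x _ /=; rewrite ImM.
Qed.

Lemma cconv_supp k r : supp_in k a -> supp_in r b -> supp_in (k + r) (cconv a b).
Proof.
move=> ak br y yk; rewrite /cconv (_ : (fun x => _) = fun=> 0).
  by rewrite (Cint_real mu (fun=> 0)) Rintegral_cst// mul0r.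
apply/funext => x /=; have [xr|xr] := pselect (cube n r x); last by rewrite br// mulr0.
rewrite ak ?mul0r// => xk; apply: yk => i.
have := xr i; have := xk i; rewrite !mxE => h1 h2.
by rewrite -[y ord0 i](subKr (x ord0 i)) (le_trans (ler_normB _ _))// addrC lerD.
Qed.

Lemma cconv_test r : supp_in r b -> ctest (cconv a b).
Proof.
move=> br; have [k _ ak] := test_supp ta.
by have [_ c] := supp_compact (cconv_supp ak br); split => //; exact: cconv_smooth.
Qed.

End complex_convolution.

(** * Linearity and continuity estimates for a distribution *)

Section distribution.
Context {R : realType} (n : nat).
Local Notation V := 'rV[R]_n.
Local Notation mu := (@lebesgue_row R n).
Local Notation ctest := (test_function (setT : set V)).
Variable f : (V -> R[i]) -> R[i].
Hypothesis df : is_distribution f.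

Lemma dist_lin c phi psi : ctest phi -> ctest psi ->
  f (fun x => c * phi x + psi x) = c * f phi + f psi.
Proof. by move=> tp tq; have [lf _] := df; exact: lf. Qed.

Lemma dist0 : f (fun=> 0) = 0.
Proof.
have := dist_lin 1 (ctest0 n) (ctest0 n); rewrite mulr0 addr0 mul1r => /eqP.
by rewrite -{1}[f _]addr0 (inj_eq (addrI _)) eq_sym => /eqP.
Qed.

Lemma distD phi psi : ctest phi -> ctest psi -> f (fun x => phi x + psi x) = f phi + f psi.
Proof.
move=> tp tq; have := dist_lin 1 tp tq; rewrite mul1r => <-.
by congr f; apply/funext => x; rewrite mul1r.
Qed.

Lemma distZ c phi : ctest phi -> f (fun x => c * phi x) = c * f phi.
Proof.
move=> tp; have := dist_lin c tp (ctest0 n); rewrite dist0 addr0 => <-.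
by congr f; apply/funext => x; rewrite addr0.
Qed.

(** The continuity estimate on a cube with a nonnegative constant, where the extended-real seminorm
    is replaced by any real bound [S] on the derivatives involved. *)
Lemma dist_bound r : exists C, exists N, 0 <= C /\ forall phi, ctest phi -> supp_in r phi ->
  forall S, (forall x s, (size s <= N)%N -> cabs (cpartial s phi x) <= S) ->
  cabs (f phi) <= C * S.
Proof.
have [_ /(_ _ (@compact_cube R n r))[C [N h]]] := df.
exists `|C|, N; split => // phi tp pr S hS.
have sn : (seminorm 0 N phi <= S%:E)%E.
  apply: ge_ereal_sup => _ [x [s [sN ->]]].
  by rewrite expr0 mul1r lee_fin; exact: hS.
have sn0 : (0 <= seminorm 0 N phi)%E.
  apply: (@le_trans _ _ ((1 + `|0 : V|) ^+ 0 * cabs (cpartial [::] phi 0))%:E).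
    by rewrite lee_fin expr0 mul1r cabs_ge0.
  by apply: ereal_sup_ubound; exists 0, [::].
rewrite -lee_fin (le_trans (h _ tp _))//; first by have [] := supp_compact pr.
apply: (@le_trans _ _ (`|C|%:E * seminorm 0 N phi)%E).
  by rewrite lee_wpmul2r// lee_fin ler_norm.
by rewrite EFinM lee_wpmul2l.
Qed.

End distribution.

(** * Exchanging a distribution with an integral *)

Section local_estimates.
Context {R : realType} (n : nat).
Local Notation V := 'rV[R]_n.
Local Notation mu := (@lebesgue_row R n).
Local Notation ctest := (test_function (setT : set V)).
Variable f : (V -> R[i]) -> R[i].
Hypothesis df : is_distribution f.

Lemma locally_lipschitz_cont (u : V -> R[i]) :
  (forall r, exists2 C, 0 <= C &
    forall x y, cube n r x -> cube n r y -> cabs (u x - u y) <= C * `|x - y|) ->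
  continuous (Re \o u) /\ continuous (Im \o u).
Proof.
move=> hu.
have H (p : R[i] -> R) : (forall z w, `|p z - p w| <= cabs (z - w)) -> continuous (p \o u).
  move=> hp x; apply/(@cvgrPdist_le _ _ _ _ (nbhs_filter x)) => e e0.
  have [C C0 hC] := hu (`|x| + 1).
  have c0 : 0 < Num.min 1 (e / (C + 1)) by rewrite lt_min ltr01 divr_gt0// ltr_wpDl.
  apply/nbhs_ballP; exists (Num.min 1 (e / (C + 1))) => //= y.
  rewrite mx_norm_ball /ball_ /= lt_min => /andP[xy1 xy2].
  have x1 : 0 <= `|x| + 1 by rewrite addr_ge0.
  rewrite (le_trans (hp _ _))// (le_trans (hC x y _ _))//.
  - by apply/cube_norm => //; rewrite lerDl.
  - apply/cube_norm => //; rewrite -[y](subKr x) (le_trans (ler_normB _ _))// lerD//.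
    exact: ltW.
  - move: xy2; rewrite ltr_pdivlMr ?ltr_wpDl// => /ltW; apply: le_trans.
    by rewrite mulrC ler_wpM2l// lerDl.
split.
  have hR (z w : R[i]) : `|Re z - Re w| <= cabs (z - w) by rewrite -ReN -ReD; exact: Re_le_cabs.
  exact: (H _ hR).
have hI (z w : R[i]) : `|Im z - Im w| <= cabs (z - w) by rewrite -ImN -ImD; exact: Im_le_cabs.
exact: (H _ hI).
Qed.

Lemma ctest_cint a : ctest a -> cint mu a.
Proof.
move=> ta; have [B _ hB] := ctest_bounded0 ta; have [k _ ak] := test_supp ta.
apply: (@cint_bounded_supp R n a B k) => //.
by apply: csmooth_meas; case: ta.
Qed.

Lemma reflect_supp k r a (x0 : V) : supp_in k a -> cube n r x0 ->
  supp_in (k + r) (fun y => a (x0 - y) : R[i]).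
Proof.
move=> ak x0r y yk; apply: ak => h; apply: yk => i.
have := h i; have := x0r i; rewrite !mxE => h1 h2.
by rewrite -[y ord0 i](subKr (x0 ord0 i)) (le_trans (ler_normB _ _))// addrC lerD.
Qed.

Variable a : V -> R[i].
Hypothesis ta : ctest a.

Let sa : smooth a. Proof. by case: ta. Qed.

(** The function fed to [f] is $\int(a(x-y)-a(x_0-y))b(x)\,dx$. The derivatives of [a] are
    Lipschitz, so those of this function are at most $L\delta\int|b|$ when [b] lives within distance
    [delta] of [x0]. *)
Lemma dist_local r : exists2 C, 0 <= C & forall x0 : V, cube n r x0 ->
  forall delta, 0 <= delta <= 1 -> forall b, cint mu b ->
  (forall x, delta < `|x - x0| -> b x = 0) ->
  cabs (f (cconv a b) - Cint mu b * toeplitz f a x0) <= C * delta * \int[mu]_x cabs (b x).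
Proof.
have [k k0 ak] := test_supp ta.
(* Since [delta] is at most 1, [b] is supported in the cube of radius [r + 1] for every [x0] and
   [delta]; the constants are therefore uniform. *)
have [C [N [C0 hC]]] := dist_bound df (k + (r + 1)).
have [L L0 hL] := ctest_lipschitz N ta.
exists (C * L); first exact: mulr_ge0.
move=> x0 x0r delta /andP[d0 d1] b ib bd.
have br : supp_in (r + 1) b.
  move=> x xr; apply: bd; rewrite ltNge; apply/negP => h; apply: xr => i.
  have := x0r i; have := le_trans (coord_le_norm (x - x0) i) (le_trans h d1).
  rewrite !mxE => h1 h2.
  by rewrite -[x ord0 i](subrK (x0 ord0 i)) (le_trans (ler_normD _ _))// addrC lerD.
have tc : ctest (cconv a b) by exact: cconv_test br.
have tr : ctest (fun y => a (x0 - y)) by exact: ctest_reflect.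
have E : f (cconv a b) - Cint mu b * toeplitz f a x0 =
    f (fun y => (- Cint mu b) * a (x0 - y) + cconv a b y).
  by rewrite (dist_lin df _ tr tc) mulNr addrC.
rewrite E -!mulrA; apply: hC.
- by apply: ctestD => //; exact: ctestZ.
- move=> y yk; rewrite (cconv_supp ak br)// addr0 (reflect_supp ak x0r) ?mulr0//.
  by move=> h; apply: yk; apply: cube_sub h; rewrite lerD2l lerDl.
move=> y s sN.
rewrite cpartialD; [|by apply: csmoothZ; case: tr|by case: tc].
rewrite cpartialZ; last by case: tr.
rewrite cpartial_reflect// cpartial_cconv// mulrCA -mulrDr cabsM cabs_signr mul1r.
have i2 := cconv_int ta ib s y.
have i1 : cint mu (fun x => cpartial s a (x0 - y) * b x) by exact: cintZ.
rewrite mulNr mulrC -CintZ// addrC -CintB//.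
rewrite mulrA -RintegralZl//; last exact: cint_cabs.
apply: cabs_Cint_le_ub.
- by apply: cmeasB; [exact: cint_meas i2|exact: cint_meas i1].
- by apply: rintZ; exact: cint_cabs.
move=> x; rewrite -mulrBl cabsM.
have [xd|xd] := lerP `|x - x0| delta; last by rewrite bd// cabs0 !mulr0.
rewrite ler_wpM2r ?cabs_ge0// (le_trans (hL s sN _ _))//.
rewrite ler_wpM2l// (_ : x - y - (x0 - y) = x - x0)//.
by rewrite opprB addrA addrNK.
Qed.

Lemma toeplitz_lipschitz r : exists2 C, 0 <= C &
  forall x x0, cube n r x -> cube n r x0 ->
  cabs (toeplitz f a x - toeplitz f a x0) <= C * `|x - x0|.
Proof.
have [k k0 ak] := test_supp ta.
have [C [N [C0 hC]]] := dist_bound df (k + r).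
have [L L0 hL] := ctest_lipschitz N ta.
exists (C * L); first exact: mulr_ge0.
move=> x x0 xr x0r; have tx y : ctest (fun z => a (y - z)) by exact: ctest_reflect.
have -> : toeplitz f a x - toeplitz f a x0 = f (fun y => (-1) * a (x0 - y) + a (x - y)).
  by rewrite (dist_lin df _ (tx x0) (tx x)) mulN1r addrC.
rewrite -mulrA; apply: hC.
- by apply: ctestD => //; exact: ctestZ.
- by move=> y yk; rewrite (reflect_supp ak x0r)// (reflect_supp ak xr)// mulr0 addr0.
move=> y s sN.
rewrite cpartialD; [|by apply: csmoothZ; case: (tx x0)|by case: (tx x)].
rewrite cpartialZ; last by case: (tx x0).
rewrite !cpartial_reflect// mulN1r addrC -mulrBr cabsM cabs_signr mul1r.
rewrite (le_trans (hL s sN _ _))// (_ : x - y - (x0 - y) = x - x0)//.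
by rewrite opprB addrA addrNK.
Qed.

Lemma toeplitz_cont : continuous (Re \o toeplitz f a) /\ continuous (Im \o toeplitz f a).
Proof. by apply: locally_lipschitz_cont => r; exact: toeplitz_lipschitz. Qed.

Lemma toeplitz_meas : cmeas (toeplitz f a).
Proof.
by have [c1 c2] := toeplitz_cont; split; exact: continuous_measurable_row.
Qed.

Lemma cont_bounded_cube (u : V -> R[i]) (r : R) :
  continuous (Re \o u) -> continuous (Im \o u) ->
  exists2 B, 0 <= B & forall x, cube n r x -> cabs (u x) <= B.
Proof.
move=> c1 c2.
have h (g : V -> R) : continuous g -> exists2 B, 0 <= B & forall x, cube n r x -> `|g x| <= B.
  move=> cg.
  have /compact_bounded/pinfty_ex_gt0 [M M0 hM] : compact [set g x | x in cube n r].
    by apply: continuous_compact; [exact: continuous_subspaceT|exact: compact_cube].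
  by exists M; [exact: ltW|move=> x xr; apply: hM; exists x].
have [B1 B10 h1] := h _ c1; have [B2 B20 h2] := h _ c2.
exists (B1 + B2); first exact: addr_ge0.
move=> x xr; apply: (le_trans (cabs_le_ReIm _)).
exact: (lerD (h1 x xr) (h2 x xr)).
Qed.

Lemma toeplitz_cint r b : cint mu b -> supp_in r b -> cint mu (fun x => toeplitz f a x * b x).
Proof.
move=> ib br; have [c1 c2] := toeplitz_cont.
have [B B0 hB] := cont_bounded_cube r c1 c2.
apply: (@cint_le _ _ _ _ _ (fun x => B * cabs (b x))).
- by apply: cmeasM; [exact: toeplitz_meas|exact: cint_meas ib].
- by apply: rintZ; exact: cint_cabs.
move=> x; rewrite cabsM; have [xr|xr] := pselect (cube n r x).
  by rewrite ler_wpM2r ?cabs_ge0 ?hB.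
by rewrite br// cabs0 !mulr0.
Qed.

Lemma cube_net r (delta : R) : 0 < delta -> exists s : seq V,
  (forall x, x \in s -> cube n r x) /\
  (forall x, cube n r x -> exists2 x0, x0 \in s & `|x - x0| <= delta).
Proof.
move=> d0; have := @compact_cube R n r; rewrite compact_cover.
move=> /(_ V (cube n r) (fun x => ball x delta)) [].
- by move=> x _; exact: ball_open.
- by move=> x xr; exists x => //; exact: ballxx.
move=> D Dr hD; exists (finmap.enum_fset D); split.
  by move=> x xD; have := Dr x xD; rewrite inE.
move=> x /hD[x0 /= x0D]; rewrite mx_norm_ball /ball_ /= => h; exists x0 => //.
by rewrite distrC ltW.
Qed.

Lemma cconvD (b c : V -> R[i]) : cint mu b -> cint mu c ->
  cconv a (fun x => b x + c x) = fun y => cconv a b y + cconv a c y.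
Proof.
move=> ib ic; apply/funext => y; rewrite /cconv.
have hb := cconv_int ta ib [::] y; have hc := cconv_int ta ic [::] y.
have E d : (fun x => cpartial [::] a (x - y) * d x) = (fun x => a (x - y) * d x) :> (V -> R[i]).
  by apply/funext => x; rewrite cpartial0.
rewrite E in hb; rewrite E in hc.
by rewrite -CintD//; congr Cint; apply/funext => x; rewrite mulrDr.
Qed.

(** Both sides are additive in [b]. By the local estimates they differ by $O(\delta\int|b|)$ when
    [b] lives in a ball of radius [delta]. Cutting [b] along a finite [delta]-net and letting
    [delta] tend to 0 gives equality. The pieces involve indicators, which is why [b] is merely
    integrable. *)
Theorem toeplitz_interchange r b : cint mu b -> supp_in r b ->
  Cint mu (fun x => toeplitz f a x * b x) = f (cconv a b).
Proof.
have [C1 C10 h1] := dist_local r; have [C2 C20 h2] := toeplitz_lipschitz (r + 1).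
pose G b := Cint mu (fun x => toeplitz f a x * b x) - f (cconv a b).
pose u := toeplitz f a.
have GD b1 b2 : cint mu b1 -> supp_in r b1 -> cint mu b2 -> supp_in r b2 ->
    G (fun x => b1 x + b2 x) = G b1 + G b2.
  move=> i1 s1 i2 s2; rewrite /G cconvD// (distD df); [|exact: cconv_test s1|exact: cconv_test s2].
  rewrite opprD addrACA -CintD; [|exact: toeplitz_cint s1|exact: toeplitz_cint s2].
  by congr (Cint _ _ + _); apply/funext => x; rewrite mulrDr.
have Gloc x0 delta b1 : cube n r x0 -> 0 <= delta <= 1 -> cint mu b1 -> supp_in r b1 ->
    (forall x, delta < `|x - x0| -> b1 x = 0) ->
    cabs (G b1) <= (C2 + C1) * delta * \int[mu]_x cabs (b1 x).
  move=> x0r dd ib1 s1 bd; have /andP[d0 d1] := dd.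
  have iu := toeplitz_cint ib1 s1.
  have -> : G b1 = Cint mu (fun x => (u x - u x0) * b1 x) -
      (f (cconv a b1) - Cint mu b1 * u x0).
    have iz : cint mu (fun x => u x0 * b1 x) by exact: cintZ.
    rewrite (_ : (fun x => (u x - u x0) * b1 x) = fun x => u x * b1 x - u x0 * b1 x).
      by rewrite CintB// CintZ// /G /u; ring.
    by apply/funext => x; rewrite mulrBl.
  rewrite (le_trans (cabsB _ _))// mulrDl mulrDl lerD//; last exact: h1.
  rewrite -RintegralZl//; last exact: cint_cabs.
  apply: cabs_Cint_le_ub.
  - apply: cmeasM; last exact: cint_meas ib1.
    by apply: cmeasB; [exact: toeplitz_meas|exact: cmeas_cst].
  - by apply: rintZ; exact: cint_cabs.
  move=> x; rewrite cabsM.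
  have [xd|xd] := lerP `|x - x0| delta; last by rewrite bd// cabs0 !mulr0.
  have rr1 : r <= r + 1 by rewrite lerDl.
  have [xr|xr] := pselect (cube n r x); last by rewrite s1// cabs0 !mulr0.
  rewrite ler_wpM2r ?cabs_ge0//.
  by rewrite (le_trans (h2 _ _ (cube_sub rr1 xr) (cube_sub rr1 x0r)))// ler_wpM2l.
(* Induction along the net: [b1] is split by the indicator of the [delta]-ball around the head of
   the list and that of its complement. The integral of $|b_1|$ splits in the same way, so the local
   bounds add up without loss. *)
have Glist delta (l : seq V) : 0 <= delta <= 1 -> (forall x, x \in l -> cube n r x) ->
    forall b1, cint mu b1 -> supp_in r b1 ->
    (forall x, b1 x != 0 -> exists2 x0, x0 \in l & `|x - x0| <= delta) ->
    cabs (G b1) <= (C2 + C1) * delta * \int[mu]_x cabs (b1 x).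
  move=> dd; elim: l => [_ b1 ib1 s1 hb|x0 l IH lr b1 ib1 s1 hb].
    have b0 : b1 = fun=> 0.
      apply/funext => x; apply/eqP; apply: contrapT => /negP/hb[] //.
    rewrite /G b0; have -> : cconv a (fun=> 0) = fun=> 0.
      apply/funext => y; rewrite /cconv; under eq_fun do rewrite mulr0.
      by rewrite (Cint_real mu (fun=> 0)) Rintegral_cst// mul0r.
    under eq_fun do rewrite mulr0.
    rewrite dist0// (Cint_real mu (fun=> 0)) Rintegral_cst// mul0r subr0 cabs0.
    rewrite mulr_ge0 ?Rintegral_ge0//; have /andP[d0 _] := dd.
    by rewrite mulr_ge0 ?addr_ge0.
  pose D : set V := [set x | `|x - x0| <= delta].
  have mD : measurable D.
    rewrite /D (_ : [set x | _] = (fun x : V => x - x0) @^-1` cube n delta).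
      rewrite -[X in measurable X]setTI.
      apply: (measurable_fun_pair1 x0 (@measurable_subrow R n)) => //.
      exact: measurable_cube.
    have /andP[d0 _] := dd.
    by apply/seteqP; split => x /=; [move=> h; exact/cube_norm|move=> /cube_norm; exact].
  pose c1 x : R[i] := (\1_D x)%:C%C.
  pose c2 x : R[i] := (\1_(~` D) x)%:C%C.
  have c12 x : c1 x + c2 x = 1.
    rewrite /c1 /c2 -rmorphD/= !indicE in_setC.
    by case: (x \in D); rewrite ?addr0 ?add0r.
  have mc1 : cmeas c1 by apply: cmeas_real; exact: measurable_indic.
  have mc2 : cmeas c2 by apply: cmeas_real; apply: measurable_indic; exact: measurableC.
  have c1B x : cabs (c1 x) <= 1.
    by rewrite cabs_real indicE; case: (_ \in _); rewrite ?normr1 ?normr0.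
  have c2B x : cabs (c2 x) <= 1.
    by rewrite cabs_real indicE; case: (_ \in _); rewrite ?normr1 ?normr0.
  have i1 : cint mu (fun x => b1 x * c1 x) by exact: (cintM ib1 mc1 c1B).
  have i2 : cint mu (fun x => b1 x * c2 x) by exact: (cintM ib1 mc2 c2B).
  have s1' : supp_in r (fun x => b1 x * c1 x) by move=> x /s1 ->; rewrite mul0r.
  have s2' : supp_in r (fun x => b1 x * c2 x) by move=> x /s1 ->; rewrite mul0r.
  have bE : b1 = fun x => b1 x * c1 x + b1 x * c2 x.
    by apply/funext => x; rewrite -mulrDr c12 mulr1.
  have nE x : cabs (b1 x) = cabs (b1 x * c1 x) + cabs (b1 x * c2 x).
    rewrite !cabsM -mulrDr /c1 /c2 !cabs_real !indicE in_setC.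
    by case: (x \in D); rewrite ?normr1 ?normr0 ?addr0 ?add0r mulr1.
  rewrite {1}bE GD// (le_trans (cabsD _ _))//.
  under eq_Rintegral do rewrite nE.
  rewrite RintegralD//; [|exact: cint_cabs|exact: cint_cabs].
  rewrite mulrDr lerD//.
    apply: (Gloc x0) => //; first by apply: lr; rewrite inE eqxx.
    move=> x xd; rewrite /c1 indicE (_ : x \in D = false) ?mulr0//.
    by apply/negbTE; rewrite notin_setE /D /= => h; rewrite leNgt xd in h.
  apply: IH => //; first by move=> x xl; apply: lr; rewrite inE xl orbT.
  move=> x bx; have b1x : b1 x != 0 by apply: contraNneq bx => ->; rewrite mul0r.
  have [y] := hb x b1x; rewrite inE => /orP[/eqP ->|yl yd]; last by exists y.
  move=> xd; exfalso; move: bx; rewrite /c2 indicE in_setC.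
  by rewrite (_ : x \in D) ?mulr0 ?eqxx//; rewrite inE.
move=> ib br; apply/eqP; rewrite -subr_eq0; apply/eqP; apply: cabs_eq0.
rewrite -/(G b); set I := \int[mu]_x cabs (b x) in Glist.
apply/eqP; rewrite eq_le cabs_ge0 andbT; apply/ler_addgt0Pr => e e0; rewrite add0r.
have I0 : 0 <= I by apply: Rintegral_ge0 => x _; exact: cabs_ge0.
(* The bound from [Glist] at $\delta\le e/K$ is at most [e]; the added 1 keeps the divisor
   positive. *)
pose K := (C2 + C1) * I + 1.
have K0 : 0 < K by rewrite ltr_wpDl// mulr_ge0// addr_ge0.
have d0 : 0 < Num.min 1 (e / K) by rewrite lt_min ltr01 divr_gt0.
have [l [lr hl]] := cube_net r d0.
rewrite (le_trans (Glist (Num.min 1 (e / K)) l _ lr b ib br _))//.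
- by rewrite (ltW d0) ge_min lexx.
- by move=> x bx; apply: hl; apply: contrapT => /br h; rewrite h eqxx in bx.
have : Num.min 1 (e / K) <= e / K by rewrite ge_min lexx orbT.
rewrite ler_pdivlMr//; apply: le_trans.
rewrite mulrAC mulrC ler_wpM2l ?(ltW d0)// /K lerDl.
by rewrite ler01.
Qed.

End local_estimates.

Lemma sqrte_ratio {R : realType} (a : \bar R) (r M : R) : (0 <= a)%E -> 0 <= r -> 0 <= M ->
  (sqrte a / sqrte r%:E <= M%:E)%E <-> (a <= (M ^+ 2)%:E * r%:E)%E.
Proof.
move=> a0 r0 M0; rewrite -EFinM; have [->|rn0] := eqVneq r 0.
  (* With a vanishing denominator the inverse is infinite, so the quotient is infinite unless [a] is
     0. *)
  rewrite mulr0 sqrte0 inve0; split => [|a0'].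
    have [->//|an0] := eqVneq a 0%E.
    have s0 : (0 < sqrte a)%E.
      rewrite lt_neqAle sqrte_ge0 andbT eq_sym; apply: contra_neq an0 => s0.
      by rewrite -(sqr_sqrte a0) s0 expe2 mul0e.
    by rewrite gt0_muley// leye_eq.
  have -> : a = 0%E by apply/eqP; rewrite eq_le a0' a0.
  by rewrite sqrte0 mul0e lee_fin.
have rp : 0 < Num.sqrt r by rewrite sqrtr_gt0 lt_neqAle eq_sym rn0.
rewrite /= inver (negbTE (lt0r_neq0 rp)) lee_pdivrMr// -EFinM.
have -> : (M * Num.sqrt r)%:E = sqrte (M ^+ 2 * r)%:E.
  by rewrite /= sqrtrM ?sqr_ge0// sqrtr_sqr ger0_norm.
by rewrite lee_sqrt// lee_fin mulr_ge0 ?sqr_ge0.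
Qed.

(** * Squared norms and the operator bound in squared form *)

Section square_norm.
Context {R : realType} (n : nat).
Local Notation V := 'rV[R]_n.
Local Notation mu := (@lebesgue_row R n).
Local Notation ctest := (test_function (setT : set V)).

Implicit Types (D : set V) (phi : V -> R[i]).

Definition sqnorm (D : set V) (phi : V -> R[i]) : \bar R :=
  (\int[mu]_(x in D) (cabs (phi x) ^+ 2)%:E)%E.

Lemma sqnorm_ge0 D phi : (0 <= sqnorm D phi)%E.
Proof. by apply: integral_ge0 => x _; rewrite lee_fin sqr_ge0. Qed.

Lemma cmeas_sqr phi : cmeas phi -> measurable_fun (setT : set V) (fun x : V => (cabs (phi x) ^+ 2)%:E).
Proof. by move=> h; apply/measurable_EFinP/measurable_funX; exact: cmeas_cabs. Qed.

Lemma sqnorm_sub D phi : measurable D -> cmeas phi -> (sqnorm D phi <= sqnorm setT phi)%E.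
Proof.
move=> mD mphi; apply: ge0_subset_integral => //; first exact: cmeas_sqr.
by move=> x _; rewrite lee_fin sqr_ge0.
Qed.

Lemma L2_normE D phi : measurable D -> L2_norm D phi = sqrte (sqnorm D phi).
Proof.
move=> mD; rewrite /L2_norm unlock poweR12_sqrt; last first.
  by apply: integral_ge0 => x _; exact: poweR_ge0.
congr sqrte; rewrite /sqnorm [RHS]integral_mkcond; apply: eq_integral => x _.
rewrite !patchE; case: ifP => _ /=.
  by rewrite powR_mulrn// ger0_norm// cabs_ge0.
by rewrite normr0 powR0.
Qed.

Lemma sqnorm_test phi : ctest phi -> sqnorm setT phi \is a fin_num.
Proof.
move=> tp; have [B B0 hB] := ctest_bounded0 tp; have [k k0 pk] := test_supp tp.
have i : rint mu (fun x => cabs (phi x) ^+ 2).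
  apply: (@rint_bounded_supp R n _ (B ^+ 2) k).
  - by apply: measurable_funX; apply: cmeas_cabs; exact: cint_meas (ctest_cint tp).
  - move=> x; rewrite normrX ger0_norm ?cabs_ge0// lerXn2r// ?nnegrE//; exact: cabs_ge0.
  - by move=> x /pk ->; rewrite cabs0 expr0n.
exact: (integrable_fin_num measurableT i).
Qed.

Lemma test_functionT (D : set V) phi : test_function D phi -> ctest phi.
Proof. by case=> s c _; split. Qed.

(** Squaring removes the quotient and the roots. The zero function, left out of the supremum,
    satisfies the squared inequality trivially. *)
Lemma toeplitz_normP (D : set V) f (M : R) : is_distribution f -> measurable D -> 0 <= M ->
  (toeplitz_norm D f <= M%:E)%E <->
  forall phi, test_function D phi ->
    (sqnorm D (toeplitz f phi) <= (M ^+ 2)%:E * sqnorm D phi)%E.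
Proof.
move=> df mD M0.
have E phi : test_function D phi ->
    (L2_norm D (toeplitz f phi) / L2_norm D phi <= M%:E)%E <->
    (sqnorm D (toeplitz f phi) <= (M ^+ 2)%:E * sqnorm D phi)%E.
  move=> /test_functionT tp; rewrite !L2_normE//.
  have fn : sqnorm D phi \is a fin_num.
    rewrite ge0_fin_numE ?sqnorm_ge0//; apply: le_lt_trans (sqnorm_sub mD _) _.
      exact: cint_meas (ctest_cint tp).
    by rewrite -ge0_fin_numE ?sqnorm_ge0// sqnorm_test.
  rewrite -(fineK fn); apply: sqrte_ratio => //; first exact: sqnorm_ge0.
  by rewrite fine_ge0// sqnorm_ge0.
split=> [h phi tp|h].
  have [p0|p0] := pselect (phi = cst 0); last first.
    by apply/E => //; apply: le_trans h; apply: ereal_sup_ubound; exists phi.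
  have -> : sqnorm D (toeplitz f phi) = 0%E.
    rewrite /sqnorm; apply: integral0_eq => x _; rewrite p0 /toeplitz /cst dist0//.
    by rewrite cabs0 expr0n.
  by rewrite mule_ge0 ?sqnorm_ge0// lee_fin sqr_ge0.
by apply: ge_ereal_sup => _ [phi [tp _] <-]; apply/E => //; exact: h.
Qed.

End square_norm.

(** * From the domain to the whole space by translation *)

Section translation.
Context {R : realType} (n : nat).
Local Notation V := 'rV[R]_n.
Local Notation mu := (@lebesgue_row R n).
Local Notation ctest := (test_function (setT : set V)).

Lemma toeplitz_translate (f : (V -> R[i]) -> R[i]) (t : V) phi x :
  toeplitz f (fun y => phi (y - t)) x = toeplitz f phi (x - t).
Proof. by rewrite /toeplitz; congr f; apply/funext => y; rewrite addrAC. Qed.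

Lemma sqnorm_translate (t : V) (phi : V -> R[i]) : cmeas phi ->
  sqnorm setT (fun x => phi (x - t)) = sqnorm setT phi.
Proof.
move=> mphi; apply: (ge0_integral_shift (- t) (cmeas_sqr mphi)) => x.
by rewrite lee_fin sqr_ge0.
Qed.

Variables (f : (V -> R[i]) -> R[i]) (Xi : set V) (M : R).
Hypotheses (df : is_distribution f) (mXi : measurable Xi).
Hypothesis Xi_lower : [set x : V | forall i, 1 < x ord0 i] `<=` Xi.
Hypothesis M0 : 0 < M.
Hypothesis hM : forall phi, test_function Xi phi ->
  (sqnorm Xi (toeplitz f phi) <= (M ^+ 2)%:E * sqnorm Xi phi)%E.

(** [toeplitz f] commutes with translations. For each cube, [phi] and the cube are translated
    together until both lie where all coordinates exceed 1, and there the bound on [Xi] applies. The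
    cubes then exhaust the space by monotone convergence. *)
Lemma sqnorm_toeplitz phi : ctest phi ->
  (sqnorm setT (toeplitz f phi) <= (M ^+ 2)%:E * sqnorm setT phi)%E.
Proof.
move=> tp; have [k k0 pk] := test_supp tp.
have mt := toeplitz_meas df tp; have mp := cint_meas (ctest_cint tp).
have H (r : nat) : (sqnorm (cube n r%:R) (toeplitz f phi) <= (M ^+ 2)%:E * sqnorm setT phi)%E.
  (* After this shift the support of [phi] has coordinates at least [r + 2], and the cube of radius
     [r] has coordinates at least [k + 2]. *)
  pose t : V := const_mx (k + r%:R + 2).
  pose psi x := phi (x - t).
  have tpsi : ctest psi by exact: ctest_shift.
  have psiXi : test_function Xi psi.
    have [s c _] := tpsi; split => //.
    have : csupport psi `<=` (fun x : V => x - t) @^-1` cube n k.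
      have cl : closed ((fun x : V => x - t) @^-1` cube n k).
        apply: closed_comp; last exact: closed_cube.
        move=> x _; apply/(@cvgrPdist_le _ _ _ _ (nbhs_filter x)) => e e0.
        apply/nbhs_ballP; exists e => //= y; rewrite mx_norm_ball /ball_ /= => /ltW.
        by rewrite opprB addrA subrK.
      rewrite ((closure_id _).1 cl); apply: closure_subset => x /= px.
      by apply: contrapT => /pk h; rewrite /psi h eqxx in px.
    move=> h x /h /= xk; apply: Xi_lower => i /=; have := xk i.
    rewrite !mxE ler_norml => /andP[h1 _].
    by move: h1; have : 0 <= r%:R :> R by []; lra.
  rewrite -(sqnorm_translate t mp) -/psi.
  have le1 : ((M ^+ 2)%:E * sqnorm Xi psi <= (M ^+ 2)%:E * sqnorm setT psi)%E.
    have mpsi : cmeas psi by exact: cint_meas (ctest_cint tpsi).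
    by rewrite lee_wpmul2l ?lee_fin ?sqr_ge0//; exact: (sqnorm_sub mXi mpsi).
  apply: le_trans le1.
  apply: le_trans (hM psiXi).
  pose g x := ((cabs (toeplitz f phi x) ^+ 2)%:E * (\1_(cube n r%:R) x)%:E)%E.
  have mg : measurable_fun setT g.
    apply: emeasurable_funM; first exact: cmeas_sqr.
    by apply/measurable_EFinP; apply: measurable_indic; exact: measurable_cube.
  have g0 x : (0 <= g x)%E by rewrite mule_ge0// lee_fin ?sqr_ge0.
  have -> : sqnorm (cube n r%:R) (toeplitz f phi) = (\int[mu]_x g x)%E.
    rewrite /sqnorm integral_mkcond; apply: eq_integral => x _.
    by rewrite patchE /g indicE; case: ifP => _; rewrite ?mule1 ?mule0.
  rewrite -(ge0_integral_shift (- t) mg g0) /sqnorm [leRHS]integral_mkcond.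
  apply: ge0_le_integral => //.
  - exact: (measurableT_comp mg (measurable_fun_pair1 t (@measurable_subrow R n))).
  - apply/(measurable_restrictT _ mXi); apply: measurable_funTS; apply: cmeas_sqr.
    exact: toeplitz_meas.
  move=> x _; rewrite patchE /g indicE toeplitz_translate.
  case: (boolP (x - t \in cube n r%:R)); last first.
    by rewrite mule0; case: ifP => // _ _; rewrite lee_fin sqr_ge0.
  rewrite inE => xr; rewrite mule1 ifT// inE; apply: Xi_lower => i /=.
  have := xr i; rewrite !mxE ler_norml => /andP[h1 _].
  by lra.
have cv : sqnorm (cube n r%:R) (toeplitz f phi) @[r --> \oo] --> sqnorm setT (toeplitz f phi).
  rewrite /sqnorm -(@cube_cover R n); apply: ge0_nondecreasing_set_cvg_integral.
  - by move=> a b ab; apply/subsetPset; apply: cube_sub; rewrite ler_nat.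
  - by move=> i; exact: measurable_cube.
  - by move=> i; apply: measurable_funTS; exact: cmeas_sqr.
  - by move=> i x _; rewrite lee_fin sqr_ge0.
by rewrite -(cvg_lim _ cv)//; apply: lime_le; [apply: cvgP cv|exact: nearW].
Qed.
End translation.

(** * Convolution of test functions *)

Section convolution.
Context {R : realType} (n : nat).
Local Notation V := 'rV[R]_n.
Local Notation mu := (@lebesgue_row R n).
Local Notation ctest := (test_function (setT : set V)).
Local Notation tp := (2 * pi : R).

Lemma csmooth_cis (a : R) (z : V) : smooth (fun x : V => cis (a * dotr x z)).
Proof.
split.
  have := smooth_cos_dotr z a 0; congr real_smooth; apply/funext => x /=.
  by rewrite addr0 dotrC.
have := smooth_cos_dotr z a (- (pi / 2)); congr real_smooth; apply/funext => x /=.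
by rewrite dotrC cosD cosN sinN cos_pihalf sin_pihalf mulr0 mulrN1 opprK add0r.
Qed.

Definition conv (a b : V -> R[i]) (t : V) : R[i] := Cint mu (fun x => a (t - x) * b x).

Lemma conv_cconv a b : conv a b = cconv (fun x => a (0 - x)) b.
Proof.
apply/funext => t; congr Cint; apply/funext => x.
by rewrite sub0r opprB.
Qed.

Lemma conv_test a b r : ctest a -> cint mu b -> supp_in r b -> ctest (conv a b).
Proof. by move=> ta ib br; rewrite conv_cconv; apply: cconv_test br => //; exact: ctest_reflect. Qed.

Lemma conv_int a b t : ctest a -> cint mu b -> cint mu (fun x => a (t - x) * b x).
Proof.
move=> ta ib; have := cconv_int (ctest_reflect 0 ta) ib [::] t.
by congr cint; apply/funext => x; rewrite cpartial0 sub0r opprB.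
Qed.

(** Young's inequality for a kernel of mass at most 1. With $g=p*\varphi$, the Schur test gives
    $\|g\|^2\le\frac12(\|g\|^2+\|\varphi\|^2)$, and the finite $\|g\|^2$ is absorbed. *)
Lemma sqnorm_conv (p : V -> R) phi : ctest (fun x => (p x)%:C%C) -> ctest phi ->
  (forall x, 0 <= p x) -> (\int[mu]_x (p x)%:E <= 1)%E ->
  (sqnorm setT (conv (fun x => (p x)%:C%C) phi) <= sqnorm setT phi)%E.
Proof.
move=> tpp tphi p0 p1; set g := conv _ _.
have [r r0 sr] := test_supp tphi.
have tg : ctest g by exact: (conv_test tpp (ctest_cint tphi) sr).
have mg := cmeas_cabs (cint_meas (ctest_cint tg)).
have mf := cmeas_cabs (cint_meas (ctest_cint tphi)).
have mp : measurable_fun setT p by have [] := cint_meas (ctest_cint tpp).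
have H := @amgm_convolution R n _ _ _ mg mf mp (fun=> cabs_ge0 _) (fun=> cabs_ge0 _) p0 p1.
have : (sqnorm setT g <= (2^-1)%:E * (sqnorm setT g + sqnorm setT phi))%E.
  apply: le_trans H; apply: ge0_le_integral => //.
  - by move=> x _; rewrite lee_fin sqr_ge0.
  - by apply/measurable_EFinP; exact: measurable_funX.
  - apply: (@sf_measurable_tonelli _ _ _ _ _ mu (@sigma_finite_lebesgue_row R n)
      (fun z : V * V => (cabs (g z.1) * cabs (phi z.2) * p (z.1 - z.2))%:E)).
      apply/measurable_EFinP; apply: measurable_funM.
        apply: measurable_funM; first exact: (measurableT_comp mg measurable_fst).
        exact: (measurableT_comp mf measurable_snd).
      exact: (measurableT_comp mp (@measurable_subrow R n)).
    by move=> z; rewrite lee_fin !mulr_ge0 ?cabs_ge0.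
  move=> x _; have ib := conv_int x tpp (ctest_cint tphi).
  have -> : (\int[mu]_y (cabs (g x) * cabs (phi y) * p (x - y))%:E =
     (cabs (g x))%:E * \int[mu]_y (cabs ((p (x - y))%:C%C * phi y))%:E)%E.
    rewrite -ge0_integralZl//.
    - apply: eq_integral => y _; rewrite -EFinM; congr EFin.
      by rewrite cabsM cabs_real (ger0_norm (p0 _)) -mulrA [p _ * _]mulrC.
    - by apply/measurable_EFinP; apply: cmeas_cabs; exact: (cint_meas ib).
    - by move=> y _; rewrite lee_fin cabs_ge0.
    - by rewrite lee_fin cabs_ge0.
  rewrite expr2 EFinM lee_wpmul2l ?lee_fin ?cabs_ge0//.
  exact: (cabs_Cint_le_ereal ib).
have := sqnorm_test tg; have := sqnorm_test tphi.
case: (sqnorm setT g) => [s||]//; case: (sqnorm setT phi) => [t||]// _ _.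
by rewrite -EFinD -EFinM !lee_fin; lra.
Qed.

(** Associativity $f*(a*b)=(f*a)*b$, obtained from [toeplitz_interchange] with [b] reflected about
    [x]. *)
Lemma toeplitz_conv (f : (V -> R[i]) -> R[i]) a b r x : is_distribution f ->
  ctest a -> cint mu b -> supp_in r b ->
  toeplitz f (conv a b) x = Cint mu (fun w => toeplitz f a w * b (x - w)).
Proof.
move=> df ta ib br; have x0 : cube n `|x| x by apply/cube_norm.
have sb : supp_in (r + `|x|) (fun w => b (x - w)) by exact: reflect_supp br x0.
rewrite (toeplitz_interchange df ta (cint_reflect x ib) sb) /toeplitz.
congr f; apply/funext => z; rewrite /conv /cconv.
rewrite -(Cint_reflect x (conv_int (x - z) ta ib)); congr Cint; apply/funext => w.
by congr (a _ * _); rewrite opprB addrC addrA subrK.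
Qed.

End convolution.

(** * A pointwise bound for localised Fourier transforms *)

Section fourier_bound.
Context {R : realType} (n : nat).
Local Notation V := 'rV[R]_n.
Local Notation mu := (@lebesgue_row R n).
Local Notation ctest := (test_function (setT : set V)).
Local Notation tp := (2 * pi : R).
Local Notation ofR p := (fun x : V => (p x)%:C%C : R[i]).

Variables (f : (V -> R[i]) -> R[i]) (M : R).
Hypotheses (df : is_distribution f) (M0 : 0 < M).
Hypothesis hM : forall phi, ctest phi ->
  (sqnorm setT (toeplitz f phi) <= (M ^+ 2)%:E * sqnorm setT phi)%E.
Variable p : V -> R.
Hypotheses (tpp : ctest (ofR p)) (p0 : forall x, 0 <= p x).
Hypothesis p1 : (\int[mu]_x (p x)%:E <= 1)%E.

(** The pairing form of the operator bound, with the product of norms replaced by half the sum of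
    squares. Nothing is lost in the application, where both norms are equal. *)
Lemma toeplitz_pairing phi psi : ctest phi -> ctest psi ->
  ((cabs (Cint mu (fun x => psi x * toeplitz f (conv (ofR p) phi) x)))%:E <=
   (M / 2)%:E * (sqnorm setT psi + sqnorm setT phi))%E.
Proof.
move=> tphi tpsi; set g := conv _ _.
have [r r0 sr] := test_supp tphi; have [k k0 sk] := test_supp tpsi.
have tg : ctest g by exact: (conv_test tpp (ctest_cint tphi) sr).
have ipg : cint mu (fun x => psi x * toeplitz f g x).
  have := toeplitz_cint df tg (ctest_cint tpsi) sk.
  by congr cint; apply/funext => x; rewrite mulrC.
apply: (le_trans (cabs_Cint_le_ereal ipg)).
have mp := cmeas_cabs (cint_meas (ctest_cint tpsi)).
have mt := cmeas_cabs (toeplitz_meas df tg).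
have M20 : 0 <= M / 2 by rewrite divr_ge0// ltW.
have iM0 : 0 <= (2 * M)^-1 by rewrite invr_ge0 mulr_ge0// ltW.
(* The weights are chosen so that the operator bound turns $(2M)^{-1}\|f*g\|^2$ into at most
   $(M/2)\|\varphi\|^2$. *)
apply: (@le_trans _ _ (\int[mu]_x (M / 2 * cabs (psi x) ^+ 2 +
    (2 * M)^-1 * cabs (toeplitz f g x) ^+ 2)%:E)%E).
  apply: ge0_le_integral => //.
  - by move=> x _; rewrite lee_fin cabs_ge0.
  - by apply/measurable_EFinP; apply: cmeas_cabs; exact: (cint_meas ipg).
  - apply/measurable_EFinP; apply: measurable_funD;
      by apply: measurable_funM => //; exact: measurable_funX.
  move=> x _; rewrite lee_fin cabsM.
  set s := cabs (psi x); set t := cabs (toeplitz f g x).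
  rewrite -subr_ge0 (_ : _ - _ = (2 * M)^-1 * (M * s - t) ^+ 2).
    by rewrite mulr_ge0 ?sqr_ge0.
  by field; exact: lt0r_neq0.
under eq_integral do rewrite EFinD.
rewrite ge0_integralD//; last 4 first.
- by move=> x _; rewrite lee_fin mulr_ge0 ?sqr_ge0.
- by apply/measurable_EFinP; apply: measurable_funM => //; exact: measurable_funX.
- by move=> x _; rewrite lee_fin mulr_ge0 ?sqr_ge0.
- by apply/measurable_EFinP; apply: measurable_funM => //; exact: measurable_funX.
have Z c (h : V -> R) : 0 <= c -> measurable_fun setT h ->
    (\int[mu]_x (c * h x ^+ 2)%:E = c%:E * \int[mu]_x (h x ^+ 2)%:E)%E.
  move=> c0 mh; under eq_integral do rewrite EFinM.
  apply: ge0_integralZl => //.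
  - by apply/measurable_EFinP; exact: measurable_funX.
  - by move=> x _; rewrite lee_fin sqr_ge0.
rewrite (Z _ _ M20 mp) (Z _ _ iM0 mt) [leRHS]ge0_muleDr ?sqnorm_ge0//; apply: leeD => //.
have le2 : (sqnorm setT (toeplitz f g) <= (M ^+ 2)%:E * sqnorm setT phi)%E.
  apply: (le_trans (hM tg)); rewrite lee_wpmul2l ?lee_fin ?sqr_ge0//.
  exact: sqnorm_conv.
apply: (@le_trans _ _ ((2 * M)^-1%:E * ((M ^+ 2)%:E * sqnorm setT phi))%E).
  by rewrite lee_wpmul2l ?lee_fin.
rewrite muleA -EFinM (_ : (2 * M)^-1 * M ^+ 2 = M / 2)//.
by field; exact: lt0r_neq0.
Qed.

Variable chi : V -> R.
Hypothesis tchi : ctest (ofR chi).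

(** By Fubini the transform equals the pairing of [psi] with $f*p*\varphi$, where [phi] and [psi]
    are [chi] modulated by opposite frequencies. Modulation keeps the norm, so [toeplitz_pairing]
    gives $\frac M2(\int\chi^2+\int\chi^2)$. *)
Lemma toeplitz_fourier_bound xi :
  cabs (fourier (fun w => toeplitz f (ofR p) w * cconv (ofR chi) (ofR chi) w) xi) <=
  M * \int[mu]_x (chi x ^+ 2).
Proof.
set X := ofR chi; set u := toeplitz f (ofR p).
(* In $\psi(x)\varphi(x-w)$ the phases depending on $x$ cancel, leaving the character at $-w$ times
   $\chi(x)\chi(x-w)$. *)
pose phi y := cis (tp * dotr y xi) * X y.
pose psi x := cis (- tp * dotr x xi) * X x.
have tphi : ctest phi by apply: ctestM => //; exact: csmooth_cis.
have tpsi : ctest psi by apply: ctestM => //; exact: csmooth_cis.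
have [r r0 sr] := test_supp tphi; have [k k0 sk] := test_supp tpsi.
have ix2 : rint mu (fun x => chi x ^+ 2).
  have [B B0 hB] := ctest_bounded0 tchi; have [q q0 hq] := test_supp tchi.
  have hq' x : ~ cube n q x -> chi x = 0 by move=> /hq/(congr1 Re).
  apply: (@rint_bounded_supp R n _ (B ^+ 2) q).
  - by apply: measurable_funX; have [] := cint_meas (ctest_cint tchi).
  - by move=> x; rewrite normrX lerXn2r// ?nnegrE// -cabs_real.
  - by move=> x /hq' ->; rewrite expr0n.
have nE (c : V -> R) : sqnorm setT (fun x => cis (c x) * X x) = (\int[mu]_x (chi x ^+ 2))%:E.
  rewrite /Rintegral fineK; last exact: (integrable_fin_num measurableT ix2).
  apply: eq_integral => x _.
  by rewrite cabsM cabs_cis mul1r /X cabs_real real_normK// num_real.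
have := toeplitz_pairing tphi tpsi.
rewrite !nE -EFinD -EFinM lee_fin.
have -> (I : R) : M / 2 * (I + I) = M * I by field.
move=> H.
apply: le_trans H; rewrite le_eqVlt; apply/orP; left; apply/eqP; congr cabs.
have E x : psi x * toeplitz f (conv (ofR p) phi) x = Cint mu (fun w => psi x * (u w * phi (x - w))).
  rewrite (toeplitz_conv x df tpp (ctest_cint tphi) sr) CintZ//.
  have x0 : cube n `|x| x by apply/cube_norm.
  exact: (toeplitz_cint df tpp (cint_reflect x (ctest_cint tphi)) (reflect_supp sr x0)).
transitivity (Cint mu (fun x : V => Cint mu (fun w => psi x * (u w * phi (x - w)))));
  last by congr Cint; apply/funext => x; rewrite E.
rewrite fourierE.
have mu_ := toeplitz_meas df tpp.
have [Bp Bp0 hBp] := ctest_bounded0 tphi.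
(* The product $\psi(x)\varphi(x-w)$ vanishes unless [w] lies in the cube of radius [k + r], where
   the continuous [u] is bounded. This gives the product majorant for Fubini. *)
pose Bw w := Bp * (cabs (u w) * \1_(cube n (k + r)) w).
have iBw : rint mu Bw.
  apply: rintZ; have [c1 c2] := toeplitz_cont df tpp.
  have [B B0 hB] := cont_bounded_cube (k + r) c1 c2.
  apply: (@rint_bounded_supp R n _ B (k + r)).
  - by apply: measurable_funM; [exact: cmeas_cabs|apply: measurable_indic; exact: measurable_cube].
  - move=> w; rewrite indicE; case: (boolP (_ \in _)) => [|_].
      by rewrite inE mulr1 ger0_norm ?cabs_ge0// => wk; exact: hB.
    by rewrite mulr0 normr0.
  - move=> w wk; rewrite indicE (_ : _ \in _ = false) ?mulr0//.
    by apply/negbTE; rewrite notin_setE.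
have sf := @sigma_finite_lebesgue_row R n.
have mF : cmeas (fun z : V * V => psi z.1 * (u z.2 * phi (z.1 - z.2))).
  apply: cmeasM; first exact: (cmeas_fst (cint_meas (ctest_cint tpsi))).
  apply: cmeasM; first exact: (cmeas_snd mu_).
  exact: (cmeas_comp2 (@measurable_subrow R n) (cint_meas (ctest_cint tphi))).
have Bw0 w : 0 <= Bw w.
  by rewrite mulr_ge0// mulr_ge0 ?cabs_ge0// indicE.
have bF x w : cabs (psi x * (u w * phi (x - w))) <= cabs (psi x) * Bw w.
  have [wk|wk] := boolP (w \in cube n (k + r)).
    rewrite cabsM ler_wpM2l ?cabs_ge0// cabsM /Bw mulrC.
    by rewrite indicE wk mulr1 ler_wpM2r ?cabs_ge0.
  rewrite /Bw indicE (negbTE wk) !mulr0.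
  have [xk|/sk -> ] := pselect (cube n k x); last by rewrite mul0r cabs0.
  have [xr|/sr -> ] := pselect (cube n r (x - w));  last by rewrite !mulr0 cabs0.
  exfalso; move: wk; rewrite notin_setE; apply => i; have := xk i; have := xr i.
  rewrite !mxE => h1 h2; rewrite -(subKr (x ord0 i) (w ord0 i)).
  by rewrite (le_trans (ler_normB _ _))// lerD.
rewrite (@Cfubini_prod _ _ _ _ _ mu mu sf sf
  (fun z : V * V => psi z.1 * (u z.2 * phi (z.1 - z.2))) (fun x => cabs (psi x)) Bw mF
  (cint_cabs (ctest_cint tpsi)) iBw (fun=> cabs_ge0 _) Bw0 bF) /=.
congr Cint; apply/funext => w; rewrite mulrAC /cconv -CintZ; last first.
  have := cconv_int tchi (ctest_cint tchi) [::] w.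
  by congr cint; apply/funext => x; rewrite cpartial0.
congr Cint; apply/funext => x; rewrite /psi /phi dotrBl.
have -> : tp * (dotr x xi - dotr w xi) = tp * dotr x xi + - (tp * dotr w xi) by ring.
rewrite cisD mulNr cisN -/(cis _).
have e1 : cis (tp * dotr x xi) * cis (- (tp * dotr x xi)) = 1 by rewrite -cisD subrr cis0.
rewrite -cisN -[LHS]mul1r -e1; ring.
Qed.

End fourier_bound.

(** * Weak-star compactness of bounded sequences of functions *)

Lemma ultra_bounded_cvg {R : realType} (U : set_system nat) (a : nat -> R) (B : R) :
  UltraFilter U -> (forall k, `|a k| <= B) -> exists l : R, a k @[k --> U] --> l.
Proof.
move=> UU aB; have [|l [_ cl]] := @segment_compact R (- B) B (a k @[k --> U]) _.
  have h : U [set k | `[- B, B]%classic (a k)].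
    by apply: filterE => k /=; rewrite in_itv/= -ler_norml.
  exact: h.
exists l => N Nl; have [//|h] := in_ultra_setVsetC (a @^-1` N) UU.
by have [y [h1 h2]] := cl (~` N) N h Nl; exfalso; exact: h1.
Qed.

Section weak_star_real.
Context d (T : measurableType d) (R : realType) (m : {sigma_finite_measure set T -> \bar R}).
Variables (q : T -> R) (h_ : nat -> T -> R) (M : R) (U : set_system nat).
Hypotheses (iq : rint m q) (q0 : forall x, 0 < q x) (M0 : 0 <= M).
Hypotheses (mh : forall k, measurable_fun setT (h_ k)) (hM : forall k x, `|h_ k x| <= M).
Hypothesis mqV : measurable_fun setT (fun x => (q x)^-1).
Hypothesis UU : UltraFilter U.

Let pU : ProperFilter U. Proof. exact: ultra_proper. Qed.

(** Along an ultrafilter every bounded real sequence converges, so this functional exists for all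
    integrable [w] at once and is linear, without extraction of subsequences. *)
Definition limint (w : T -> R) : R := lim ((\int[m]_x (h_ k x * w x)) @[k --> U]).

Let int_h k w : rint m w -> rint m (fun x => h_ k x * w x).
Proof.
move=> iw; apply: (@rint_le _ _ _ _ _ (fun x => M * `|w x|)).
- by apply: measurable_funM => //; exact: rint_meas iw.
- by apply: rintZ; exact: integrable_norm iw.
- by move=> x; rewrite normrM ler_wpM2r.
Qed.

Let int_h_le k w : rint m w -> `|\int[m]_x (h_ k x * w x)| <= M * \int[m]_x `|w x|.
Proof.
move=> iw; rewrite -RintegralZl//; last exact: integrable_norm iw.
apply: (le_trans (le_normr_Rintegral _ (int_h k iw))) => //.
apply: le_Rintegral => //.
- exact: integrable_norm (int_h k iw).
- by apply: rintZ; exact: integrable_norm iw.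
- by move=> x _; rewrite normrM ler_wpM2r.
Qed.

Lemma limint_cvg w : rint m w -> (\int[m]_x (h_ k x * w x)) @[k --> U] --> limint w.
Proof.
move=> iw; have [l hl] := ultra_bounded_cvg UU (fun k => int_h_le k iw).
exact: (cvgP _ hl).
Qed.

Lemma limintE w l : (\int[m]_x (h_ k x * w x)) @[k --> U] --> l -> limint w = l.
Proof. by move=> h; exact: cvg_lim. Qed.

Lemma limintD w v : rint m w -> rint m v -> limint (fun x => w x + v x) = limint w + limint v.
Proof.
move=> iw iv; apply: limintE.
rewrite (_ : (fun k => _) = fun k => \int[m]_x (h_ k x * w x) + \int[m]_x (h_ k x * v x)).
  by apply: cvgD; exact: limint_cvg.
apply/funext => k; rewrite -RintegralD//; [|exact: int_h|exact: int_h].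
by apply: eq_Rintegral => x _; rewrite mulrDr.
Qed.

Lemma limintZ c w : rint m w -> limint (fun x => c * w x) = c * limint w.
Proof.
move=> iw; apply: limintE.
rewrite (_ : (fun k => _) = fun k => c * \int[m]_x (h_ k x * w x)).
  by apply: cvgM; [exact: cvg_cst|exact: limint_cvg].
apply/funext => k; rewrite -RintegralZl//; last exact: int_h.
by apply: eq_Rintegral => x _; rewrite mulrCA.
Qed.

Lemma limint_le w : rint m w -> `|limint w| <= M * \int[m]_x `|w x|.
Proof.
move=> iw; have c : `|\int[m]_x (h_ k x * w x)| @[k --> U] --> `|limint w|.
  by apply: cvg_norm; exact: limint_cvg.
rewrite -(cvg_lim _ c)//; apply: limr_le; first exact: cvgP c.
by apply: filterE => k; exact: int_h_le.
Qed.

Let int_q E : measurable E -> rint m (fun x => q x * \1_E x).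
Proof.
move=> mE; apply: (@rint_le _ _ _ _ _ q) => //.
  by apply: measurable_funM; [exact: rint_meas iq|exact: measurable_indic].
move=> x; rewrite indicE; have /ltW qx := q0 x.
by case: (_ \in _); rewrite ?mulr1 ?mulr0 ?normr0 ?ger0_norm.
Qed.

(** The integrable positive factor [q] makes this a finite signed measure although [m] is only
    sigma-finite; its Radon-Nikodym density yields the limit function. *)
Let nu (E : set T) : \bar R := (limint (fun x => q x * \1_E x))%:E.

Let nu0 : nu set0 = 0%E.
Proof.
rewrite /nu (_ : (fun x => _) = fun x => 0 * q x).
  by rewrite limintZ// mul0r.
by apply/funext => x; rewrite indic0 mulr0 mul0r.
Qed.

Let nuU A B : measurable A -> measurable B -> A `&` B = set0 -> nu (A `|` B) = (nu A + nu B)%E.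
Proof.
move=> mA mB AB; rewrite /nu -EFinD -limintD; [|exact: int_q|exact: int_q].
congr (limint _)%:E; apply/funext => x; rewrite -mulrDr; congr (_ * _).
rewrite !indicE in_setU; case: (boolP (x \in A)) => xA; case: (boolP (x \in B)) => xB /=;
  rewrite ?addr0 ?add0r//.
by exfalso; rewrite !inE in xA xB; have : (A `&` B) x by []; rewrite AB.
Qed.

(** Finite additivity together with the bound of [limint] by the $L^1$ norm: $q$ times the indicator
    of a finite union tends in $L^1$ to $q$ times that of the full union. *)
Let nu_sigma : semi_sigma_additive nu.
Proof.
move=> F mF tF mUF; pose G n := \bigcup_(i < n) F i.
have mG n : measurable (G n) by exact: bigcup_measurable.
have E n : (\sum_(0 <= i < n) nu (F i) = nu (G n))%E.
  elim: n => [|n IH]; first by rewrite big_nil /G bigcup0// nu0.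
  rewrite big_nat_recr// IH -[LHS]/(nu (G n) + nu (F n))%E -nuU//.
    by congr nu; rewrite /G !bigcup_mkord big_ord_recr.
  apply/seteqP; split => // x [[i /= iN Fi] Fn].
  have := tF i n I I; rewrite (_ : i = n) ?ltnn// in iN *; last first.
    by apply: tF => //; exists x.
under eq_fun do rewrite E.
apply: cvg_EFin; first exact: nearW.
pose D n x := q x * \1_(G n) x - q x * \1_(\bigcup_i F i) x.
have iD n : rint m (D n) by apply: rintD; [exact: int_q|apply: rintN; exact: int_q].
have D0 : \int[m]_x `|D n x| @[n --> \oo] --> \int[m]_x (0 : R).
  apply: (@rdominated _ _ _ m (fun n x => `|D n x|) (fun=> 0) (fun x => 2 * q x)).
  - by move=> n; apply: measurableT_comp => //; exact: rint_meas (iD n).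
  - exact: measurable_cst.
  - move=> x; apply: cvg_near_cst.
    have [[i _ Fi]|nF] := pselect ((\bigcup_i F i) x); last first.
      apply: nearW => n; rewrite /D !indicE !(memNset _) ?subrr ?normr0//.
      by move=> [i _ Fi]; apply: nF; exists i.
    exists i.+1 => // n /= ni; rewrite /D !indicE !mem_set ?subrr ?normr0//.
      by exists i.
    by exists i.
  - exact: rintZ.
  move=> n x; rewrite normr_id /D -mulrBr normrM (ger0_norm (ltW (q0 x))) mulrC.
  have qx := ltW (q0 x); apply: ler_wpM2r => //; rewrite !indicE.
  by do 2 case: (_ \in _); rewrite ?subrr ?subr0 ?sub0r ?normrN ?normr1 ?normr0 ?ler1n// ler0n.
rewrite Rintegral_cst// mul0r in D0.
apply/cvgrPdist_le => e e0.
have C : (M * \int[m]_x `|D n x|) @[n --> \oo] --> M * 0 by apply: cvgM; [exact: cvg_cst|exact: D0].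
rewrite mulr0 in C; move/cvgrPdist_le: C => /(_ e e0).
apply: filterS => n; rewrite sub0r normrN => h; rewrite distrC; apply: le_trans h.
rewrite /= -[X in `|_ - X|]mul1r -mulNr -limintZ; last exact: int_q.
rewrite -limintD; [|exact: int_q|by apply: rintZ; exact: int_q].
have -> : (fun x => q x * \1_(G n) x + -1 * (q x * \1_(\bigcup_i F i) x)) = D n.
  by apply/funext => x; rewrite mulN1r.
by rewrite (le_trans (limint_le (iD n)))// ler_norm.
Qed.

Let nu_dom : nu `<< m.
Proof.
apply/null_content_dominatesP => A mA A0.
have := limint_le (int_q mA); rewrite (_ : \int[m]_x _ = 0).
  by rewrite mulr0 normr_le0 /nu => /eqP ->.
rewrite /Rintegral (_ : (\int[m]_x _ = \int[m]_(x in A) (q x)%:E)%E); last first.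
  rewrite [RHS]integral_mkcond; apply: eq_integral => x _; rewrite patchE indicE.
  by case: ifP => _; rewrite ?mulr1 ?mulr0 ?normr0// ger0_norm// ltW.
rewrite null_set_integral//.
  by apply: measurable_funTS; apply/measurable_EFinP; exact: rint_meas iq.
Qed.

Lemma limint_density : exists kap : T -> R, rint m kap /\
  forall E, measurable E -> limint (fun x => q x * \1_E x) = \int[m]_x (kap x * \1_E x).
Proof.
pose nuC : {charge set T -> \bar R} := HB.pack nu
  (isCharge.Build _ _ _ nu nu0 (fun E _ => isT) nu_sigma).
have dom : nuC `<< m by exact: nu_dom.
have ik := Radon_Nikodym_integrable dom.
have kE x : Radon_Nikodym nuC m x = (fine (Radon_Nikodym nuC m x))%:E.
  by rewrite fineK// Radon_Nikodym_fin_num.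
exists (fun x => fine (Radon_Nikodym nuC m x)); split.
  by move: ik; congr (integrable _ _ _); apply/funext => x; exact: kE.
move=> E mE; have := Radon_Nikodym_integral dom mE => H.
rewrite -[LHS]/(fine (nu E)) -[nu E]/(nuC E) H /Rintegral; congr fine.
rewrite [LHS]integral_mkcond; apply: eq_integral => x _; rewrite patchE indicE.
by case: ifP => _; rewrite ?mulr1 ?mulr0.
Qed.

(** The density [kap] satisfies $|\kappa|\le Mq$ almost everywhere, since $\pm\int_E\kappa\le
    M\int_E q$ for every measurable $E$, in particular for the sets where this bound fails. *)
Lemma limint_bounded_density : exists g : T -> R, [/\ measurable_fun setT g,
  forall x, `|g x| <= M &
  forall E, measurable E -> limint (fun x => q x * \1_E x) = \int[m]_x (g x * (q x * \1_E x))].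
Proof.
have [kap [ik kE]] := limint_density.
have mk := rint_meas ik; have mq := rint_meas iq.
have mMq : measurable_fun setT (fun x => M * q x) by apply: measurable_funM.
pose Ep := [set x | M * q x < kap x]; pose Em := [set x | M * q x < - kap x].
have mEp : measurable Ep.
  have := measurable_fun_ltr mMq mk measurableT (Y := [set true]).
  by rewrite setTI; apply.
have mEm : measurable Em.
  have mNk : measurable_fun setT (fun x => - kap x) by exact: measurableT_comp.
  have := measurable_fun_ltr mMq mNk measurableT (Y := [set true]).
  by rewrite setTI; apply.
(* The density relative to [q], truncated so that the bound holds everywhere; [E0] shows that the
   truncation is immaterial. *)
pose g x := Num.max (- M) (Num.min M (kap x / q x)).
have mg : measurable_fun setT g.
  apply: measurable_maxr => //; apply: measurable_minr => //.
  exact: measurable_funM.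
have gM x : `|g x| <= M.
  rewrite ler_norml /g le_max lexx/= ge_max ge_min lexx/= andbT.
  by rewrite (le_trans _ M0)// oppr_le0.
have igq : rint m (fun x => g x * q x).
  apply: (@rint_le _ _ _ _ _ (fun x => M * q x)).
  - exact: measurable_funM.
  - exact: rintZ.
  - by move=> x; rewrite normrM (gtr0_norm (q0 x)) ler_wpM2r// ltW.
have i1 E h : measurable E -> rint m h -> rint m (fun x => h x * \1_E x).
  move=> mE ih; apply: (@rint_le _ _ _ _ _ (fun x => `|h x|)).
  - by apply: measurable_funM; [exact: rint_meas ih|exact: measurable_indic].
  - exact: integrable_norm ih.
  - by move=> x; rewrite indicE; case: (_ \in _); rewrite ?mulr1 ?mulr0 ?normr0.
have le0 (s : R) E : `|s| = 1 -> measurable E ->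
    \int[m]_x ((s * kap x - M * q x) * \1_E x) <= 0.
  move=> s1 mE.
  rewrite (_ : (fun x => _) = fun x => s * (kap x * \1_E x) - M * (q x * \1_E x)); last first.
    by apply/funext => x; rewrite mulrBl !mulrA.
  have ik1 := i1 _ _ mE ik; have iq1 := i1 _ _ mE iq.
  rewrite RintegralB//; [|exact: rintZ|exact: rintZ].
  rewrite !RintegralZl// -kE// subr_le0.
  rewrite (le_trans (ler_norm _))// normrM s1 mul1r (le_trans (limint_le iq1))//.
  rewrite ler_wpM2l// le_eqVlt; apply/orP; left; apply/eqP; apply: eq_Rintegral => x _.
  by rewrite ger0_norm// mulr_ge0 ?indicE// ltW.
(* Truncation changes [kap] only on [Ep] and [Em], by exactly the excess over [M * q]; [le0] says
   that these excesses have nonpositive integral. *)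
have E0 : \int[m]_x `|g x * q x - kap x| <= 0.
  rewrite (_ : (fun x => _) = fun x => (1 * kap x - M * q x) * \1_Ep x +
      (- 1 * kap x - M * q x) * \1_Em x); last first.
    apply/funext => x; rewrite !indicE; have qx := q0 x.
    have [c cE] : exists c, kap x = c * q x by exists (kap x / q x); rewrite divfK// gt_eqF.
    have gE : g x = Num.max (- M) (Num.min M c) by rewrite /g cE mulfK// gt_eqF.
    have pE : (x \in Ep) = (M < c).
      apply/idP/idP; first by rewrite inE /Ep /= cE ltr_pM2r.
      by move=> h; rewrite inE /Ep /= cE ltr_pM2r.
    have mE : (x \in Em) = (M < - c).
      apply/idP/idP; first by rewrite inE /Em /= cE -mulNr ltr_pM2r.
      by move=> h; rewrite inE /Em /= cE -mulNr ltr_pM2r.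
    rewrite pE mE gE cE -mulrBl normrM (gtr0_norm qx).
    have [h|h] := ltrP M c.
      have NM : - M <= M by rewrite (le_trans _ M0)// oppr_le0.
      rewrite (max_idPr NM).
      rewrite ltNge (le_trans _ M0) ?oppr_le0 ?(le_trans M0 (ltW h))//= mulr0 mulr1 addr0.
      by rewrite distrC gtr0_norm ?subr_gt0// mul1r mulrBl.
    rewrite mulr0 add0r; have [h'|h'] := ltrP M (- c).
      have h2 : c <= - M by rewrite lerNr ltW.
      rewrite (max_idPl h2) mulr1.
      rewrite gtr0_norm; last by rewrite subr_gt0 ltrNr.
      by ring.
    have h3 : - M <= c by rewrite lerNl.
    by rewrite (max_idPr h3) subrr normr0 mul0r mulr0.
  rewrite RintegralD//; last 2 first.
  - by apply: i1 => //; apply: rintD; [exact: rintZ|apply: rintN; exact: rintZ].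
  - by apply: i1 => //; apply: rintD; [exact: rintZ|apply: rintN; exact: rintZ].
  by rewrite -[leRHS]addr0 lerD// le0// ?normrN normr1.
exists g; split => // E mE; rewrite kE//; apply/eqP; rewrite eq_sym -subr_eq0 -normr_le0.
have E1 : (fun x => g x * (q x * \1_E x)) = fun x => (g x * q x) * \1_E x.
  by apply/funext => x; rewrite mulrA.
rewrite E1 -RintegralB//; [|exact: i1|exact: i1].
have i2 : rint m (fun x => g x * q x - kap x) by apply: rintD => //; exact: rintN.
apply: le_trans E0; apply: (le_trans (le_normr_Rintegral _ _)) => //.
  by apply: rintD; [exact: i1|apply: rintN; exact: i1].
apply: le_Rintegral => //.
- by apply: integrable_norm; apply: rintD; [exact: i1|apply: rintN; exact: i1].
- exact: integrable_norm i2.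
by move=> x _; rewrite -mulrBl indicE; case: (_ \in _); rewrite ?mulr1 ?mulr0 ?normr0.
Qed.

End weak_star_real.

Import HBSimple HBNNSimple.

Section weak_star_representation.
Context d (T : measurableType d) (R : realType) (m : {sigma_finite_measure set T -> \bar R}).
Variables (q : T -> R) (h_ : nat -> T -> R) (M : R) (U : set_system nat).
Hypotheses (iq : rint m q) (q0 : forall x, 0 < q x) (M0 : 0 <= M).
Hypotheses (mh : forall k, measurable_fun setT (h_ k)) (hM : forall k x, `|h_ k x| <= M).
Hypothesis mqV : measurable_fun setT (fun x => (q x)^-1).
Hypothesis UU : UltraFilter U.
Local Notation limint := (limint m h_ U).

(** The identity known on products of [q] with indicators extends to all integrable [w], because
    both sides are linear and continuous in the $L^1$ norm. *)
Lemma weak_star_real : exists g : T -> R, [/\ measurable_fun setT g, forall x, `|g x| <= M &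
  forall w, rint m w -> (\int[m]_x (h_ k x * w x)) @[k --> U] --> \int[m]_x (g x * w x)].
Proof.
have [g [mg gM gE]] := limint_bounded_density iq q0 M0 mh hM mqV UU.
exists g; split => // w iw.
suff -> : \int[m]_x (g x * w x) = limint w by exact: (limint_cvg mh hM UU iw).
have lD := limintD mh hM UU; have lZ := limintZ mh hM UU.
have ll := limint_le mh hM UU.
have ig v : rint m v -> rint m (fun x => g x * v x).
  move=> iv; apply: (@rint_le _ _ _ _ _ (fun x => M * `|v x|)).
  - by apply: measurable_funM => //; exact: rint_meas iv.
  - by apply: rintZ; exact: integrable_norm iv.
  - by move=> x; rewrite normrM ler_wpM2r.
pose G v := limint v - \int[m]_x (g x * v x).
have GD v v' : rint m v -> rint m v' -> G (fun x => v x + v' x) = G v + G v'.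
  move=> iv iv'; rewrite /G lD//.
  have -> : \int[m]_x (g x * (v x + v' x)) = \int[m]_x (g x * v x) + \int[m]_x (g x * v' x).
    rewrite -RintegralD//; [|exact: ig|exact: ig].
    by apply: eq_Rintegral => x _; rewrite mulrDr.
  by rewrite opprD addrACA.
have GZ c v : rint m v -> G (fun x => c * v x) = c * G v.
  move=> iv; rewrite /G lZ// mulrBr -RintegralZl//; last exact: ig.
  by congr (_ - _); apply: eq_Rintegral => x _; rewrite mulrCA.
have Gle v : rint m v -> `|G v| <= 2 * M * \int[m]_x `|v x|.
  move=> iv; rewrite (le_trans (ler_normB _ _))// -mulrA mulr_natl mulr2n lerD ?ll//.
  rewrite -RintegralZl//; last exact: integrable_norm iv.
  apply: (le_trans (le_normr_Rintegral _ (ig _ iv))) => //.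
  apply: le_Rintegral => //.
  - exact: integrable_norm (ig _ iv).
  - by apply: rintZ; exact: integrable_norm iv.
  - by move=> x _; rewrite normrM ler_wpM2r.
have iqE E : measurable E -> rint m (fun x => q x * \1_E x).
  move=> mE; apply: (@rint_le _ _ _ _ _ q) => //.
    by apply: measurable_funM; [exact: rint_meas iq|exact: measurable_indic].
  move=> x; rewrite indicE; have /ltW qx := q0 x.
  by case: (_ \in _); rewrite ?mulr1 ?mulr0 ?normr0 ?ger0_norm.
have Gsum (r : seq R) (c : R -> R) (E : R -> set T) : (forall y, measurable (E y)) ->
    rint m (fun x => \sum_(y <- r) c y * (q x * \1_(E y) x)) /\
    G (fun x => \sum_(y <- r) c y * (q x * \1_(E y) x)) = 0.
  move=> mE; elim: r => [|y r [i0 IH]].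
    under eq_fun do rewrite big_nil.
    have i0 : rint m (fun=> 0).
      by have := rintZ 0 iq; congr (integrable _ _ _); apply/funext => x /=; rewrite mul0r.
    split => //; rewrite -[RHS](mul0r (G (fun=> 0))) -GZ//; congr G.
    by apply/funext => x; rewrite mul0r.
  under eq_fun do rewrite big_cons.
  have i1 : rint m (fun x => c y * (q x * \1_(E y) x)) by apply: rintZ; exact: iqE.
  split; first exact: rintD.
  rewrite GD// IH addr0 GZ; last exact: iqE.
  by rewrite /G gE// subrr mulr0.
(* The quotient $v/q$ is an increasing limit of simple functions [s k]. [G] vanishes on [q * s k],
   which converges to [v] in $L^1$ by domination. *)
have Gpos v : rint m v -> (forall x, 0 <= v x) -> G v = 0.
  move=> iv v0; pose u x := (v x / q x)%:E.
  have mu : measurable_fun setT u.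
    by apply/measurable_EFinP; apply: measurable_funM => //; exact: rint_meas iv.
  have u0 x : setT x -> (0 <= u x)%E by move=> _; rewrite lee_fin divr_ge0// ltW.
  pose s k : T -> R := nnsfun_approx measurableT mu k.
  have s0 k x : 0 <= s k x by exact: fun_ge0.
  have sE k : s k = fun x => \sum_(y <- finmap.enum_fset (fset_set (range (s k))))
      y * \1_(s k @^-1` [set y]) x.
    apply/funext => x; rewrite /s [LHS]fimfunE fsbig_finite//; exact: fimfunP.
  have ms k : measurable_fun setT (s k) by exact: measurable_funPT.
  have cs x : s k x @[k --> \oo] --> v x / q x.
    by have /fine_cvgP[] := cvg_nnsfun_approx measurableT mu u0 (x := x) I.
  have sv k x : q x * s k x <= v x.
    have c := cs x; have nd : nondecreasing_seq (fun k => s k x).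
      by move=> i j ij; have /lefP := nd_nnsfun_approx measurableT mu ij; exact.
    rewrite mulrC -ler_pdivlMr// -(cvg_lim _ c)//.
    by apply: nondecreasing_cvgn_le => //; exact: cvgP c.
  have cv x : q x * s k x @[k --> \oo] --> v x.
    have vE : v x = q x * (v x / q x) by rewrite mulrC divfK// gt_eqF.
    by rewrite [X in _ --> X]vE; apply: cvgM; [exact: cvg_cst|exact: cs].
  have is_ k : rint m (fun x => q x * s k x) /\ G (fun x => q x * s k x) = 0.
    have := Gsum (finmap.enum_fset (fset_set (range (s k)))) id (fun y => s k @^-1` [set y]) _.
    have -> : (fun x => q x * s k x) = fun x => \sum_(y <- finmap.enum_fset (fset_set (range (s k))))
      y * (q x * \1_(s k @^-1` [set y]) x).
      apply/funext => x; rewrite {1}sE mulr_sumr; apply: eq_bigr => y _; exact: mulrCA.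
    apply => y; rewrite -[X in measurable X]setTI; apply: ms => //; exact: measurable_set1.
  have D0 : (2 * M * \int[m]_x `|v x - q x * s k x|) @[k --> \oo] --> 2 * M * \int[m]_x (0 : R).
    apply: cvgM; first exact: cvg_cst.
    apply: (@rdominated _ _ _ m (fun k x => `|v x - q x * s k x|) (fun=> 0) v) => //.
    - move=> k; apply: measurableT_comp => //; apply: measurable_funB; first exact: rint_meas iv.
      exact: rint_meas (is_ k).1.
    - move=> x; rewrite -(normr0 R) -(subrr (v x)); apply: cvg_norm.
      by apply: cvgB; [exact: cvg_cst|exact: cv].
    - move=> k x; rewrite normr_id ger0_norm ?subr_ge0// lerBlDr lerDl.
      by rewrite mulr_ge0// ltW.
  rewrite Rintegral_cst// mul0r mulr0 in D0.
  apply/eqP; rewrite -normr_le0; rewrite -[leRHS](cvg_lim _ D0)//; apply: limr_ge; [exact: cvgP D0|apply: nearW => k].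
  have [i1 G1] := is_ k.
  have i2 : rint m (fun x => v x - q x * s k x) by apply: rintD => //; exact: rintN.
  have <- : G (fun x => v x - q x * s k x) = G v; last exact: Gle.
  have -> : G v = G (fun x => (v x - q x * s k x) + q x * s k x).
    by congr G; apply/funext => x; rewrite subrK.
  by rewrite [RHS]GD// G1 addr0.
have ia := integrable_norm iw.
have ip : rint m (fun x => `|w x| + w x) by exact: rintD.
have Gw : G (fun x => `|w x| + w x) = 0.
  by apply: Gpos => // x; have := ler_norm (- w x); rewrite normrN; lra.
have Ga : G (fun x => `|w x|) = 0 by apply: Gpos.
by move: Gw; rewrite GD// Ga add0r => /eqP; rewrite /G subr_eq0 => /eqP.
Qed.
End weak_star_representation.

Section almost_everywhere.
Context d (T : measurableType d) (R : realType) (m : {measure set T -> \bar R}).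

Lemma ae_Rintegral (f g : T -> R) : measurable_fun setT f -> measurable_fun setT g ->
  {ae m, forall x, f x = g x} -> \int[m]_x f x = \int[m]_x g x.
Proof.
move=> mf mg fg; rewrite /Rintegral; congr fine; apply: ae_eq_integral => //.
- exact/measurable_EFinP.
- exact/measurable_EFinP.
by apply: filterS fg => x /= -> _.
Qed.

Lemma ae_Cint (f g : T -> R[i]) : cmeas f -> cmeas g ->
  {ae m, forall x, f x = g x} -> Cint m f = Cint m g.
Proof.
move=> [f1 f2] [g1 g2] fg; apply: complex_ext; apply: ae_Rintegral => //;
  by apply: filterS fg => x /= ->.
Qed.

Lemma rint_eq0_ae (f : T -> R) : rint m f -> (forall x, 0 <= f x) -> \int[m]_x f x <= 0 ->
  {ae m, forall x, f x = 0}.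
Proof.
move=> fi f0 I0; have mf : measurable_fun setT (EFin \o f) by apply/measurable_EFinP; exact: rint_meas fi.
have : (\int[m]_x `|(EFin \o f) x| = 0)%E.
  have -> : (\int[m]_x `|(EFin \o f) x| = \int[m]_x (f x)%:E)%E.
    by apply: eq_integral => x _; rewrite /= ger0_norm.
  rewrite -(fineK (integrable_fin_num measurableT fi)); congr EFin.
  by apply/eqP; rewrite eq_le I0/= fine_ge0// integral_ge0// => x _; rewrite lee_fin.
move=> /ae_eq_integral_abs -/(_ measurableT mf); apply: filterS => x /= h.
by have [] := h I.
Qed.

End almost_everywhere.

(** * Weak-star limits of complex functions with the sharp bound *)

Section weak_star_complex.
Context {R : realType} (n : nat).
Local Notation V := 'rV[R]_n.
Local Notation mu := (@lebesgue_row R n).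

Lemma measurable_weightV : measurable_fun setT (fun x : V => (weight x)^-1).
Proof.
have -> : (fun x : V => (weight x)^-1) = fun x : V => \prod_i oneDsqr (x ord0 i).
  by apply/funext => x; rewrite /weight prodfV invrK.
apply: measurable_prod => i _; rewrite /oneDsqr; apply: measurable_funD => //.
apply: measurable_funX; exact: measurable_coord.
Qed.

(** Real and imaginary parts are treated separately along one ultrafilter, which first gives only
    the bound [M + M]; testing against the set where the modulus exceeds [M] restores [M]. The
    conclusion mentions only ordinary limits, which agree with limits along the ultrafilter whenever
    they exist. *)
Lemma weak_star (h_ : nat -> V -> R[i]) (M : R) : 0 <= M ->
  (forall k, cmeas (h_ k)) -> (forall k x, cabs (h_ k x) <= M) ->
  exists h : V -> R[i], [/\ cmeas h, forall x, cabs (h x) <= M &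
    forall w, cint mu w -> forall c,
      ccvg \oo (fun k => Cint mu (fun x => h_ k x * w x)) c -> Cint mu (fun x => h x * w x) = c].
Proof.
move=> M0 mh hM.
have [U [UU subU]] := @ultraFilterLemma nat \oo _.
have [m' mE] := sigma_finite_packed (@sigma_finite_lebesgue_row R n).
have iq := @rint_weight R n.
have [g1 [mg1 g1M g1E]] : exists g : V -> R, [/\ measurable_fun setT g, forall x, `|g x| <= M &
    forall w, rint mu w -> (\int[mu]_x (Re (h_ k x) * w x)) @[k --> U] --> \int[mu]_x (g x * w x)].
  have m1 k : measurable_fun setT (fun x => Re (h_ k x)) by case: (mh k).
  have b1 k x : `|Re (h_ k x)| <= M by apply: le_trans (hM k x); exact: Re_le_cabs.
  rewrite mE in iq *.
  exact: (weak_star_real iq (@weight_gt0 R n) M0 m1 b1 measurable_weightV UU).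
have [g2 [mg2 g2M g2E]] : exists g : V -> R, [/\ measurable_fun setT g, forall x, `|g x| <= M &
    forall w, rint mu w -> (\int[mu]_x (Im (h_ k x) * w x)) @[k --> U] --> \int[mu]_x (g x * w x)].
  have m1 k : measurable_fun setT (fun x => Im (h_ k x)) by case: (mh k).
  have b1 k x : `|Im (h_ k x)| <= M by apply: le_trans (hM k x); exact: Im_le_cabs.
  rewrite mE in iq *.
  exact: (weak_star_real iq (@weight_gt0 R n) M0 m1 b1 measurable_weightV UU).
pose h0 x : R[i] := (g1 x +i* g2 x)%C.
have mh0 : cmeas h0 by split.
have h0B x : cabs (h0 x) <= M + M.
  by apply: (le_trans (cabs_le_ReIm _)); exact: (lerD (g1M x) (g2M x)).
have pU : ProperFilter U by exact: ultra_proper.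
have ib (h : V -> R) w : measurable_fun setT h -> (forall x, `|h x| <= M) -> rint mu w ->
    rint mu (fun x => h x * w x).
  move=> mg gM iw; apply: (@rint_le _ _ _ _ _ (fun x => M * `|w x|)).
  - by apply: measurable_funM => //; exact: rint_meas iw.
  - by apply: rintZ; exact: integrable_norm iw.
  - by move=> x; rewrite normrM ler_wpM2r.
have cU w : cint mu w ->
    ccvg U (fun k => Cint mu (fun x => h_ k x * w x)) (Cint mu (fun x => h0 x * w x)).
  move=> [i1 i2]; split.
    rewrite (_ : @complex.Re R \o _ = fun k =>
        \int[mu]_x (Re (h_ k x) * Re (w x)) - \int[mu]_x (Im (h_ k x) * Im (w x))).
      rewrite (_ : complex.Re _ = \int[mu]_x (g1 x * Re (w x)) - \int[mu]_x (g2 x * Im (w x))).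
        by apply: cvgB; [exact: g1E|exact: g2E].
      rewrite -RintegralB//; [|exact: ib|exact: ib].
      by apply: eq_Rintegral => x _ /=; rewrite ReM.
    apply/funext => k; rewrite -RintegralB//.
    - by apply: eq_Rintegral => x _ /=; rewrite ReM.
    - by apply: ib => //; [case: (mh k)|move=> x; apply: le_trans (hM k x); exact: Re_le_cabs].
    - by apply: ib => //; [case: (mh k)|move=> x; apply: le_trans (hM k x); exact: Im_le_cabs].
  rewrite (_ : @complex.Im R \o _ = fun k =>
      \int[mu]_x (Re (h_ k x) * Im (w x)) + \int[mu]_x (Im (h_ k x) * Re (w x))).
    rewrite (_ : complex.Im _ = \int[mu]_x (g1 x * Im (w x)) + \int[mu]_x (g2 x * Re (w x))).
      by apply: cvgD; [exact: g1E|exact: g2E].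
    rewrite -RintegralD//; [|exact: ib|exact: ib].
    by apply: eq_Rintegral => x _ /=; rewrite ImM.
  apply/funext => k; rewrite -RintegralD//.
  - by apply: eq_Rintegral => x _ /=; rewrite ImM.
  - by apply: ib => //; [case: (mh k)|move=> x; apply: le_trans (hM k x); exact: Re_le_cabs].
  - by apply: ib => //; [case: (mh k)|move=> x; apply: le_trans (hM k x); exact: Im_le_cabs].
pose E := [set x | M < cabs (h0 x)].
have mE' : measurable E.
  have := measurable_fun_ltr (measurable_cst M) (cmeas_cabs mh0) measurableT (Y := [set true]).
  by rewrite setTI; apply.
pose e x := weight x * \1_E x.
have e0 x : 0 <= e x by rewrite mulr_ge0 ?weight_ge0// indicE.
have ie : rint mu e.
  apply: (@rint_le _ _ _ _ _ (@weight R n)) => //.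
    by apply: measurable_funM; [exact: rint_meas iq|exact: measurable_indic].
  move=> x; rewrite ger0_norm// /e indicE ler_piMr ?weight_ge0//.
  by case: (_ \in _).
(* Against this function [h0] integrates to $\int e|h_0|^2$, while every [h_ k] gives at most $M\int
   e|h_0|$. As [e] is positive exactly on [E], where $|h_0|>M$, the set [E] must be null. *)
pose w x := (h0 x)^*%C * (e x)%:C%C.
have iw : cint mu w.
  have := cintM (cint_real ie) (cmeas_conj mh0) (B := M + M) _.
  rewrite /w; under eq_fun do rewrite mulrC; apply.
  by move=> x; rewrite cabs_conj.
have wE x : h0 x * w x = (e x * cabs (h0 x) ^+ 2)%:C%C.
  by rewrite /w mulrA -[h0 x * _]cabs_sqr_conj -rmorphM mulrC.
have absw x : cabs (w x) = e x * cabs (h0 x).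
  by rewrite cabsM cabs_conj cabs_real ger0_norm// mulrC.
have iw2 : rint mu (fun x => e x * cabs (h0 x) ^+ 2).
  apply: (@rint_le _ _ _ _ _ (fun x => (M + M) ^+ 2 * e x)).
  - by apply: measurable_funM; [exact: rint_meas ie|apply: measurable_funX; exact: cmeas_cabs].
  - exact: rintZ.
  - move=> x; rewrite (ger0_norm (mulr_ge0 (e0 x) (sqr_ge0 _))) [leLHS]mulrC ler_wpM2r//.
    by rewrite lerXn2r// ?nnegrE ?cabs_ge0// addr_ge0.
have iwM : rint mu (fun x => M * cabs (w x)) by apply: rintZ; exact: cint_cabs.
have bd : \int[mu]_x (e x * cabs (h0 x) ^+ 2) <= \int[mu]_x (M * cabs (w x)).
  have : cabs (Cint mu (fun x => h0 x * w x)) <= \int[mu]_x (M * cabs (w x)).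
    apply: (ccvg_cabs_le (cU w iw)) => k; apply: cabs_Cint_le_ub => //.
      by apply: cmeasM => //; exact: cint_meas iw.
    by move=> x; rewrite cabsM ler_wpM2r ?cabs_ge0.
  under eq_fun do rewrite wE.
  rewrite Cint_real cabs_real; apply: le_trans; exact: ler_norm.
have fE x : e x * cabs (h0 x) ^+ 2 - M * cabs (w x) = e x * cabs (h0 x) * (cabs (h0 x) - M).
  by rewrite absw; ring.
have nul : {ae mu, forall x, e x * cabs (h0 x) ^+ 2 - M * cabs (w x) = 0}.
  apply: rint_eq0_ae; first by apply: rintD => //; exact: rintN.
  - move=> x; rewrite fE; have [xE|xE] := pselect (E x).
      apply: mulr_ge0; first exact: mulr_ge0 (e0 x) (cabs_ge0 _).
      by rewrite subr_ge0 ltW.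
    by rewrite /e indicE memNset// mulr0 !mul0r.
  - by rewrite RintegralB// subr_le0.
pose h x := if cabs (h0 x) <= M then h0 x else 0.
have mh' : cmeas h.
  have -> : h = fun x => h0 x * (\1_(~` E) x)%:C%C.
    apply/funext => x; rewrite /h indicE; case: ifPn => hx.
      by rewrite mem_set ?mulr1// /E /= => /lt_geF; rewrite hx.
    by rewrite memNset ?mulr0// => /= h'; apply: h'; rewrite /E/= ltNge.
  apply: cmeasM => //; apply: cmeas_real; apply: measurable_indic; exact: measurableC.
exists h; split => //.
  by move=> x; rewrite /h; case: ifP => // _; rewrite cabs0.
move=> v iv c hc; transitivity (Cint mu (fun x => h0 x * v x)).
  apply: ae_Cint.
  - by apply: cmeasM => //; exact: cint_meas iv.
  - by apply: cmeasM => //; exact: cint_meas iv.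
  apply: filterS nul => x; rewrite fE /h; case: ifPn => //; rewrite -ltNge => xE.
  have hp : 0 < cabs (h0 x) by exact: le_lt_trans xE.
  have hM' : 0 < cabs (h0 x) - M by rewrite subr_gt0.
  move=> /eqP; rewrite /e indicE mem_set// mulr1 !mulf_eq0.
  by rewrite (gt_eqF (weight_gt0 x)) (gt_eqF hp) (gt_eqF hM').
apply: (ccvg_unique (cU v iv)); have [c1 c2] := hc.
by split; [move=> N /c1; exact: subU|move=> N /c2; exact: subU].
Qed.

End weak_star_complex.

(** * Rapidly decreasing functions and derivatives under the Fourier transform *)

Lemma mvt_le_near {R : realType} (f df : R -> R) (B h : R) :
  (forall t : R, is_derive t 1 f (df t)) -> (forall t : R, `|t| <= `|h| -> `|df t| <= B) ->
  `|f h - f 0| <= B * `|h|.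
Proof.
move=> fd fB.
have M a b : a < b -> exists2 c, c \in `]a, b[ & f b - f a = df c * (b - a).
  move=> ab; apply: (@MVT R f df a b ab (fun t _ => fd t)).
  by apply: derivable_within_continuous => t _; case: (fd t).
have [h0|h0|->] := ltgtP h 0; last by rewrite subrr !normr0 mulr0.
  have [c] := M _ _ h0; rewrite in_itv /= => /andP[c1 c2] E.
  rewrite distrC E sub0r normrM normrN ler_wpM2r// fB//.
  by rewrite !ltr0_norm// lerN2 ltW.
have [c] := M _ _ h0; rewrite in_itv /= => /andP[c1 c2] ->.
by rewrite subr0 normrM ler_wpM2r// fB// !gtr0_norm// ltW.
Qed.

(** The derivative along the sequence of steps $1/(k+1)$, the form required by sequential dominated
    convergence. *)
Lemma derive_seq {R : realType} (W : normedModType R) (f : W -> R) (x v : W) (df : R) :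
  is_derive x v f df -> (k.+1%:R * (f (k.+1%:R^-1 *: v + x) - f x)) @[k --> \oo] --> df.
Proof.
move=> [fd <-]; move: fd => /cvg_ex[l fl].
have -> : 'D_v f x = l by exact: cvg_lim fl.
apply/cvgrPdist_le => e e0; move/cvgrPdist_le: fl => /(_ e e0).
rewrite near_withinE => hn.
have h2 : \forall k \near \oo, (k.+1%:R^-1 : R) != 0 ->
    `|l - (k.+1%:R^-1)^-1 *: (f (k.+1%:R^-1 *: v + x) - f x)| <= e := @cvg_harmonic R _ hn.
apply: (filterS _ h2) => k hk.
have := hk; rewrite /GRing.scale/= invrK; apply.
by rewrite invr_eq0 pnatr_eq0.
Qed.

Section rapid_decrease.
Context {R : realType} (n : nat).
Local Notation V := 'rV[R]_n.
Local Notation mu := (@lebesgue_row R n).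
Local Notation tp := (2 * pi : R).
Local Notation e_ j := (delta_mx ord0 j : V).
Implicit Types phi : V -> R[i].

(** The Schwartz condition with one derivative and one power at a time, free of extended-real
    suprema; [schwartzP] gives the equivalence. *)
Definition rapid phi := smooth phi /\
  forall s k, exists C, forall x : V, (1 + `|x|) ^+ k * cabs (cpartial s phi x) <= C.

Lemma cpartial_cat s s' phi : cpartial s' (cpartial s phi) = cpartial (s' ++ s) phi.
Proof.
apply/funext => x; rewrite /cpartial; congr (_ +i* _)%C;
  by rewrite /partial foldr_cat; congr (foldr _ _ _ _).
Qed.

Lemma smooth_cpartial s phi : smooth phi -> smooth (cpartial s phi).
Proof. by move=> [p1 p2]; split; [exact: (smooth_partial s p1)|exact: (smooth_partial s p2)]. Qed.

Lemma rapid_cpartial s phi : rapid phi -> rapid (cpartial s phi).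
Proof.
move=> [sp hp]; split; first exact: smooth_cpartial.
by move=> s' k; have [C hC] := hp (s' ++ s) k; exists C => x; rewrite cpartial_cat.
Qed.

(** Each factor satisfies $1+x_i^2\le(1+|x|)^2$. Hence the exponent $2n$ in the decay estimates that
    yield integrability. *)
Lemma weight_ge (x : V) : 1 <= (1 + `|x|) ^+ (2 * n) * weight x.
Proof.
have -> : (1 + `|x|) ^+ (2 * n) = \prod_(i < n) ((1 + `|x|) ^+ 2).
  by rewrite prodr_const card_ord exprM.
rewrite /weight -big_split /=; apply: (big_ind (fun y => 1 <= y)) => // [y z|i _]; first exact: mulr_ege1.
have d0 : 0 < oneDsqr (x ord0 i) by rewrite /oneDsqr ltr_pwDl// sqr_ge0.
rewrite ler_pdivlMr// mul1r /oneDsqr.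
have := coord_le_norm x i; have := normr_ge0 (x ord0 i) => h0 h1.
rewrite -(real_normK (num_real (x ord0 i))); nra.
Qed.

Lemma le_weight (x : V) (a C : R) : 0 <= a -> (1 + `|x|) ^+ (2 * n) * a <= C -> a <= C * weight x.
Proof.
move=> a0 aC; apply: le_trans (ler_wpM2r (weight_ge0 x) aC).
by rewrite mulrAC ler_peMl// weight_ge.
Qed.

Lemma rapid_cint s phi : rapid phi -> cint mu (cpartial s phi).
Proof.
move=> [sp /(_ s (2 * n)%N)[C hC]].
apply: (@cint_le _ _ _ _ _ (fun x => C * weight x)).
- by apply: csmooth_meas; exact: smooth_cpartial.
- by apply: rintZ; exact: rint_weight.
- by move=> x; apply: le_weight => //; exact: cabs_ge0.
Qed.

Lemma norm_delta_le j : `|e_ j| <= 1.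
Proof.
apply/(@cube_norm R n (e_ j) 1) => // i; rewrite mxE eqxx /=.
by case: (i == j); rewrite ?normr1 ?normr0.
Qed.

(** An integrable majorant, uniform in the step, for the difference quotients of a rapidly
    decreasing function. *)
Lemma rapid_difference j phi : rapid phi -> exists C, forall x (t : R), `|t| <= 1 ->
  cabs (phi (t *: e_ j + x) - phi x) <= C * weight x * `|t|.
Proof.
move=> rp; have [[s1 s2] hp] := rp; have [C hC] := hp [:: j] (2 * n)%N.
(* For $|t|\le1$ one has $1+|x|\le2(1+|x+te_j|)$; raising this to the power $2n$ produces the
   factor. *)
pose C' := 2 ^+ (2 * n) * C.
have hC' x (t : R) : `|t| <= 1 -> cabs (cpartial [:: j] phi (t *: e_ j + x)) <= C' * weight x.
  move=> t1; apply: le_weight; first exact: cabs_ge0.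
  apply: le_trans (ler_wpM2l _ (hC (t *: e_ j + x))); last exact: exprn_ge0.
  rewrite mulrA -exprMn ler_wpM2r ?cabs_ge0// lerXn2r// ?nnegrE ?mulr_ge0 ?addr_ge0//.
  have h1 : `|x| <= `|t *: e_ j + x| + 1.
    rewrite -{1}(addKr (t *: e_ j) x) addrC (le_trans (ler_normD _ _))// lerD2l normrN normrZ.
    by rewrite mulr_ile1// norm_delta_le.
  by have := normr_ge0 (t *: e_ j + x); lra.
exists (C' + C') => x t t1.
have H (g : V -> R) : real_smooth g ->
    (forall y, `|'D_(e_ j) g y| <= cabs (cpartial [:: j] phi y)) ->
    `|g (t *: e_ j + x) - g x| <= C' * weight x * `|t|.
  move=> sg hg; have := @mvt_le_near R (fun t => g (t *: e_ j + x))
    (fun t => 'D_(e_ j) g (t *: e_ j + x)) (C' * weight x) t.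
  rewrite scale0r add0r; apply.
    by move=> u; apply: is_derive_line_at; exact: smooth_derivable.
  by move=> u ut; rewrite (le_trans (hg _))// hC'// (le_trans ut).
apply: (le_trans (cabs_le_ReIm _)); rewrite !mulrDl; apply: lerD.
  by have := H _ s1 (fun y => Re_le_cabs (cpartial [:: j] phi y)); rewrite /= -ReN -ReD.
by have := H _ s2 (fun y => Im_le_cabs (cpartial [:: j] phi y)); rewrite /= -ImN -ImD.
Qed.

(** Proved without integration by parts. The transform of a difference quotient is $\hat\varphi$
    times $(e^{it a}-1)/t$ with $a=2\pi\xi_j$, by translation invariance of the integral. As
    $t=1/(k+1)$ tends to 0 the quotient converges with domination, and the factor tends to $ia$. *)
Lemma fourier_cpartial j phi xi : rapid phi ->
  fourier (cpartial [:: j] phi) xi = (0 +i* (tp * xi ord0 j))%C * fourier phi xi.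
Proof.
move=> rp; have [C hC] := rapid_difference j rp; have [[s1 s2] _] := rp.
have ip : cint mu phi by have := rapid_cint [::] rp; congr cint; apply/funext => x; exact: cpartial0.
pose t k : R := k.+1%:R^-1.
pose D k x : R[i] := (k.+1%:R)%:C%C * ((phi (t k *: e_ j + x) - phi x) * cis (- (tp * dotr x xi))).
have mphi := cint_meas ip.
have mcis : cmeas (fun x : V => cis (- (tp * dotr x xi))).
  by apply: cmeas_cis; apply: measurableT_comp => //; exact: measurable_dotrl.
have msh k : cmeas (fun x => phi (t k *: e_ j + x)).
  have := cint_meas (cint_shift (t k *: e_ j) ip).
  by congr cmeas; apply/funext => x; rewrite addrC.
have t1 k : `|t k| <= 1 by rewrite ger0_norm ?invr_ge0// invf_le1// ler1n.
have c1 : ccvg \oo (fun k => Cint mu (D k)) (fourier (cpartial [:: j] phi) xi).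
  rewrite fourierE; apply: (@cdominated _ _ _ _ _ _ (fun x => C * weight x)).
  - move=> k; apply: cmeasM; first exact: cmeas_cst.
    by apply: cmeasM => //; exact: cmeasB.
  - by apply: cmeasM => //; exact: cint_meas (rapid_cint [:: j] rp).
  - move=> x; apply: (@ccvg_near _ _ _ (fun k => ((k.+1%:R)%:C%C * (phi (t k *: e_ j + x) - phi x)) * cis (- (tp * dotr x xi)))).
      by move=> k; rewrite /D mulrA.
    apply: ccvgM; last exact: ccvg_cst.
    have d1 := derive_seq (derivableP (@smooth_derivable R n _ x j s1)).
    have d2 := derive_seq (derivableP (@smooth_derivable R n _ x j s2)).
    split.
      rewrite (_ : @complex.Re R \o _ = fun k =>
        k.+1%:R * ((@complex.Re R \o phi) (t k *: e_ j + x) - (@complex.Re R \o phi) x)) //.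
      by apply/funext => k /=; rewrite ReM /= mul0r subr0 ReD ReN.
    rewrite (_ : @complex.Im R \o _ = fun k =>
        k.+1%:R * ((@complex.Im R \o phi) (t k *: e_ j + x) - (@complex.Im R \o phi) x)) //.
    by apply/funext => k /=; rewrite ImM /= mul0r addr0 ImD ImN.
  - by apply: rintZ; exact: rint_weight.
  move=> k x; rewrite /D !cabsM cabs_cis mulr1 cabs_real ger0_norm//.
  rewrite mulrC -ler_pdivlMr// (le_trans (hC x _ (t1 k)))// ger0_norm ?invr_ge0//.
have DE k : Cint mu (D k) =
    (k.+1%:R)%:C%C * (cis (t k * (tp * xi ord0 j)) - 1) * fourier phi xi.
  have i1 : cint mu (fun x => phi x * cis (- (tp * dotr x xi))) by exact: cint_cisN.
  have i2 := cint_shift (t k *: e_ j) i1.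
  have E x : phi (t k *: e_ j + x) * cis (- (tp * dotr x xi)) =
      cis (t k * (tp * xi ord0 j)) * (phi (x + t k *: e_ j) * cis (- (tp * dotr (x + t k *: e_ j) xi))).
    rewrite [X in phi X]addrC mulrCA; congr (_ * _).
    have -> : dotr (x + t k *: e_ j) xi = t k * xi ord0 j + dotr x xi.
      by rewrite addrC dotrC dotr_line dotr_delta [dotr x _]dotrC.
    by rewrite -cisD; congr cis; ring.
  have iD : cint mu (fun x => (phi (t k *: e_ j + x) - phi x) * cis (- (tp * dotr x xi))).
    apply: cint_cisN; apply: cintB => //.
    have := cint_shift (t k *: e_ j) ip.
    by congr cint; apply/funext => x; rewrite addrC.
  rewrite /D CintZ//.
  rewrite -mulrA; congr (_ * _).
  rewrite (_ : (fun x => _) = fun x => cis (t k * (tp * xi ord0 j)) *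
     (phi (x + t k *: e_ j) * cis (- (tp * dotr (x + t k *: e_ j) xi))) -
     phi x * cis (- (tp * dotr x xi))); last by apply/funext => x; rewrite mulrBl E.
  rewrite CintB//; last exact: cintZ.
  by rewrite CintZ// (Cint_shift (t k *: e_ j) i1) -fourierE mulrBl mul1r.
apply: (ccvg_unique c1); apply: ccvg_near (fun k => esym (DE k)) _.
apply: ccvgM; last exact: ccvg_cst.
set a := tp * xi ord0 j.
have dc : is_derive (0 : R) 1 (fun u => cos (a * u + 0)) (a * - sin (a * 0 + 0)).
  exact: (is_derive_affine (is_derive_cos _)).
have ds : is_derive (0 : R) 1 (fun u => sin (a * u + 0)) (a * cos (a * 0 + 0)).
  exact: (is_derive_affine (is_derive_sin _)).
have -> : (0 +i* a)%C = (a * - sin (a * 0 + 0) +i* (a * cos (a * 0 + 0)))%C.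
  by rewrite mulr0 addr0 sin0 cos0 oppr0 mulr0 mulr1.
have c2 := derive_seq dc; have c3 := derive_seq ds; split.
  rewrite (_ : @complex.Re R \o _ = fun k =>
    k.+1%:R * (cos (a * (k.+1%:R^-1 *: (1 : R) + 0) + 0) - cos (a * 0 + 0))) //.
  apply/funext => k; transitivity (Re ((k.+1%:R)%:C%C * (cis (t k * a) - 1))) => //.
  rewrite ReM ReD ReN /= mul0r subr0 !addr0 mulr0.
  by rewrite /GRing.scale/= mulr1 [a * _]mulrC ?cos0 ?sin0.
rewrite (_ : @complex.Im R \o _ = fun k =>
    k.+1%:R * (sin (a * (k.+1%:R^-1 *: (1 : R) + 0) + 0) - sin (a * 0 + 0))) //.
  apply/funext => k; transitivity (Im ((k.+1%:R)%:C%C * (cis (t k * a) - 1))) => //.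
  rewrite ImM ImD ImN /= mul0r !addr0 mulr0.
  by rewrite /GRing.scale/= mulr1 [a * _]mulrC ?cos0 ?sin0.
Qed.

End rapid_decrease.

(** * Decay of Fourier transforms and inversion for rapidly decreasing functions *)

Section fourier_rapid.
Context {R : realType} (n : nat).
Local Notation V := 'rV[R]_n.
Local Notation mu := (@lebesgue_row R n).
Local Notation ctest := (test_function (setT : set V)).
Local Notation tp := (2 * pi : R).
Implicit Types phi : V -> R[i].

Lemma rapid_cint0 phi : rapid phi -> cint mu phi.
Proof. by move=> /(rapid_cint [::]); congr cint; apply/funext => x; exact: cpartial0. Qed.

Lemma cabs_imag (a : R) : cabs (0 +i* a)%C = `|a|.
Proof. by rewrite cabsE /= expr0n add0r sqrtr_sqr. Qed.

Lemma fourier_coord_le j phi (xi : V) : rapid phi ->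
  `|xi ord0 j| * cabs (fourier phi xi) <= cabs (fourier (cpartial [:: j] phi) xi).
Proof.
move=> rp; rewrite fourier_cpartial// cabsM cabs_imag ler_wpM2r ?cabs_ge0// normrM.
rewrite ler_peMl// ger0_norm ?mulr_ge0 ?pi_ge0//.
have := @pi_ge2 R; lra.
Qed.

(** A factor $1+\xi_j^2$ is paid for by the function itself plus its second derivative in direction
    $j$; hence one factor 2 and at most two more derivatives per coordinate of [r]. *)
Lemma fourier_prod_le (A : R) (r : seq 'I_n) s0 phi (xi : V) : rapid phi ->
  (forall s, (size s <= size s0 + 2 * size r)%N -> \int[mu]_x cabs (cpartial s phi x) <= A) ->
  (\prod_(j <- r) oneDsqr (xi ord0 j)) * cabs (fourier (cpartial s0 phi) xi) <= 2 ^+ size r * A.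
Proof.
move=> rp; elim: r s0 => [|j r IH] s0 hA.
  rewrite big_nil mul1r mul1r (le_trans (fourier_le _ (rapid_cint s0 rp)))// hA//.
  by rewrite addn0.
have rs := rapid_cpartial s0 rp.
have P0 : 0 <= \prod_(i <- r) oneDsqr (xi ord0 i).
  by apply: prodr_ge0 => i _; rewrite /oneDsqr addr_ge0 ?sqr_ge0.
rewrite big_cons [size _]/= exprS -[leLHS]mulrA -[leRHS]mulrA [leRHS]mulr_natl [leRHS]mulr2n.
rewrite {1}/oneDsqr mulrDl mul1r lerD//.
  by apply: IH => s hs; apply: hA; rewrite (leq_trans hs)// mulnS addnCA leq_addl.
rewrite mulrCA; apply: le_trans (IH [:: j, j & s0] _); last first.
  by move=> s hs; apply: hA; rewrite (leq_trans hs)//= mulnS addnCA.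
rewrite ler_wpM2l// -real_normK ?num_real// expr2 -mulrA.
apply: le_trans (ler_wpM2l _ (fourier_coord_le j xi rs)) _; first exact: normr_ge0.
rewrite cpartial_cat; apply: (le_trans (fourier_coord_le j xi (rapid_cpartial _ rp))).
by rewrite cpartial_cat.
Qed.

Lemma fourier_weight_le (A : R) phi (xi : V) : rapid phi ->
  (forall s, (size s <= 2 * n)%N -> \int[mu]_x cabs (cpartial s phi x) <= A) ->
  cabs (fourier phi xi) <= 2 ^+ n * A * weight xi.
Proof.
move=> rp hA; have sz : size (index_enum 'I_n) = n by rewrite -[RHS]card_ord cardE enumT.
have := @fourier_prod_le A (index_enum 'I_n) [::] phi xi rp.
rewrite sz add0n (_ : cpartial [::] phi = phi); last by apply/funext => x; exact: cpartial0.
move=> /(_ hA) H; rewrite /weight prodfV ler_pdivlMr; first by rewrite mulrC.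
by apply: prodr_gt0 => i _; rewrite /oneDsqr ltr_pwDl// sqr_ge0.
Qed.

Lemma fourier_rapid_cint phi : rapid phi -> cint mu (fourier phi).
Proof.
move=> rp; have ip := rapid_cint0 rp.
have ex s : exists2 C, 0 <= C & \int[mu]_x cabs (cpartial s phi x) <= C.
  by eexists; last exact: lexx; apply: Rintegral_ge0 => x _; exact: cabs_ge0.
have [A A0 hA] := @seq_bound R n _ (fun s C C' CC h => le_trans h CC) ex (2 * n)%N.
apply: (@cint_le _ _ _ _ _ (fun z => 2 ^+ n * A * weight z)).
- exact: fourier_meas.
- by apply: rintZ; exact: rint_weight.
- by move=> z; exact: fourier_weight_le.
Qed.

(** Since $|\xi|\le\sum_j|\xi_j|$, one more power of $1+|\xi|$ is bounded by the previous power for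
    [phi] and for its first derivatives. *)
Lemma fourier_decay k phi : rapid phi ->
  exists C, forall xi : V, (1 + `|xi|) ^+ k * cabs (fourier phi xi) <= C.
Proof.
elim: k phi => [|k IH] phi rp.
  by exists (\int[mu]_x cabs (phi x)) => xi; rewrite mul1r fourier_le//; exact: rapid_cint0.
have [C0 hC0] := IH _ rp.
have [C hC] := choice (fun j => IH _ (rapid_cpartial [:: j] rp)).
exists (C0 + \sum_j C j) => xi; rewrite exprSr -mulrA mulrDl mul1r mulrDr lerD//.
have hn : `|xi| <= \sum_j `|xi ord0 j|.
  apply/(@cube_norm R n xi); first exact: sumr_ge0.
  by move=> i; rewrite (bigD1 i)//= lerDl sumr_ge0.
have p0 : 0 <= (1 + `|xi|) ^+ k by rewrite exprn_ge0.
apply: (@le_trans _ _ (\sum_j (1 + `|xi|) ^+ k * (`|xi ord0 j| * cabs (fourier phi xi)))).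
  by rewrite -mulr_sumr -mulr_suml ler_wpM2l// ler_wpM2r ?cabs_ge0.
apply: ler_sum => j _; apply: le_trans (hC j xi); rewrite ler_wpM2l//.
exact: fourier_coord_le.
Qed.

Lemma rapid_bounded phi : rapid phi -> exists B, forall x, cabs (phi x) <= B.
Proof.
by move=> [_ /(_ [::] 0%N)[B hB]]; exists B => x; have := hB x; rewrite mul1r cpartial0.
Qed.

Lemma smooth_line_cvg phi (x y : V) : smooth phi -> ccvg \oo (fun k => phi (x - k.+1%:R^-1 *: y)) (phi x).
Proof.
move=> [/smooth_cont c1 /smooth_cont c2].
have h : (x - k.+1%:R^-1 *: y) @[k --> \oo] --> x.
  rewrite -[X in _ --> X]subr0 -(scale0r y); apply: cvgB; first exact: cvg_cst.
  by apply: cvgZr_tmp; exact: cvg_harmonic.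
by split; [exact: (continuous_cvg _ (c1 x) h)|exact: (continuous_cvg _ (c2 x) h)].
Qed.

Lemma fourier_inversion_rapid phi (x : V) : rapid phi ->
  Cint mu (fun z => fourier phi z * cis (tp * dotr z x)) = phi x.
Proof.
move=> rp; have [B hB] := rapid_bounded rp.
apply: fourier_inversion hB _; [exact: rapid_cint0|exact: fourier_rapid_cint|].
by move=> y; apply: smooth_line_cvg; case: rp.
Qed.

Lemma fourier_fourierN phi x : rapid phi -> fourier (fourier phi) (- x) = phi x.
Proof.
move=> rp; rewrite fourierE -[RHS]fourier_inversion_rapid//; congr Cint.
by apply/funext => z; rewrite dotrNr mulrN opprK.
Qed.

Lemma fourierN_fourier phi x : rapid phi -> fourier (fun z => fourier phi (- z)) x = phi x.
Proof.
move=> rp; rewrite fourierE -[RHS]fourier_inversion_rapid//.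
rewrite -[RHS](Cint_reflect 0); last exact: cint_cis (fourier_rapid_cint rp).
by congr Cint; apply/funext => z; rewrite sub0r dotrNl mulrN.
Qed.

End fourier_rapid.

(** * Schwartz functions and transforms of test functions *)

Section schwartz_rapid.
Context {R : realType} (n : nat).
Local Notation V := 'rV[R]_n.
Local Notation mu := (@lebesgue_row R n).
Local Notation ctest := (test_function (setT : set V)).
Local Notation tp := (2 * pi : R).
Implicit Types phi : V -> R[i].

Lemma seminorm_ub k N phi s (x : V) : (size s <= N)%N ->
  (((1 + `|x|) ^+ k * cabs (cpartial s phi x))%:E <= seminorm k N phi)%E.
Proof. by move=> sN; apply: ereal_sup_ubound; exists x, s. Qed.

Lemma seminorm_ge0 k N phi : (0 <= seminorm k N phi)%E.
Proof.
apply: le_trans (seminorm_ub k phi (s := [::]) 0 (leq0n N)).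
by rewrite lee_fin mulr_ge0 ?cabs_ge0// exprn_ge0.
Qed.

Lemma schwartz_seminorm k N phi s (x : V) : schwartz phi -> (size s <= N)%N ->
  (1 + `|x|) ^+ k * cabs (cpartial s phi x) <= fine (seminorm k N phi).
Proof.
move=> [_ fs] sN; rewrite -lee_fin fineK ?seminorm_ub//.
by rewrite ge0_fin_numE ?seminorm_ge0.
Qed.

Lemma schwartzP phi : schwartz phi <-> rapid phi.
Proof.
split=> [sp|[sp hp]].
  split; first by case: sp.
  by move=> s k; eexists => x; exact: (schwartz_seminorm k x sp (leqnn (size s))).
split=> // k N.
have ex s : exists2 C, 0 <= C & forall x : V, (1 + `|x|) ^+ k * cabs (cpartial s phi x) <= C.
  have [C hC] := hp s k; exists C => //; apply: le_trans (hC 0).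
  by rewrite mulr_ge0 ?cabs_ge0// exprn_ge0.
have [C _ hC] := @seq_bound R n _ (fun s C C' CC h => fun x => le_trans (h x) CC) ex N.
apply: (@le_lt_trans _ _ C%:E); last exact: ltry.
by apply: ge_ereal_sup => _ [x [s [sN ->]]]; rewrite lee_fin; exact: hC.
Qed.

(** The seminorm controls the $L^1$ norms of the derivatives of order at most $2n$, hence
    $\hat\varphi$ by a multiple of [weight]. This continuity makes the functional of
    [symbol_extension] tempered. *)
Lemma fourier_seminorm_le : exists2 C : R, 0 <= C & forall phi, schwartz phi ->
  \int[mu]_z cabs (fourier phi z) <= C * fine (seminorm (2 * n) (2 * n) phi).
Proof.
pose W := \int[mu]_x (@weight R n x).
have W0 : 0 <= W by apply: Rintegral_ge0 => x _; exact: weight_ge0.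
have iW := @rint_weight R n.
exists (2 ^+ n * W * W) => [|phi sp]; first by rewrite !mulr_ge0.
have rp := (schwartzP phi).1 sp; set S := fine _.
have hA s : (size s <= 2 * n)%N -> \int[mu]_x cabs (cpartial s phi x) <= S * W.
  move=> sN; rewrite /W -RintegralZl//; apply: le_Rintegral => //.
  - exact: cint_cabs (rapid_cint s rp).
  - exact: rintZ.
  - by move=> x _; apply: le_weight; [exact: cabs_ge0|exact: schwartz_seminorm].
have -> : 2 ^+ n * W * W * S = 2 ^+ n * (S * W) * W by ring.
rewrite /W -RintegralZl//; apply: le_Rintegral => //.
- exact: cint_cabs (fourier_rapid_cint rp).
- exact: rintZ.
- by move=> z _; exact: fourier_weight_le.
Qed.

Lemma test_rapid phi : ctest phi -> rapid phi.
Proof.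
move=> tphi; have [r r0 pr] := test_supp tphi; split; first by case: tphi.
move=> s k; have [B B0 hB] := ctest_bounded s tphi; exists ((1 + r) ^+ k * B) => x.
have [xr|xr] := pselect (cube n r x).
  rewrite ler_pM ?exprn_ge0 ?cabs_ge0 ?addr_ge0// lerXn2r// ?nnegrE ?addr_ge0// lerD2l.
  exact/cube_norm.
have h1 : supp_in r (Re \o phi) by move=> y /pr /= ->.
have h2 : supp_in r (Im \o phi) by move=> y /pr /= ->.
have -> : cpartial s phi x = 0.
  by apply: complex_ext; [exact: (partial_supp s h1)|exact: (partial_supp s h2)].
by rewrite cabs0 mulr0 mulr_ge0// exprn_ge0// addr_ge0.
Qed.

(** Real and imaginary parts of a Fourier transform are combinations of these integrals with phases
    $0$ and $-\pi/2$. With a free phase the family is closed under differentiation, a derivative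
    bringing in a coordinate factor and a phase $\pi/2$. *)
Definition cos_transform (g : V -> R) (c : R) (y : V) : R :=
  \int[mu]_x (g x * cos (tp * dotr x y + c)).

Let cos_kernel (g : V -> R) c (y : V) (x : V) : R := g x * cos (tp * dotr x y + c).

Lemma rtest_rint (g : V -> R) : rtest g -> rint mu g.
Proof.
move=> tg; have [B B0 hB] := rtest_bounded [::] tg; have [sg [k gk]] := tg.
apply: (@rint_bounded_supp R n g B k) => //.
exact: (continuous_measurable_row (smooth_cont sg)).
Qed.

Lemma smooth_coord j : real_smooth (fun x : V => x ord0 j).
Proof.
have Sm_cst k (c : R) : Sm k (fun=> c).
  elim: k c => [|k IH] c; split; try exact: cst_continuous; try by [].
  by exists (fun=> 0); split => // t; exact: is_derive_cst.
have Sm_id k : Sm k (@id R).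
  case: k => [|k]; split; try (by move=> x; exact: cvg_id); try by [].
  by exists (fun=> 1); split => // t; exact: is_derive_id.
have := smooth_coord1 1 0 j Sm_id; congr real_smooth.
by apply/funext => x; rewrite mul1r addr0.
Qed.

Lemma rtest_moment (g : V -> R) (s : seq 'I_n) : rtest g ->
  rtest (fun x => g x * \prod_(j <- s) (tp * x ord0 j)).
Proof.
move=> tg; elim: s => [|j s IH].
  by move: tg; congr rtest; apply/funext => x; rewrite big_nil mulr1.
have -> : (fun x => g x * \prod_(i <- j :: s) (tp * x ord0 i)) =
   fun x => (tp * x ord0 j) * (g x * \prod_(i <- s) (tp * x ord0 i)).
  by apply/funext => x; rewrite big_cons mulrCA.
by apply: rtestMl IH; apply: smoothZ; exact: smooth_coord.
Qed.

Let cos_kernel_partial (g : V -> R) c s (x : V) : real_smooth (fun y => cos_kernel g c y x) /\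
  forall y, partial s (fun y => cos_kernel g c y x) y =
    cos_kernel (fun x => g x * \prod_(j <- s) (tp * x ord0 j)) (c + pi / 2 * (size s)%:R) y x.
Proof.
split; first by apply: smoothZ; exact: smooth_cos_dotr.
move=> y; rewrite partialZ; last exact: smooth_cos_dotr.
by rewrite partial_cos_dotr mulrA.
Qed.

Let cos_kernel_meas (g : V -> R) c y : rtest g -> measurable_fun setT (fun x => cos_kernel g c y x).
Proof.
move=> tg; apply: measurable_funM; first exact: rint_meas (rtest_rint tg).
apply: (measurableT_comp (@measurable_cos R)); apply: measurable_funD => //.
exact: measurable_dotrl.
Qed.

Lemma cos_transform_partial (g : V -> R) c : rtest g -> real_smooth (cos_transform g c) /\
  forall s y, partial s (cos_transform g c) y =
    cos_transform (fun x => g x * \prod_(j <- s) (tp * x ord0 j)) (c + pi / 2 * (size s)%:R) y.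
Proof.
move=> tg; pose F y x := cos_kernel g c y x.
pose G (s : seq 'I_n) x := `|g x * \prod_(j <- s) (tp * x ord0 j)|.
have sF x : real_smooth (F ^~ x) by have [] := cos_kernel_partial g c [::] x.
have pF s x y := (cos_kernel_partial g c s x).2 y.
have mF s y : measurable_fun setT (fun x => partial s (F ^~ x) y).
  by under eq_fun do rewrite pF; apply: cos_kernel_meas; exact: rtest_moment.
have iG s : rint mu (G s) by apply: integrable_norm; apply: rtest_rint; exact: rtest_moment.
have FG s y x : `|partial s (F ^~ x) y| <= G s x.
  rewrite pF /cos_kernel normrM ler_piMr//.
  by rewrite ler_norml cos_geN1 cos_le1.
split; first exact: (smooth_integral sF mF iG FG).
move=> s y; rewrite (partial_integralE sF mF iG FG).
by apply: eq_Rintegral => x _; rewrite pF.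
Qed.

Lemma cos_transform_decay (g : V -> R) c k : rtest g ->
  exists C, forall y, (1 + `|y|) ^+ k * `|cos_transform g c y| <= C.
Proof.
move=> tg; have tgc : ctest (fun x => (g x)%:C%C).
  have [_ t0] := test_rtest (@ctest0 R n).
  by apply: rtest_test; [exact: tg|exact: t0].
have [C hC] := fourier_decay k (test_rapid tgc); exists C => y.
apply: le_trans (hC y); rewrite ler_wpM2l ?exprn_ge0//.
have ig := ctest_cint tgc.
have -> : cos_transform g c y = Re (cis (- c) * fourier (fun x => (g x)%:C%C) y).
  rewrite fourierE -CintZ; last exact: cint_cisN.
  rewrite /cos_transform /Cint; apply: eq_Rintegral => x _.
  transitivity (Re (cis (- c) * ((g x)%:C%C * cis (- (tp * dotr x y))))) => //.
  rewrite mulrCA -cisD -opprD [c + _]addrC ReM.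
  by rewrite /= mul0r subr0 cosN.
by rewrite (le_trans (Re_le_cabs _))// cabsM cabs_cis mul1r.
Qed.

Lemma fourier_test_rapid phi : ctest phi -> rapid (fourier phi).
Proof.
move=> tphi; have [t1 t2] := test_rtest tphi.
have iphi := ctest_cint tphi.
have cosB_pihalf (t : R) : cos (t - pi / 2) = sin t.
  by rewrite cosB cos_pihalf sin_pihalf mulr0 mulr1 add0r.
have icos (g : V -> R) c y : rtest g -> rint mu (fun x => g x * cos (tp * dotr x y + c)).
  move=> tg; apply: (@rint_le _ _ _ _ _ (fun x => `|g x|)).
  - exact: cos_kernel_meas.
  - by apply: integrable_norm; exact: rtest_rint.
  - by move=> x; rewrite normrM ler_piMr// ler_norml cos_geN1 cos_le1.
have RE : Re \o fourier phi = fun y => cos_transform (Re \o phi) 0 y + cos_transform (Im \o phi) (- (pi / 2)) y.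
  apply/funext => y; rewrite /cos_transform -RintegralD//; last 2 first.
  - exact: icos.
  - exact: icos.
  apply: eq_Rintegral => x _; rewrite /= ReM /= addr0 cosB_pihalf; ring.
have IE : Im \o fourier phi = fun y => cos_transform (Im \o phi) 0 y + (-1) * cos_transform (Re \o phi) (- (pi / 2)) y.
  apply/funext => y; rewrite /cos_transform -RintegralZl//; last exact: icos.
  rewrite -RintegralD//; last 2 first.
  - exact: icos.
  - by apply: rintZ; exact: icos.
  apply: eq_Rintegral => x _; rewrite /= ImM /= addr0 cosB_pihalf; ring.
have [s1 p1] := cos_transform_partial 0 t1; have [s2 p2] := cos_transform_partial 0 t2.
have [s3 p3] := cos_transform_partial (- (pi / 2)) t1; have [s4 p4] := cos_transform_partial (- (pi / 2)) t2.
split.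
  split; first by rewrite RE; exact: smoothD.
  by rewrite IE; apply: smoothD => //; exact: smoothZ.
move=> s k.
have [C1 h1] := cos_transform_decay (0 + pi / 2 * (size s)%:R) k (rtest_moment s t1).
have [C2 h2] := cos_transform_decay (0 + pi / 2 * (size s)%:R) k (rtest_moment s t2).
have [C3 h3] := cos_transform_decay (- (pi / 2) + pi / 2 * (size s)%:R) k (rtest_moment s t1).
have [C4 h4] := cos_transform_decay (- (pi / 2) + pi / 2 * (size s)%:R) k (rtest_moment s t2).
exists ((C1 + C4) + (C2 + C3)) => y.
have w0 : 0 <= (1 + `|y|) ^+ k by exact: exprn_ge0.
apply: (le_trans (ler_wpM2l w0 (cabs_le_ReIm _))); rewrite mulrDr /cpartial /= RE IE.
rewrite partialD// partialD//; last exact: smoothZ.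
rewrite partialZ// p1 p2 p3 p4; apply: lerD.
  apply: (le_trans (ler_wpM2l w0 (ler_normD _ _))); rewrite mulrDr; exact: lerD.
apply: (le_trans (ler_wpM2l w0 (ler_normD _ _))); rewrite mulrDr mulN1r normrN; exact: lerD.
Qed.

End schwartz_rapid.

(** * A bump function with positive mass and energy *)

Section approximate_units.
Context {R : realType} (n : nat).
Local Notation V := 'rV[R]_n.
Local Notation mu := (@lebesgue_row R n).
Local Notation ctest := (test_function (setT : set V)).
Local Notation tp := (2 * pi : R).
Local Notation ofR p := (fun x : V => (p x)%:C%C : R[i]).

Lemma rtest_ctest (g : V -> R) : rtest g -> ctest (ofR g).
Proof.
by move=> tg; have [_ t0] := test_rtest (@ctest0 R n); apply: rtest_test; [exact: tg|exact: t0].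
Qed.

(** If all cubes were null the whole space would be null, and the Poisson kernel could not have
    integral 1. *)
Lemma lebesgue_row_gt0 : exists k : nat, mu (cube n k%:R) != 0.
Proof.
apply: contrapT => /forallNP h.
have : (\int[mu]_x (@poisson R n 1 x)%:E = 0)%E.
  apply: null_set_integral => //; first by apply/measurable_EFinP; exact: rint_meas (@rint_poisson R n 1 ltr01).
  apply: measure_negligible => //; rewrite -(@cube_cover R n); apply: negligible_bigcup => k.
  apply/negligibleP; first exact: measurable_cube.
  by have /negP := h k; rewrite negbK => /eqP.
move=> h0; have := @Rint_poisson R n 1 ltr01; rewrite /Rintegral h0 /= => /eqP.
by rewrite eq_sym oner_eq0.
Qed.

(** The mass normalises approximations of the Dirac mass, and the energy is the value at 0 of the
    autocorrelation. *)
Lemma bump_exists : exists b : V -> R, [/\ rtest b, forall x, 0 <= b x,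
  0 < \int[mu]_x b x & 0 < \int[mu]_x (b x ^+ 2)].
Proof.
have [k hk] := lebesgue_row_gt0.
pose c : V := const_mx k.+1%:R; pose b := box_bump (- c) c 1.
have tb : rtest b by exact: box_bump_rtest.
have b0 x : 0 <= b x by exact: box_bump_ge0.
have bp x : cube n k%:R x -> 0 < b x.
  move=> h; apply: box_bump_gt0 => // i; have := h i; rewrite !mxE ler_norml => /andP[h1 h2].
  by rewrite (lt_le_trans _ h1) ?ltrN2 ?ltr_nat//= (le_lt_trans h2)// ltr_nat.
have H (g : V -> R) : rint mu g -> (forall x, 0 <= g x) -> (forall x, cube n k%:R x -> 0 < g x) ->
    0 < \int[mu]_x g x.
  move=> ig g0 gp; rewrite ltNge; apply/negP => /(rint_eq0_ae ig g0) [N [mN N0 sN]].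
  move/negP: hk; apply; rewrite -measure_le0 -N0 le_measure ?inE//; first exact: measurable_cube.
  by move=> x xk; apply: sN => /= e; have := gp x xk; rewrite e ltxx.
have ib := rtest_rint tb.
have ib2 : rint mu (fun x => b x ^+ 2).
  by have := rtest_rint (rtestMl tb.1 tb); congr rint; apply/funext => x; rewrite expr2.
exists b; split => //; first exact: H.
by apply: H => // [x|x /bp h]; [exact: sqr_ge0|exact: exprn_gt0].
Qed.

End approximate_units.

(** * A bounded symbol for a bounded convolution operator *)

Section spectral_density.
Context {R : realType} (n : nat).
Local Notation V := 'rV[R]_n.
Local Notation mu := (@lebesgue_row R n).
Local Notation ctest := (test_function (setT : set V)).
Local Notation tp := (2 * pi : R).
Local Notation ofR p := (fun x : V => (p x)%:C%C : R[i]).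

Variables (f : (V -> R[i]) -> R[i]) (M : R).
Hypotheses (df : is_distribution f) (M0 : 0 < M).
Hypothesis hM : forall phi, ctest phi ->
  (sqnorm setT (toeplitz f phi) <= (M ^+ 2)%:E * sqnorm setT phi)%E.

Lemma fourierN_cint phi : ctest phi -> cint mu (fun z => fourier phi (- z)).
Proof.
move=> tphi; have := cint_reflect 0 (fourier_rapid_cint (test_rapid tphi)).
by congr cint; apply/funext => z; rewrite sub0r.
Qed.

Lemma autocorrelation_dilate (b : V -> R) (c : R) z : ctest (ofR b) -> 0 < c ->
  cconv (ofR (fun x => b (c *: x))) (ofR (fun x => b (c *: x))) z =
  ((c ^+ n)^-1)%:C%C * cconv (ofR b) (ofR b) (c *: z).
Proof.
move=> tb c0; rewrite /cconv.
have i1 : cint mu (fun x => (b (x - c *: z))%:C%C * (b x)%:C%C).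
  have := cconv_int tb (ctest_cint tb) [::] (c *: z).
  by congr cint; apply/funext => x; rewrite cpartial0.
have c0' : c != 0 by rewrite gt_eqF.
rewrite [in RHS](@Cint_affine R n c 0 c0' _ i1) mulrA -rmorphM gtr0_norm//= mulVf ?expf_neq0//.
by rewrite mul1r; congr Cint; apply/funext => x; rewrite addr0 scalerBr.
Qed.

(** Multiplying $u=f*p$ by a dilated, normalised autocorrelation [A] gives integrable functions
    [g k] that tend to [u] pointwise and have transforms bounded by [M]. A weak-star limit of these
    transforms is the required density. *)
Lemma spectral_density_mollified (p : V -> R) : ctest (ofR p) -> (forall x, 0 <= p x) ->
  (\int[mu]_x (p x)%:E <= 1)%E ->
  exists h : V -> R[i], [/\ cmeas h, forall x, cabs (h x) <= M & forall phi, ctest phi ->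
    Cint mu (fun z => h z * fourier phi (- z)) = Cint mu (fun x => toeplitz f (ofR p) x * phi x)].
Proof.
move=> tpp p0 p1; have [b [tb b0 _ N0]] := @bump_exists R n.
have tbc := rtest_ctest tb; set N := \int[mu]_x (b x ^+ 2) in N0.
pose u := toeplitz f (ofR p); pose A := cconv (ofR b) (ofR b).
pose t k : R := k.+1%:R^-1.
have t0 k : 0 < t k by rewrite invr_gt0.
have tA : ctest A by have [r _ br] := test_supp tbc; apply: cconv_test br => //; exact: ctest_cint.
have [sA _ _] := tA.
pose g k x := u x * ((N^-1)%:C%C * A (t k *: x)).
have tAk k : ctest (fun x => (N^-1)%:C%C * A (t k *: x)).
  apply: ctestZ; have t0' : t k != 0 by rewrite gt_eqF.
  by have := ctest_affine 0 t0' tA; congr test_function; apply/funext => x; rewrite addr0.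
have ig k : cint mu (g k).
  by have [r _ sr] := test_supp (tAk k); apply: (toeplitz_cint df tpp _ sr); exact: ctest_cint.
have AE0 : A 0 = N%:C%C.
  rewrite /A /cconv -Cint_real; congr Cint; apply/funext => x.
  by rewrite subr0 -rmorphM expr2.
(* Dilating [b] by [t k] multiplies both its autocorrelation, up to the dilation of the argument,
   and its energy by $t_k^{-n}$. These powers cancel in [toeplitz_fourier_bound], leaving exactly
   [M]. *)
have hbd k xi : cabs (fourier (g k) xi) <= M.
  pose bk x := b (t k *: x).
  have tbk : ctest (ofR bk).
    apply: rtest_ctest; have t0' : t k != 0 by rewrite gt_eqF.
    by have := rtest_affine 0 t0' tb; congr rtest; apply/funext => x; rewrite addr0.
  have H := toeplitz_fourier_bound df M0 hM tpp p0 p1 tbk xi.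
  have NE : \int[mu]_x (bk x ^+ 2) = (t k ^+ n)^-1 * N.
    have ib2 : rint mu (fun x => b x ^+ 2).
      by have := rtest_rint (rtestMl tb.1 tb); congr rint; apply/funext => x; rewrite expr2.
    have t0' : t k != 0 by rewrite gt_eqF.
    rewrite /N (@Rintegral_affine R n (t k) 0 t0' _ ib2) gtr0_norm// mulrA mulVf ?expf_neq0//.
    by rewrite mul1r; apply: eq_Rintegral => x _; rewrite addr0.
  have E : (fun w => u w * cconv (ofR bk) (ofR bk) w) =
      fun w => (((t k ^+ n)^-1 * N)%:C%C) * g k w.
    apply/funext => w; rewrite autocorrelation_dilate// /g -/A.
    have <- : ((t k ^+ n)^-1 * N)%:C%C * (N^-1)%:C%C = ((t k ^+ n)^-1)%:C%C :> R[i].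
      by rewrite -rmorphM/= mulfK// gt_eqF.
    by ring.
  move: H; rewrite -/u E fourierE.
  rewrite (_ : (fun x => _) = fun x => ((t k ^+ n)^-1 * N)%:C%C * (g k x * cis (- (tp * dotr x xi)))).
    rewrite CintZ; last exact: cint_cisN.
    have c0 : 0 < (t k ^+ n)^-1 * N by rewrite mulr_gt0// invr_gt0 exprn_gt0.
    rewrite -fourierE cabsM cabs_real gtr0_norm// NE [M * _]mulrC.
    by rewrite ler_pM2l.
  by apply/funext => x; rewrite mulrA.
have [h [mh hb hw]] := weak_star (ltW M0) (fun k => fourier_meas (ig k)) hbd.
exists h; split => // phi tphi; apply: hw; first exact: fourierN_cint.
have iup : cint mu (fun x => u x * phi x).
  by have [r _ sr] := test_supp tphi; apply: (toeplitz_cint df tpp _ sr); exact: ctest_cint.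
have [B B0 hB] := ctest_bounded0 tA.
(* The multiplication formula moves the transform from [g k] to the reflected transform of [phi],
   which inversion turns back into [phi]. The limit is then found in physical space by dominated
   convergence. *)
apply: (@ccvg_near _ _ _ (fun k => Cint mu (fun x => g k x * phi x))).
  move=> k; rewrite multiplication_formula//; last exact: fourierN_cint.
  by congr Cint; apply/funext => x; rewrite fourierN_fourier//; exact: test_rapid.
apply: (@cdominated _ _ _ _ _ _ (fun x => N^-1 * B * cabs (u x * phi x))).
- move=> k; apply: cmeasM; first exact: cint_meas (ig k).
  exact: cint_meas (ctest_cint tphi).
- exact: cint_meas iup.
- move=> x; rewrite -[X in ccvg _ _ X]mulr1.
  have -> : 1 = (N^-1)%:C%C * A 0 :> R[i] by rewrite AE0 -rmorphM mulVf// gt_eqF.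
  apply: (@ccvg_near _ _ _ (fun k => (u x * phi x) * ((N^-1)%:C%C * A (0 - t k *: (- x))))).
    by move=> k; rewrite sub0r scalerN opprK /g; ring.
  apply: ccvgM; first exact: ccvg_cst.
  by apply: ccvgM; [exact: ccvg_cst|exact: smooth_line_cvg].
- by apply: rintZ; exact: cint_cabs.
move=> k x; have -> : g k x * phi x = (N^-1)%:C%C * A (t k *: x) * (u x * phi x) by rewrite /g; ring.
rewrite [leLHS]cabsM ler_wpM2r ?cabs_ge0// cabsM cabs_real gtr0_norm ?invr_gt0//.
by rewrite ler_wpM2l// invr_ge0 ltW.
Qed.

(** The densities of $f*p_k$ for an approximate unit $p_k$ are all bounded by [M]. They have a
    weak-star limit, and $\int(f*p_k)\varphi$ tends to $f(\varphi)$ by [dist_local] at the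
    origin. *)
Theorem spectral_density : exists h : V -> R[i], [/\ cmeas h, forall x, cabs (h x) <= M &
  forall phi, ctest phi -> f phi = Cint mu (fun z => h z * fourier phi (- z))].
Proof.
have [b [tb b0 I0 _]] := @bump_exists R n.
have [r r0 br] := test_supp (rtest_ctest tb); set I := \int[mu]_x b x in I0.
(* As [b] vanishes outside the cube of radius [r], this dilation puts the support of [p k] within
   distance $1/(k+1)$ of 0. *)
pose c k : R := (r + 1) * k.+1%:R.
have c0 k : 0 < c k by rewrite mulr_gt0// ltr_wpDl.
pose p k x := c k ^+ n / I * b (c k *: x).
have pE k : p k = fun x => c k ^+ n / I * b (c k *: x) by [].
have tp' k : rtest (p k).
  apply: rtestMl; first exact: smooth_cst.
  have c0' : c k != 0 by rewrite gt_eqF.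
  by have := rtest_affine 0 c0' tb; congr rtest; apply/funext => x; rewrite addr0.
have p0 k x : 0 <= p k x by rewrite mulr_ge0// divr_ge0 ?exprn_ge0// ltW.
have p1 k : \int[mu]_x p k x = 1.
  have c0' : c k != 0 by rewrite gt_eqF.
  have ibc : rint mu (fun x => b (c k *: x)).
    by have := rint_affine 0 c0' (rtest_rint tb); congr rint; apply/funext => x; rewrite addr0.
  rewrite RintegralZl//.
  have := @Rintegral_affine R n (c k) 0 c0' _ (rtest_rint tb).
  rewrite gtr0_norm// -/I; under eq_Rintegral do rewrite addr0.
  by move=> E; rewrite mulrAC -E mulfV// gt_eqF.
have p1e k : (\int[mu]_x (p k x)%:E <= 1)%E.
  rewrite -(fineK (integrable_fin_num measurableT (rtest_rint (tp' k)))).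
  by rewrite -/(Rintegral _ _ _) p1.
have psupp k x : k.+1%:R^-1 < `|x| -> p k x = 0.
  move=> xk; rewrite /p; have -> : b (c k *: x) = 0; last by rewrite mulr0.
  have : (b (c k *: x))%:C%C = 0 :> R[i]; last by move=> /(congr1 Re).
  apply: br => /cube_norm -/(_ r0); rewrite normrZ gtr0_norm// leNgt => /negP; apply.
  have : 1 < k.+1%:R * `|x| by rewrite mulrC -ltr_pdivrMr// mul1r.
  by rewrite /c -mulrA; nra.
have [h_ hh] := choice (fun k => spectral_density_mollified (rtest_ctest (tp' k)) (p0 k) (p1e k)).
have [h [mh hb hw]] := weak_star (ltW M0) (fun k => let: And3 a _ _ := hh k in a)
  (fun k => let: And3 _ a _ := hh k in a).
exists h; split => // phi tphi; apply/esym; apply: hw; first exact: fourierN_cint.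
have ip k : cint mu (ofR (p k)) by apply: ctest_cint; exact: rtest_ctest.
pose a x := phi (0 - x); have ta : ctest a by exact: ctest_reflect.
have [r' _ sphi] := test_supp tphi.
have [C C0 hC] := dist_local df ta 0.
(* The integral of $(f*p_k)\varphi$ is [f] of a correlation. A reflection and a translation exchange
   the roles of [p k] and [phi], so that the small support lies in the second argument, as
   [dist_local] requires. *)
apply: (@ccvg_near _ _ _ (fun k => f (cconv a (fun x => (p k (0 - x))%:C%C)))).
  move=> k; have [_ _ ->//] := hh k.
  rewrite (toeplitz_interchange df (rtest_ctest (tp' k)) (ctest_cint tphi) sphi); congr f.
  apply/funext => y; rewrite /cconv.
  have i1 : cint mu (fun x => (p k x)%:C%C * phi (x + y)).
    have [B _ hB] := ctest_bounded0 tphi.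
    have ms := cint_meas (cint_shift y (ctest_cint tphi)).
    exact: (cintM (ip k) ms (fun x => hB (x + y))).
  transitivity (Cint mu (fun x => (p k x)%:C%C * phi (x + y))).
    rewrite -(Cint_reflect 0 i1); congr Cint; apply/funext => x.
    by rewrite mulrC /a; congr (_ * phi _); rewrite !sub0r opprB addrC.
  rewrite -(Cint_shift (- y) i1); congr Cint; apply/funext => x.
  by rewrite subrK.
apply: (@ccvg_squeeze _ _ _ _ _ _ (fun k => C * k.+1%:R^-1)); last first.
  by rewrite -[X in _ --> X](mulr0 C); apply: cvgM; [exact: cvg_cst|exact: cvg_harmonic].
move=> k.
have ib : cint mu (fun x => (p k (0 - x))%:C%C) by exact: (cint_reflect 0 (ip k)).
have x00 : cube n 0 (0 : V) by move=> i; rewrite mxE normr0.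
have d01 : 0 <= (k.+1%:R^-1 : R) <= 1 by rewrite invr_ge0 ler0n/= invf_le1// ler1n.
have := hC 0 x00 _ d01 _ ib _.
have -> : Cint mu (fun x => (p k (0 - x))%:C%C) = 1.
  by rewrite (Cint_reflect 0 (ip k)) Cint_real p1.
have -> : \int[mu]_x cabs (p k (0 - x))%:C%C = 1.
  have H := Cint_reflect 0 (ip k); rewrite !Cint_real p1 in H.
  have E : \int[mu]_x p k (0 - x) = 1 := congr1 (@complex.Re R) H.
  rewrite -[RHS]E; by apply: eq_Rintegral => x _; rewrite cabs_real ger0_norm.
rewrite mulr1 mul1r /toeplitz /a (_ : (fun y => phi (0 - (0 - y))) = phi); last first.
  by apply/funext => y; rewrite !sub0r opprK.
apply => x; rewrite subr0 => hx; rewrite psupp// sub0r normrN//.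
Qed.

End spectral_density.

(** * Functions with vanishing integrals against boxes or test functions *)

Section open_boxes.
Context {R : realType} (n : nat).
Local Notation V := 'rV[R]_n.
Local Notation mu := (@lebesgue_row R n).
Local Notation ctest := (test_function (setT : set V)).
Local Notation ofR p := (fun x : V => (p x)%:C%C : R[i]).

Definition box (a b : V) : set V := [set x | forall i, a ord0 i < x ord0 i < b ord0 i].
Definition boxes : set (set V) := [set A | exists a b, A = box a b].

Lemma boxes_setI : setI_closed boxes.
Proof.
move=> _ _ [a [b ->]] [c [d ->]].
exists (\row_i Num.max (a ord0 i) (c ord0 i)), (\row_i Num.min (b ord0 i) (d ord0 i)).
apply/seteqP; split=> x /=.
  by move=> [h1 h2] i; rewrite !mxE gt_max lt_min; have /andP[-> ->] := h1 i; exact: h2.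
move=> h; split=> i; have := h i; rewrite !mxE gt_max lt_min;
  by move=> /andP[/andP[h1 h2] /andP[h3 h4]]; apply/andP.
Qed.

Lemma measurable_box a b : measurable (box a b).
Proof.
have -> : box a b = [set x | forall i, `]a ord0 i, b ord0 i[%classic (x ord0 i)].
  by apply/seteqP; split=> x /= h i; have := h i; rewrite /= in_itv.
apply: (@measurable_rect R n (fun i => `]a ord0 i, b ord0 i[%classic)) => i.
exact: measurable_itv.
Qed.

Lemma box_cover : \bigcup_k box (const_mx (- k%:R)) (const_mx k%:R) = setT.
Proof.
apply/seteqP; split => // x _.
have [k xk] : exists k : nat, `|x| < k%:R.
  by exists (Num.truncn `|x|).+1; exact: truncnS_gt.
exists k => // i; rewrite !mxE -ltr_norml.
exact: le_lt_trans (coord_le_norm x i) xk.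
Qed.

Lemma measurable_boxes : (measurable : set (set V)) = <<s boxes >>.
Proof.
apply/seteqP; split; last first.
  apply: smallest_sub; first exact: sigma_algebra_measurable.
  by move=> _ [a [b ->]]; exact: measurable_box.
suff mid : measurable_fun (setT : set (g_sigma_algebraType boxes)) (fun x : g_sigma_algebraType boxes => x : V).
  by move=> A mA; have := mid measurableT A mA; rewrite setTI.
apply: measurable_rowP => i.
apply: (measurability (@RGenOInfty.G R) (RGenOInfty.measurableE R)) => _ [_ [c ->] <-]; rewrite setTI.
(* The half-space where coordinate [i] exceeds [c] is the union over [k] of these boxes, so the
   boxes generate the coordinate sigma-algebras. *)
pose a k : V := \row_j if j == i then c else - k%:R.
rewrite (_ : _ @^-1` _ = \bigcup_k box (a k) (const_mx k%:R)).
  apply: bigcup_measurable => k _; apply: sub_sigma_algebra; by exists (a k), (const_mx k%:R).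
apply/seteqP; split => [x|x [k _ /(_ i)]] /=; rewrite in_itv/= andbT; last first.
  by rewrite !mxE eqxx => /andP[].
move=> cx; have : (setT : set V) x by [].
rewrite -box_cover => -[k _ hk]; exists k => // j; have := hk j; rewrite !mxE.
by case: eqP => [->|//] /andP[_ ->]; rewrite cx.
Qed.

(** The measures with densities the positive and the negative part of [g] agree on open boxes. These
    are closed under intersection and generate the sigma-algebra, so the two measures coincide. *)
Lemma box_integral_zero (g : V -> R) : rint mu g ->
  (forall a b, \int[mu]_x (g x * \1_(box a b) x) = 0) -> {ae mu, forall x, g x = 0}.
Proof.
move=> ig hg; pose gp x := Num.max (g x) 0; pose gn x := Num.max (- g x) 0.
have mg := rint_meas ig.
have mp : measurable_fun setT gp by exact: measurable_maxr.
have mn : measurable_fun setT gn by apply: measurable_maxr => //; exact: measurableT_comp.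
have p0 x : 0 <= gp x by rewrite le_max lexx orbT.
have n0 x : 0 <= gn x by rewrite le_max lexx orbT.
have pnE x : (0 <= g x /\ gp x = g x /\ gn x = 0) \/ (g x <= 0 /\ gp x = 0 /\ gn x = - g x).
  have [h|/ltW h] := leP 0 (g x); [left|right]; split => //; split.
  - exact/max_idPl.
  - by apply/max_idPr; rewrite oppr_le0.
  - exact/max_idPr.
  - by apply/max_idPl; rewrite oppr_ge0.
have gE x : g x = gp x - gn x by have [[_ [-> ->]]|[_ [-> ->]]] := pnE x; rewrite ?subr0 ?sub0r ?opprK.
have aE x : `|g x| = gp x + gn x.
  have [[h [-> ->]]|[h [-> ->]]] := pnE x; first by rewrite addr0 ger0_norm.
  by rewrite add0r ler0_norm.
have ip : rint mu gp.
  by apply: (rint_le mp (integrable_norm ig)) => x /=; rewrite aE ger0_norm// lerDl.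
have in_ : rint mu gn.
  by apply: (rint_le mn (integrable_norm ig)) => x /=; rewrite aE ger0_norm// lerDr.
have iE (h : V -> R) E : rint mu h -> measurable E -> rint mu (fun x => h x * \1_E x).
  move=> ih mE; apply: (@rint_le _ _ _ _ _ (fun x => `|h x|)).
  - by apply: measurable_funM; [exact: rint_meas ih|exact: measurable_indic].
  - exact: integrable_norm ih.
  - by move=> x; rewrite indicE; case: (_ \in _); rewrite ?mulr1 ?mulr0 ?normr0.
have mes (h : V -> R) : measurable_fun setT h -> (forall x, 0 <= h x) ->
    exists m : {measure set V -> \bar R}, forall E, m E = (\int[mu]_(x in E) (h x)%:E)%E.
  move=> mh h0; pose nu E := (\int[mu]_(x in E) (h x)%:E)%E.
  have nu0 : nu set0 = 0%E by exact: integral_set0.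
  have nuge0 E : (0 <= nu E)%E by apply: integral_ge0 => x _; rewrite lee_fin.
  have nus : semi_sigma_additive nu.
    apply: semi_sigma_additive_nng_induced; first exact/measurable_EFinP.
    by move=> x; rewrite lee_fin.
  pose m : {measure set V -> \bar R} := HB.pack nu (isMeasure.Build _ _ _ nu nu0 nuge0 nus).
  by exists m.
have [m1 m1E] := mes _ mp p0; have [m2 m2E] := mes _ mn n0.
have intE (h : V -> R) E : rint mu h -> measurable E ->
    (\int[mu]_(x in E) (h x)%:E = (\int[mu]_x (h x * \1_E x))%:E)%E.
  move=> ih mE; rewrite /Rintegral fineK; last exact: (integrable_fin_num measurableT (iE _ _ ih mE)).
  rewrite [LHS]integral_mkcond; apply: eq_integral => x _; rewrite patchE indicE.
  by case: ifP => _; rewrite ?mulr1 ?mulr0.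
have eq12 : forall E, measurable E -> m1 E = m2 E.
  apply: (measure_unique boxes (fun k => box (const_mx (- k%:R)) (const_mx k%:R))).
  - exact: measurable_boxes.
  - exact: boxes_setI.
  - by move=> k; exists (const_mx (- k%:R)), (const_mx k%:R).
  - exact: box_cover.
  - move=> _ [a [b ->]]; rewrite m1E m2E !intE//; [|exact: measurable_box|exact: measurable_box].
    congr EFin; apply/eqP; rewrite -subr_eq0 -RintegralB//; [|exact: iE (measurable_box _ _)|exact: iE (measurable_box _ _)].
    rewrite -(hg a b); apply/eqP; apply: eq_Rintegral => x _.
    by rewrite -mulrBl -gE.
  - by move=> k; rewrite m1E intE ?ltry//; exact: measurable_box.
have mP : measurable [set x | 0 < g x].
  have := measurable_fun_ltr (measurable_cst (0 : R)) mg measurableT (Y := [set true]).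
  by rewrite setTI; apply.
(* On the set where [g] is positive the negative part vanishes, so equality of the two measures
   there forces the positive part to have integral 0. Equality on the whole space then does the same
   for the negative part. *)
have e1 : \int[mu]_x gp x = 0.
  have := eq12 _ mP; rewrite m1E m2E !intE// => -[].
  have -> : (fun x => gp x * \1_[set x | 0 < g x] x) = gp.
    apply/funext => x; rewrite indicE; have [h|h] := ltP 0 (g x); first by rewrite mem_set ?mulr1.
    rewrite memNset ?mulr0 /=; last by rewrite ltNge h.
    by apply/esym/max_idPr.
  move=> ->; rewrite (_ : (fun x => gn x * _) = fun=> 0); first by rewrite Rintegral_cst// mul0r.
  apply/funext => x; rewrite indicE; have [h|h] := ltP 0 (g x); last by rewrite memNset ?mulr0//= ltNge h.
  by rewrite /gn (max_idPr _) ?mul0r// oppr_le0 ltW.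
have e2 : \int[mu]_x gn x = 0.
  have := eq12 _ measurableT; rewrite m1E m2E => E12.
  by rewrite -e1 /Rintegral E12.
have : {ae mu, forall x, `|g x| = 0}.
  apply: rint_eq0_ae => //; first exact: integrable_norm.
  under eq_Rintegral do rewrite aE.
  by rewrite RintegralD// e1 e2 addr0.
by apply: filterS => x /normr0_eq0.
Qed.

Lemma beta_cvg1 (t : R) : 0 < t -> beta 0 (k.+1%:R * t) @[k --> \oo] --> (1 : R).
Proof.
move=> t0; apply: (@cvg_dist_le _ _ _ _ _ _ (fun k => t^-1 * k.+1%:R^-1)); last first.
  by rewrite -[X in _ --> X](mulr0 t^-1); apply: cvgM; [exact: cvg_cst|exact: cvg_harmonic].
move=> k; have kt : 0 < k.+1%:R * t by rewrite mulr_gt0.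
rewrite ler0_norm ?subr_le0 ?beta0_le1// opprB lerBlDr addrC -lerBlDr.
rewrite /beta kt expr0 invr1 mul1r invfM.
have := expR_ge1Dx (- (t^-1 * k.+1%:R^-1)).
by rewrite mulrC.
Qed.

Lemma cvg_prod_ord m (F : 'I_m -> nat -> R) (l : 'I_m -> R) :
  (forall i, F i k @[k --> \oo] --> l i) -> \prod_i F i k @[k --> \oo] --> \prod_i l i.
Proof.
elim: m F l => [|m IH] F l h.
  by under eq_fun do rewrite big_ord0; rewrite big_ord0; exact: cvg_cst.
under eq_fun do rewrite big_ord_recl; rewrite big_ord_recl.
by apply: cvgM; [exact: h|apply: IH => i; exact: h].
Qed.

Lemma box_bump_cvg (a b x : V) : box_bump a b k.+1%:R x @[k --> \oo] --> (\1_(box a b) x : R).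
Proof.
have [xb|xb] := pselect (box a b x); last first.
  rewrite indicE memNset//; apply: cvg_near_cst; apply: nearW => k.
  exact: box_bump_out.
rewrite indicE mem_set//= /box_bump.
rewrite [X in _ --> X](_ : _ = \prod_(i < n) (1 * 1)); last by rewrite mulr1 prodr_const expr1n.
apply: (@cvg_prod_ord n (fun i k => beta 0 (k.+1%:R * (x ord0 i - a ord0 i)) *
  beta 0 (k.+1%:R * (b ord0 i - x ord0 i))) (fun=> 1 * 1)) => i.
have /andP[h1 h2] := xb i.
by apply: cvgM; apply: beta_cvg1; rewrite subr_gt0.
Qed.

(** Indicators of boxes are bounded pointwise limits of the test functions [box_bump], so dominated
    convergence reduces the claim to [box_integral_zero]. *)
Lemma test_integral_zero (kap : V -> R[i]) : cint mu kap ->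
  (forall eta, ctest eta -> Cint mu (fun x => kap x * eta x) = 0) ->
  {ae mu, forall x, kap x = 0}.
Proof.
move=> ik hk; have [i1 i2] := ik.
have H (g : V -> R) : rint mu g ->
    (forall b : V -> R, rtest b -> \int[mu]_x (g x * b x) = 0) -> {ae mu, forall x, g x = 0}.
  move=> ig hg; apply: box_integral_zero => // a b.
  have c : \int[mu]_x (g x * box_bump a b k.+1%:R x) @[k --> \oo] --> \int[mu]_x (g x * \1_(box a b) x).
    apply: (@rdominated _ _ _ mu _ _ (fun x => `|g x|)).
    - move=> k; apply: measurable_funM; first exact: rint_meas ig.
      exact: continuous_measurable_row (smooth_cont (box_bump_smooth _ _ _)).
    - apply: measurable_funM; first exact: rint_meas ig.
      by apply: measurable_indic; exact: measurable_box.
    - by move=> x; apply: cvgM; [exact: cvg_cst|exact: box_bump_cvg].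
    - exact: integrable_norm ig.
    - move=> k x; rewrite normrM ler_piMr// ger0_norm ?box_bump_ge0//.
      exact: box_bump_le1.
  have E k : \int[mu]_x (g x * box_bump a b k.+1%:R x) = 0 by apply: hg; exact: box_bump_rtest.
  by rewrite -(cvg_lim _ c)// (funext E) lim_cst.
have hr (b : V -> R) : rtest b -> Cint mu (fun x => kap x * (b x)%:C%C) = 0.
  by move=> tb; apply: hk; exact: rtest_ctest.
have z1 := H _ i1 _; have z2 := H _ i2 _.
have : {ae mu, forall x, Re (kap x) = 0}.
  apply: z1 => b /hr/(congr1 (@complex.Re R)) h; rewrite -[RHS]h.
  by apply: eq_Rintegral => x _ /=; rewrite ReM /= mulr0 subr0.
have : {ae mu, forall x, Im (kap x) = 0}.
  apply: z2 => b /hr/(congr1 (@complex.Im R)) h; rewrite -[RHS]h.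
  by apply: eq_Rintegral => x _ /=; rewrite ImM /= mulr0 add0r.
apply: filterS2 => x h1 h2; exact: complex_ext.
Qed.

End open_boxes.

(** * Uniqueness of the symbol *)

Section spectral_uniqueness.
Context {R : realType} (n : nat).
Local Notation V := 'rV[R]_n.
Local Notation mu := (@lebesgue_row R n).
Local Notation ctest := (test_function (setT : set V)).
Local Notation tp := (2 * pi : R).
Local Notation ofR p := (fun x : V => (p x)%:C%C : R[i]).

Lemma fourier_translate (phi : V -> R[i]) (a w : V) : cint mu phi ->
  fourier (fun x => phi (x + a)) w = cis (tp * dotr a w) * fourier phi w.
Proof.
move=> ip; rewrite !fourierE -CintZ; last exact: cint_cisN.
rewrite -(Cint_shift a (cintZ _ (cint_cisN w ip))); congr Cint; apply/funext => x.
rewrite mulrCA -cisD; congr (_ * cis _); rewrite dotrDl; ring.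
Qed.

Lemma fourier_reflect (phi : V -> R[i]) (a w : V) : cint mu phi ->
  fourier (fun x => phi (a - x)) w = cis (- (tp * dotr a w)) * fourier phi (- w).
Proof.
move=> ip; rewrite !fourierE -CintZ; last exact: cint_cisN.
rewrite -(Cint_reflect a (cintZ _ (cint_cisN (- w) ip))); congr Cint; apply/funext => x.
rewrite mulrCA -cisD; congr (_ * cis _); rewrite dotrNr dotrBl; ring.
Qed.

Lemma fourier_dilate (phi : V -> R[i]) (c : R) (w : V) : 0 < c -> cint mu phi ->
  fourier (fun x => phi (c *: x)) w = ((c ^+ n)^-1)%:C%C * fourier phi (c^-1 *: w).
Proof.
move=> c0 ip; have c0' : c != 0 by rewrite gt_eqF.
rewrite !fourierE [in RHS](@Cint_affine R n c 0 c0' _ (cint_cisN _ ip)).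
rewrite mulrA -rmorphM gtr0_norm//= mulVf ?expf_neq0// mul1r; congr Cint; apply/funext => x.
rewrite addr0; congr (_ * cis (- (tp * _))).
have dZ (u v : V) (t : R) : dotr u (t *: v) = t * dotr u v.
  by rewrite /dotr mulr_sumr; apply: eq_bigr => i _; rewrite mxE mulrCA.
by rewrite dZ [dotr (c *: x) _]dotrC dZ mulrA mulVf// mul1r dotrC.
Qed.

Variables (k : V -> R[i]) (B : R).
Hypotheses (mk : cmeas k) (kB : forall x, cabs (k x) <= B).
Hypothesis k0 : forall phi, ctest phi -> Cint mu (fun z => k z * fourier phi (- z)) = 0.

(** Applying the hypothesis to the translates of [phi] says that this integrable product has zero
    Fourier transform. Every test function is itself a Fourier transform, so the multiplication
    formula shows that the product annihilates all of them. *)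
Lemma spectral_product_zero phi : ctest phi -> {ae mu, forall z, k z * fourier phi (- z) = 0}.
Proof.
move=> tphi; have iF := fourierN_cint tphi.
have ik : cint mu (fun z => k z * fourier phi (- z)).
  by have := cintM iF mk kB; congr cint; apply/funext => z; rewrite mulrC.
have F0 a : fourier (fun z => k z * fourier phi (- z)) a = 0.
  rewrite fourierE -(k0 (ctest_shift a tphi)); congr Cint; apply/funext => z.
  rewrite fourier_translate; last exact: ctest_cint.
  by rewrite dotrNr mulrN dotrC -mulrA [fourier _ _ * _]mulrC.
apply: test_integral_zero => // eta teta.
rewrite (_ : (fun x => _) = fun x => k x * fourier phi (- x) * fourier (fun z => fourier eta (- z)) x).
  rewrite -multiplication_formula//; last exact: fourierN_cint.
  rewrite (_ : (fun z => _) = fun=> 0); first by rewrite (Cint_real mu (fun=> 0)) Rintegral_cst// mul0r.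
  by apply/funext => z; rewrite F0 mul0r.
by apply/funext => x; rewrite fourierN_fourier//; exact: test_rapid.
Qed.

(** The transform of a bump of positive mass is nonzero near the origin. Dilating the bump makes it
    nonzero on any given ball, where the vanishing product forces [k] to vanish almost
    everywhere. *)
Lemma spectral_zero : {ae mu, forall x, k x = 0}.
Proof.
have [b [tb b0 I0 _]] := @bump_exists R n; have tbc := rtest_ctest tb.
have [delta d0 hd] : exists2 delta : R, 0 < delta & forall y, `|y| <= delta -> fourier (ofR b) y != 0.
  have [[/smooth_cont c _] _] := fourier_test_rapid tbc.
  have F0 : Re (fourier (ofR b) 0) = \int[mu]_x b x.
    rewrite fourierE (_ : (fun x => _) = ofR b); first by rewrite Cint_real.
    apply/funext => x; have -> : dotr x 0 = 0 by rewrite /dotr big1// => i _; rewrite mxE mulr0.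
    by rewrite mulr0 oppr0 cis0 mulr1.
  have /(@cvgrPdist_lt _ _ _ _ (nbhs_filter (0 : V))) /(_ _ I0) := c 0.
  move=> /nbhs_ballP[e /= e0 he]; exists (e / 2); first by rewrite divr_gt0.
  move=> y ye; have : ball (0 : V) e y.
    rewrite mx_norm_ball /ball_ /= sub0r normrN (le_lt_trans ye)// ltr_pdivrMr// mulr_natr.
    by rewrite mulr2n ltrDl.
  move=> /he h; apply/eqP => E.
  have h' : `|Re (fourier (ofR b) 0) - Re (fourier (ofR b) y)| < \int[mu]_x b x := h.
  by move: h'; rewrite E F0 subr0 (ger0_norm (ltW I0)) ltxx.
have H N : {ae mu, forall x, `|x| <= N.+1%:R -> k x = 0}.
  (* The transform of $b(cx)$ at $w$ is a positive multiple of $\hat b(w/c)$, and $|w|\le N+1$ gives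
     $|w/c|\le\delta$. *)
  pose c := N.+1%:R / delta; have c0 : 0 < c by rewrite divr_gt0.
  have tc : ctest (fun x => (b (c *: x))%:C%C).
    have := @ctest_affine R n c 0 _ (lt0r_neq0 c0) tbc.
    by congr test_function; apply/funext => x; rewrite addr0.
  have := spectral_product_zero tc; apply: filterS => x + xN => /eqP.
  rewrite (fourier_dilate _ c0 (ctest_cint tbc)) !mulf_eq0 => /orP[/eqP//|/orP[|]].
    move=> /eqP/(congr1 (@complex.Re R)) /= /eqP; rewrite invr_eq0 expf_eq0 (gt_eqF c0).
    by rewrite andbF.
  move=> /negPn; rewrite hd// normrZ normrN gtr0_norm ?invr_gt0// mulrC ler_pdivrMr//.
  by rewrite /c mulrC divfK// gt_eqF.
have : {ae mu, forall x, forall N : nat, `|x| <= N.+1%:R -> k x = 0} by exact: ae_foralln.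
apply: filterS => x h; apply: (h (Num.truncn `|x|)); exact/ltW/truncnS_gt.
Qed.

End spectral_uniqueness.

(** * Symbols: operator bounds, uniqueness and tempered extension *)

Section toeplitz_symbol.
Context {R : realType} (n : nat).
Local Notation V := 'rV[R]_n.
Local Notation mu := (@lebesgue_row R n).
Local Notation ctest := (test_function (setT : set V)).
Local Notation tp := (2 * pi : R).

(** The identity $\hat f=h$ tested on compactly supported functions: the reflected transform is the
    inverse Fourier transform, so no extension of [f] to Schwartz functions is involved. *)
Definition symbol_of (f : (V -> R[i]) -> R[i]) (h : V -> R[i]) :=
  forall phi, ctest phi -> f phi = Cint mu (fun z => h z * fourier phi (- z)).

Lemma rapid_reflect (phi : V -> R[i]) : rapid phi -> rapid (fun z => phi (- z)).
Proof.
have -> : (fun z => phi (- z)) = fun z => phi (0 - z) by apply/funext => z; rewrite sub0r.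
move=> [sp hp]; split.
  have := csmooth_affine (-1) 0 sp; congr smooth; apply/funext => z.
  by rewrite scaleN1r addrC.
move=> s k; have [C hC] := hp s k; exists C => x; rewrite cpartial_reflect// cabsM cabs_signr mul1r.
by have := hC (0 - x); rewrite sub0r normrN.
Qed.

Lemma Linfty_normP (h : V -> R[i]) (K : R) : 0 <= K ->
  (Linfty_norm h <= K%:E)%E <-> {ae mu, forall x, cabs (h x) <= K}.
Proof.
(* At exponent infinity [Lnorm] is the essential supremum only on a space of positive measure. *)
move=> K0; have muT : (0 < mu setT)%E.
  have [k hk] := @lebesgue_row_gt0 R n.
  apply: (@lt_le_trans _ _ (mu (cube n k%:R))); first by rewrite lt_neqAle eq_sym hk measure_ge0.
  by rewrite le_measure ?inE//; exact: measurable_cube.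
rewrite /Linfty_norm unlock muT; split=> [/ess_supP|] H.
  by apply: filterS H => x /=; rewrite ger0_norm ?cabs_ge0// lee_fin.
by apply/ess_supP; apply: filterS H => x; rewrite /= ger0_norm ?cabs_ge0// lee_fin.
Qed.

(** The hypothesis is tested on the reflected transform of [phi], a Schwartz function whose Fourier
    transform is [phi]. *)
Lemma tempered_symbol f T (h : V -> R[i]) : tempered_extension f T ->
  given_by (fourier_tempered T) h -> symbol_of f h.
Proof.
move=> [_ fT] hh phi tphi; have rF := rapid_reflect (fourier_test_rapid tphi).
rewrite -fT//; have := hh _ ((schwartzP _).2 rF); rewrite /fourier_tempered /= => H.
rewrite -[RHS]H; congr T; apply/funext => x.
by rewrite fourierN_fourier//; exact: test_rapid.
Qed.

(** Changing [h] on a null set makes the bound hold at every point, the form used by the integral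
    estimates. *)
Lemma symbol_bounded f (h : V -> R[i]) (K : R) : cmeas h -> 0 <= K -> symbol_of f h ->
  {ae mu, forall x, cabs (h x) <= K} ->
  exists h', [/\ cmeas h', forall x, cabs (h' x) <= K, symbol_of f h' &
    {ae mu, forall x, h x = h' x}].
Proof.
move=> mh K0 fh hK; pose h' x := if cabs (h x) <= K then h x else 0.
have hh' : {ae mu, forall x, h x = h' x} by apply: filterS hK => x hx; rewrite /h' hx.
have mh' : cmeas h'.
  pose E := [set x | cabs (h x) <= K].
  have -> : h' = fun x => h x * (\1_E x)%:C%C.
    apply/funext => x; rewrite /h' indicE; case: ifPn => hx; first by rewrite mem_set ?mulr1.
    by rewrite memNset ?mulr0//; apply/negP.
  apply: cmeasM => //; apply: cmeas_real; apply: measurable_indic.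
  have := measurable_fun_ler (cmeas_cabs mh) (measurable_cst K) measurableT (Y := [set true]).
  by rewrite setTI; apply.
exists h'; split => //.
  by move=> x; rewrite /h'; case: ifP => // _; rewrite cabs0.
move=> phi tphi; rewrite fh//; apply: ae_Cint.
- by apply: cmeasM => //; exact: cint_meas (fourierN_cint tphi).
- by apply: cmeasM => //; exact: cint_meas (fourierN_cint tphi).
by apply: filterS hh' => x ->.
Qed.

Lemma toeplitz_fourier f (h : V -> R[i]) phi x : symbol_of f h -> ctest phi ->
  toeplitz f phi x = fourier (fun z => h z * fourier phi z) (- x).
Proof.
move=> fh tphi; rewrite /toeplitz fh; last exact: ctest_reflect.
rewrite fourierE; congr Cint; apply/funext => z.
rewrite fourier_reflect; last exact: ctest_cint.
by rewrite opprK !dotrNr dotrC [cis _ * _]mulrC mulrA.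
Qed.

(** Plancherel is applied first to $h\hat\varphi$, then, after $|h|\le K$, to [phi] itself. *)
Lemma toeplitz_norm_le (Xi : set V) f (h : V -> R[i]) (K : R) : is_distribution f ->
  measurable Xi -> cmeas h -> 0 <= K -> (forall x, cabs (h x) <= K) -> symbol_of f h ->
  (toeplitz_norm Xi f <= K%:E)%E.
Proof.
move=> df mXi mh K0 hK fh; apply/toeplitz_normP => // phi tXi; have tphi := test_functionT tXi.
have iF := fourier_rapid_cint (test_rapid tphi).
have ihF : cint mu (fun z => h z * fourier phi z).
  by have := cintM iF mh hK; congr cint; apply/funext => z; rewrite mulrC.
apply: (le_trans (sqnorm_sub mXi (toeplitz_meas df tphi))).
have -> : sqnorm setT (toeplitz f phi) =
    (\int[mu]_z (cabs (fourier (fun z => h z * fourier phi z) z) ^+ 2)%:E)%E.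
  have mF := fourier_meas ihF.
  rewrite -(ge0_integral_reflect 0 (cmeas_sqr mF)); last by move=> z; rewrite lee_fin sqr_ge0.
  by apply: eq_integral => x _; rewrite (toeplitz_fourier _ fh)// sub0r.
apply: (le_trans (plancherel_le ihF)).
apply: (@le_trans _ _ ((K ^+ 2)%:E * sqnorm setT (fourier phi))%E).
  rewrite -ge0_integralZl//; last 3 first.
  - by apply: cmeas_sqr; exact: cint_meas iF.
  - by move=> z _; rewrite lee_fin sqr_ge0.
  - by rewrite lee_fin sqr_ge0.
  apply: ge0_le_integral => //.
  - by move=> z _; rewrite lee_fin sqr_ge0.
  - by apply: cmeas_sqr; exact: cint_meas ihF.
  - by apply: emeasurable_funM => //; apply: cmeas_sqr; exact: cint_meas iF.
  move=> z _; rewrite -EFinM lee_fin cabsM exprMn ler_wpM2r ?sqr_ge0//.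
  by rewrite lerXn2r// ?nnegrE ?cabs_ge0.
rewrite lee_wpmul2l ?lee_fin ?sqr_ge0//; apply: (le_trans (plancherel_le (ctest_cint tphi))).
(* The support of [phi] lies in [Xi], so its norm over the whole space is its norm over [Xi]. *)
rewrite /sqnorm [leRHS]integral_mkcond le_eqVlt; apply/orP; left; apply/eqP.
apply: eq_integral => x _; rewrite patchE; case: ifPn => //; rewrite notin_setE => xXi.
suff -> : phi x = 0 by rewrite cabs0 expr0n.
apply: contrapT => /eqP px; apply: xXi; have [_ _] := tXi; apply.
exact: subset_closure.
Qed.

(** [spectral_density] provides some symbol bounded by [M]; its difference with [h] is bounded and
    annihilates all test functions, so [spectral_zero] identifies the two. *)
Lemma symbol_le (Xi : set V) f (h : V -> R[i]) (K M : R) : is_distribution f ->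
  measurable Xi -> [set x : V | forall i, 1 < x ord0 i] `<=` Xi ->
  cmeas h -> (forall x, cabs (h x) <= K) -> symbol_of f h -> 0 < M ->
  (toeplitz_norm Xi f <= M%:E)%E -> {ae mu, forall x, cabs (h x) <= M}.
Proof.
move=> df mXi Xil mh hK fh M0 /(toeplitz_normP df mXi (ltW M0)) fM.
have [g [mg gM fg]] := spectral_density df M0 (sqnorm_toeplitz df mXi Xil fM).
have : {ae mu, forall x, h x - g x = 0}.
  apply: (@spectral_zero R n _ (K + M)); first exact: cmeasB.
    by move=> x; rewrite (le_trans (cabsB _ _))// lerD.
  move=> phi tphi; have iF := fourierN_cint tphi.
  have E (k : V -> R[i]) C : cmeas k -> (forall x, cabs (k x) <= C) ->
      cint mu (fun z => k z * fourier phi (- z)).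
    by move=> mk kC; have := cintM iF mk kC; congr cint; apply/funext => z; rewrite mulrC.
  have := CintB (E _ _ mh hK) (E _ _ mg gM); rewrite -fh// -fg// subrr => H.
  by rewrite -[RHS]H; congr Cint; apply/funext => z; rewrite mulrBl.
by apply: filterS => x /eqP; rewrite subr_eq0 => /eqP ->.
Qed.

(** The supremum of an empty set would be $-\infty$, so a nonzero test function in [Xi] is
    exhibited: a bump on the box $]2,4[^n$, whose closed support keeps all coordinates above 1. *)
Lemma toeplitz_norm_ge0 (Xi : set V) f : measurable Xi ->
  [set x : V | forall i, 1 < x ord0 i] `<=` Xi -> (0 <= toeplitz_norm Xi f)%E.
Proof.
move=> mXi Xil.
pose a : V := const_mx 2; pose b : V := const_mx 4.
pose p x : R[i] := (box_bump a b 1 x)%:C%C.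
have tp' : ctest p by apply: rtest_ctest; exact: box_bump_rtest.
have pXi : test_function Xi p.
  have [s c _] := tp'; split => // x.
  move=> xs; apply: Xil => i /=; rewrite ltNge; apply/negP => xi.
  have [y [/= py]] := xs _ (nbhsx_ballx x 1 ltr01); rewrite mx_norm_ball /ball_ /= => xy.
  move: py; rewrite /p box_bump_out ?eqxx// => /(_ i); rewrite !mxE => /andP[y2 _].
  have := le_lt_trans (coord_le_norm (x - y) i) xy; rewrite !mxE ltr_norml => /andP[h1 h2].
  lra.
have p0 : p <> cst 0.
  move=> /(congr1 (fun q => q (const_mx 3))) /(congr1 (@complex.Re R)) /= h.
  have := @box_bump_gt0 R n a b 1 (const_mx 3) ltr01; rewrite h ltxx => H.
  suff : false by []; apply: H => i; rewrite !mxE; apply/andP; split; lra.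
apply: (@le_trans _ _ (L2_norm Xi (toeplitz f p) / L2_norm Xi p)%E); last first.
  by apply: ereal_sup_ubound; exists p.
by rewrite mule_ge0 ?inve_ge0 ?Lnorm_ge0.
Qed.

(** The formula $\int h(z)\hat\varphi(-z)\,dz$ makes sense for Schwartz [phi] and is continuous by
    [fourier_seminorm_le]. On a Fourier transform it reduces to $\int h\varphi$ by inversion. *)
Lemma symbol_extension f (h : V -> R[i]) (M : R) : cmeas h -> 0 <= M -> (forall x, cabs (h x) <= M) ->
  symbol_of f h -> exists T, tempered_extension f T /\ given_by (fourier_tempered T) h.
Proof.
move=> mh M0 hM fh; pose T phi := Cint mu (fun z => h z * fourier phi (- z)).
have iF phi : schwartz phi -> cint mu (fun z => fourier phi (- z)).
  move=> /schwartzP rp; have := cint_reflect 0 (fourier_rapid_cint rp).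
  by congr cint; apply/funext => z; rewrite sub0r.
have ihF phi : schwartz phi -> cint mu (fun z => h z * fourier phi (- z)).
  by move=> /iF i; have := cintM i mh hM; congr cint; apply/funext => z; rewrite mulrC.
exists T; split; first split; first split.
- move=> a phi psi sphi spsi; rewrite /T -CintZ; last exact: ihF.
  rewrite -CintD; [|by apply: cintZ; exact: ihF|exact: ihF].
  congr Cint; apply/funext => z.
  have i1 := rapid_cint0 ((schwartzP _).1 sphi); have i2 := rapid_cint0 ((schwartzP _).1 spsi).
  have -> : fourier (fun x => a * phi x + psi x) (- z) = a * fourier phi (- z) + fourier psi (- z).
    rewrite !fourierE -CintZ; last exact: cint_cisN.
    rewrite -CintD; [|by apply: cintZ; exact: cint_cisN|exact: cint_cisN].
    by congr Cint; apply/funext => x; rewrite mulrDl mulrA.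
  by rewrite mulrDr mulrCA.
- have [C C0 hC] := @fourier_seminorm_le R n; exists (M * C), (2 * n)%N, (2 * n)%N => phi sphi.
  have fs : seminorm (2 * n) (2 * n) phi \is a fin_num.
    by rewrite ge0_fin_numE ?seminorm_ge0//; case: sphi.
  rewrite -(fineK fs) -EFinM lee_fin -mulrA.
  apply: le_trans (ler_wpM2l M0 (hC _ sphi)).
  have iFr := fourier_rapid_cint ((schwartzP _).1 sphi).
  have -> : \int[mu]_z cabs (fourier phi z) = \int[mu]_z cabs (fourier phi (- z)).
    have ia := cint_real (cint_cabs iFr).
    have H := Cint_reflect 0 ia; rewrite !Cint_real in H.
    rewrite -[LHS](congr1 (@complex.Re R) H).
    by apply: eq_Rintegral => z _; rewrite sub0r.
  rewrite -RintegralZl//; last exact: cint_cabs (iF _ sphi).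
  apply: cabs_Cint_le_ub.
  + exact: cint_meas (ihF _ sphi).
  + by apply: rintZ; exact: cint_cabs (iF _ sphi).
  + by move=> z; rewrite cabsM ler_wpM2r ?cabs_ge0.
- by move=> phi tphi; rewrite /T -fh.
move=> phi sphi; rewrite /fourier_tempered /= /T.
by congr Cint; apply/funext => z; rewrite fourier_fourierN//; exact/schwartzP.
Qed.

End toeplitz_symbol.

(** * The boundedness criterion and the norm identity *)

Theorem corollary6p2 (R : realType) (d : nat) (d_ge1 : (1 <= d)%N)
    (Xi : set 'rV[R]_d) (Xi_open : open Xi) (Xi_connected : connected Xi)
    (Xi_lower : [set x : 'rV[R]_d | forall i, 1 < x ord0 i] `<=` Xi)
    (Xi_upper : Xi `<=` [set x : 'rV[R]_d | forall i, 0 < x ord0 i])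
    (f : ('rV[R]_d -> R[i]) -> R[i]) (f_distr : is_distribution f) :
  (toeplitz_bounded Xi f <->
   exists T : ('rV[R]_d -> R[i]) -> R[i], tempered_extension f T /\
     exists h : 'rV[R]_d -> R[i], Linfty h /\ given_by (fourier_tempered T) h)
  /\
  (toeplitz_bounded Xi f ->
   forall (T : ('rV[R]_d -> R[i]) -> R[i]) (h : 'rV[R]_d -> R[i]),
     tempered_extension f T -> Linfty h -> given_by (fourier_tempered T) h ->
     toeplitz_norm Xi f = Linfty_norm h).
Proof.
have mXi : measurable Xi by exact: open_measurable_row.
have N0 := @toeplitz_norm_ge0 R d Xi f mXi Xi_lower.
have Linfty_bound (h : 'rV[R]_d -> R[i]) : Linfty h ->
    Linfty_norm h = (fine (Linfty_norm h))%:E /\ 0 <= fine (Linfty_norm h).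
  move=> [_ hoo]; have h0 : (0 <= Linfty_norm h)%E by exact: Lnorm_ge0.
  by rewrite fineK ?fine_ge0// ge0_fin_numE.
have upper T h : tempered_extension f T -> Linfty h -> given_by (fourier_tempered T) h ->
    (toeplitz_norm Xi f <= Linfty_norm h)%E.
  move=> fT Lh hh; have [mh _] := Lh; have [hE h0] := Linfty_bound h Lh.
  have hK : {ae @lebesgue_row R d, forall x, ComplexField.Normc.normc (h x) <= fine (Linfty_norm h)}.
    by apply/Linfty_normP; rewrite // -hE.
  have [h' [mh' hK' fh' _]] := symbol_bounded mh h0 (tempered_symbol fT hh) hK.
  by rewrite hE; exact: toeplitz_norm_le fh'.
split; last first.
  move=> bd T h fT Lh hh; apply/eqP; rewrite eq_le (upper T h)//=.
  have [mh _] := Lh; have [hE h0] := Linfty_bound h Lh.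
  have Nfin : toeplitz_norm Xi f \is a fin_num by rewrite ge0_fin_numE.
  have hK : {ae @lebesgue_row R d, forall x, ComplexField.Normc.normc (h x) <= fine (Linfty_norm h)}.
    by apply/Linfty_normP; rewrite // -hE.
  have [h' [mh' hK' fh' hh']] := symbol_bounded mh h0 (tempered_symbol fT hh) hK.
  (* [symbol_le] needs a strictly positive bound, so it is applied to the operator norm plus [e];
     this includes the case of norm 0. *)
  rewrite -(fineK Nfin); apply/lee_addgt0Pr => e e0.
  have M0 : 0 < fine (toeplitz_norm Xi f) + e by rewrite ltr_wpDl// fine_ge0.
  rewrite -EFinD; apply/Linfty_normP; first exact: ltW.
  have NM : (toeplitz_norm Xi f <= (fine (toeplitz_norm Xi f) + e)%:E)%E.
    by rewrite EFinD fineK// leeDl// lee_fin ltW.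
  have := symbol_le f_distr mXi Xi_lower mh' hK' fh' M0 NM.
  by apply: filterS2 hh' => x ->.
split=> [bd|[T [fT [h [Lh hh]]]]]; last first.
  by apply: (le_lt_trans (upper T h fT Lh hh)); case: Lh.
have Nfin : toeplitz_norm Xi f \is a fin_num by rewrite ge0_fin_numE.
(* Only the existence of a bounded symbol is at stake here, so any positive bound serves; adding 1
   ensures positivity. *)
pose M := fine (toeplitz_norm Xi f) + 1.
have M0 : 0 < M by rewrite ltr_wpDl// fine_ge0.
have NM : (toeplitz_norm Xi f <= M%:E)%E by rewrite EFinD fineK// leeDl// lee_fin.
have fM := (toeplitz_normP f_distr mXi (ltW M0)).1 NM.
have [h [mh hM fh]] := spectral_density f_distr M0 (sqnorm_toeplitz f_distr mXi Xi_lower fM).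
have [T [fT hh]] := symbol_extension mh (ltW M0) hM fh.
exists T; split => //; exists h; split => //; split => //.
apply: (@le_lt_trans _ _ M%:E); last exact: ltry.
by apply/Linfty_normP; [exact: ltW|exact: nearW].
Qed.
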